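(* Let $\Omega\subset\mathbb{R}^d$ be an open set whose boundary is of class $C^1$. Let $\Phi$ be a Musielak-Orlicz function on $\Omega$ satisfying both condition (A1) and condition $\Delta_2$. Then the set of restrictions to $\Omega$ of functions from $C_C^\infty(\mathbb{R}^d)$ is dense in the Musielak-Orlicz-Sobolev space $W^{1,\Phi}(\Omega)$.
   Context: Functions are complex valued; $C_C^\infty(\mathbb{R}^d)$ is the set of smooth compactly supported functions on $\mathbb{R}^d$; $|A|$ is the Lebesgue measure of $A$; $L^0(A)$ is the set of Lebesgue measurable functions $A\to\mathbb{C}$. Musielak-Orlicz (MO) function: for measurable $A\subset\mathbb{R}^d$, a function $\Phi:A\times[0,\infty)\to[0,\infty)$ such that (a) for every $x\in A$, $t\mapsto\Phi(x,t)$ is convex; (b) for every $x\in A$, $\Phi(x,t)=0$ if and only if $t=0$; (c) for every $t\in[0,\infty)$, $x\mapsto\Phi(x,t)$ is Lebesgue measurable on $A$. $\Phi^{-1}(x,\cdot)$ denotes the inverse of $t\mapsto\Phi(x,t)$. Condition $\Delta_2$: there exist a constant $C>0$ and a positive function $h\in L^1(A)$ such that $\Phi(x,2t)\le C\Phi(x,t)+h(x)$ for all $t\ge0$ and a.a. $x\in A$. Condition (A1) (for $\Phi$ on an open set $\Omega$): there exist $\beta,\delta\in(0,1)$ such that for all open balls $B\subset\mathbb{R}^d$ with $|B|<\delta$ and almost all $x,y\in B\cap\Omega$, $\Phi(x,\beta t)\le\Phi(y,t)$ whenever $t\in[\Phi^{-1}(y,1),\Phi^{-1}(y,1/|B|)]$.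 (Conditions (A1) and $\Delta_2$ together imply that $\Phi$ is locally integrable on $\Omega$, i.e. $\int_K\Phi(x,\lambda)\,dx<\infty$ for all compact $K\subset\Omega$ and $\lambda>0$.) Spaces: $I_\Phi(f)=\int_A\Phi(x,|f(x)|)\,dx$; $L^\Phi(A)=\{f\in L^0(A):\exists\lambda>0,\ I_\Phi(\lambda f)<\infty\}$ with norm $\|f\|_\Phi=\inf\{\lambda>0: I_\Phi(f/\lambda)\le1\}$. For $\Omega$ open and $\Phi$ a locally integrable MO function, $W^{1,\Phi}(\Omega)$ is the set of weakly differentiable $f\in L^1_{loc}(\Omega)$ (weak derivatives in $L^1_{loc}(\Omega)$) with $\partial^\alpha f\in L^\Phi(\Omega)$ for all multi-indices $|\alpha|\le1$, with norm $\|f\|_{W^{1,\Phi}}=\sum_{|\alpha|\le1}\|\partial^\alpha f\|_\Phi$. Boundary of class $C^1$: write $x=(x',x_d)$ with $x'=(x_1,\dots,x_{d-1})\in\mathbb{R}^{d-1}$. For $r>0$ let $Q(0,r)=\{y\in\mathbb{R}^d:|y_i|<r,\ i=1,\dots,d\}$ and $Q_{d-1}(0,r)=\{y'\in\mathbb{R}^{d-1}:|y_i|<r,\ i=1,\dots,d-1\}$. A rigid motion is a map $T(x)=Rx+c$ with $R$ a rotation of $\mathbb{R}^d$ and $c\in\mathbb{R}^d$. The boundary $\operatorname{bd}(\Omega)$ is of class $C^1$ if for every $x_0\in\operatorname{bd}(\Omega)$ there exist an open neighborhood $U$ of $x_0$, a rigid motion $T$, a number $r>0$ and a (real-valued) function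 $\mathfrak{f}\in C^1(Q_{d-1}(0,r))$ such that $T(x_0)=0$ and $T(\Omega\cap U)=\{y\in Q(0,r): y_d>\mathfrak{f}(y')\}$. *)

(* Defs.v *)
From HB Require Import structures.
From mathcomp Require Import all_boot all_order all_algebra.
From mathcomp.real_closed Require Import complex.
From mathcomp Require Import all_classical all_reals all_analysis.

Set Implicit Arguments.
Unset Strict Implicit.
Unset Printing Implicit Defensive.
Import Order.TTheory GRing.Theory Num.Theory.
Import numFieldNormedType.Exports.

Local Open Scope classical_set_scope.
Local Open Scope ring_scope.

Lemma product_sigma_finite d1 d2 (T1 : measurableType d1)
    (T2 : measurableType d2) (R : realType)
    (m1 : {sigma_finite_measure set T1 -> \bar R})
    (m2 : {sigma_finite_measure set T2 -> \bar R}) :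
  sigma_finite setT (m1 \x m2)%E.
Proof.
have /sigma_finiteP[F [TF ndF Foo]] := sigma_finiteT m1.
have /sigma_finiteP[G [TG ndG Goo]] := sigma_finiteT m2.
exists (fun n => F n `*` G n).
  rewrite -setXTT TF TG predeqE => -[x y]; split.
    move=> [/= [n _ Fnx] [k _ Gky]]; exists (maxn n k) => //; split.
    - by move: x Fnx; exact/subsetPset/ndF/leq_maxl.
    - by move: y Gky; exact/subsetPset/ndG/leq_maxr.
  by move=> [n _ []/= ? ?]; split; exists n.
move=> k; have [? ?] := Foo k; have [? ?] := Goo k.
split; first exact: measurableX.
by rewrite product_measure1E// lte_mul_pinfty// ge0_fin_numE.
Qed.

Section BorelRowVectors.
Context {R : realType} (n : nat).

Definition rV_borel : set (set 'rV[R]_n) :=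
  g_sigma_preimage (fun (i : 'I_n) (x : 'rV[R]_n) => (x 0 i : measurableTypeR R)).

Let rV_borel0 : rV_borel set0.
Proof. exact: sigma_algebra0. Qed.

Let rV_borelC A : rV_borel A -> rV_borel (~` A).
Proof. exact: sigma_algebraC. Qed.

Let rV_borel_bigcup (F : (set 'rV[R]_n)^nat) :
  (forall i, rV_borel (F i)) -> rV_borel (\bigcup_i F i).
Proof. exact: sigma_algebra_bigcup. Qed.

HB.instance Definition _ := @isMeasurable.Build default_measure_display
  'rV[R]_n rV_borel rV_borel0 rV_borelC rV_borel_bigcup.

Lemma measurable_coord (i : 'I_n) :
  measurable_fun setT (fun x : 'rV[R]_n => (x 0 i : measurableTypeR R)).
Proof.
move=> _ Y mY; rewrite setTI; apply: sub_sigma_algebra => /=.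
rewrite -bigcup_seq/=; exists i => /=; first by rewrite mem_index_enum.
by exists Y => //; rewrite setTI.
Qed.

Lemma measurable_fun_rV d (T : measurableType d) (f : T -> 'rV[R]_n) :
  (forall i, measurable_fun setT (fun t => (f t 0 i : measurableTypeR R))) ->
  measurable_fun setT f.
Proof.
move=> mf _ A mA; rewrite setTI.
suff : rV_borel `<=` [set B | measurable (f @^-1` B)] by apply.
apply: smallest_sub.
  split => /=.
  - by rewrite preimage_set0.
  - by move=> B mB; rewrite setTD preimage_setC; exact: measurableC.
  - by move=> F mF; rewrite preimage_bigcup; exact: bigcup_measurable.
rewrite -bigcup_seq => B [i _] [C mC <-] /=; rewrite setTI.
by rewrite -[X in measurable X]setTI; exact: mf.
Qed.

End BorelRowVectors.

Section Lebesgue.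
Context {R : realType}.

Definition rV_cons n (p : measurableTypeR R * 'rV[R]_n) : 'rV[R]_n.+1 :=
  \row_(i < n.+1) oapp (fun j => p.2 0 j) p.1 (unlift ord0 i).

Lemma measurable_rV_cons n : measurable_fun setT (@rV_cons n).
Proof.
apply: measurable_fun_rV => i; case: (unliftP ord0 i) => [j ->|->].
  rewrite (_ : (fun t => _) = (fun x : 'rV[R]_n => x 0 j) \o snd); last first.
    by apply/funext => p /=; rewrite mxE liftK.
  by apply: measurableT_comp => //; exact: measurable_coord.
rewrite (_ : (fun t => _) = fst)//.
by apply/funext => p /=; rewrite mxE unlift_none.
Qed.

Definition rV_uncons n (x : 'rV[R]_n.+1) : measurableTypeR R * 'rV[R]_n :=
  (x 0 ord0, \row_i x 0 (lift ord0 i)).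

Lemma measurable_rV_uncons n : measurable_fun setT (@rV_uncons n).
Proof.
apply: measurable_fun_pair; first exact: measurable_coord.
apply: measurable_fun_rV => i.
rewrite (_ : (fun t => _) = fun x : 'rV[R]_n.+1 => x 0 (lift ord0 i)).
  exact: measurable_coord.
by apply/funext => x /=; rewrite mxE.
Qed.

Lemma rV_unconsK n : cancel (@rV_uncons n) (@rV_cons n).
Proof.
move=> x; apply/rowP => i; rewrite mxE.
by case: (unliftP ord0 i) => [j ->|->]; rewrite ?liftK ?unlift_none//= mxE.
Qed.

Lemma rV_consK n : cancel (@rV_cons n) (@rV_uncons n).
Proof.
move=> [a x]; rewrite /rV_uncons mxE unlift_none /=; congr pair.
by apply/rowP => i; rewrite !mxE liftK.
Qed.

Section step.
Context n (mu : {sigma_finite_measure set 'rV[R]_n -> \bar R}).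

Definition rV_prod : set 'rV[R]_n.+1 -> \bar R :=
  pushforward (@lebesgue_measure R \x mu)%E (@rV_cons n).

Let mpreimage A : measurable A -> measurable (@rV_cons n @^-1` A).
Proof.
by move=> mA; rewrite -[X in measurable X]setTI; exact: measurable_rV_cons.
Qed.

Let rV_prod0 : rV_prod set0 = 0%E.
Proof. by rewrite /rV_prod /pushforward preimage_set0 measure0. Qed.

Let rV_prod_ge0 A : (0 <= rV_prod A)%E.
Proof. exact: (measure_ge0 (lebesgue_measure \x mu)%E). Qed.

Let rV_prod_sigma_additive : semi_sigma_additive rV_prod.
Proof.
move=> F mF tF mUF; rewrite /rV_prod /pushforward preimage_bigcup.
apply: measure_semi_sigma_additive.
- by move=> k; exact: mpreimage.
- apply/trivIsetP => /= i j _ _ ij; rewrite -preimage_setI.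
  by move/trivIsetP : tF => /(_ _ _ _ _ ij) ->//; rewrite preimage_set0.
- by rewrite -preimage_bigcup; exact: mpreimage.
Qed.

HB.instance Definition _ := isMeasure.Build _ _ _
  rV_prod rV_prod0 rV_prod_ge0 rV_prod_sigma_additive.

Let rV_prod_sigma_finite : sigma_finite setT rV_prod.
Proof.
have [F FT Fm] : sigma_finite setT (@lebesgue_measure R \x mu)%E.
  exact: product_sigma_finite.
exists (fun k => @rV_uncons n @^-1` F k).
  by rewrite -preimage_bigcup -FT preimage_setT.
move=> k; have [mF Foo] := Fm k; split.
  by rewrite -[X in measurable X]setTI; exact: measurable_rV_uncons.
rewrite /rV_prod /pushforward -comp_preimage.
by rewrite (_ : _ \o _ = id) ?preimage_id//; apply/funext => p /=; rewrite rV_consK.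
Qed.

HB.instance Definition _ :=
  @Measure_isSigmaFinite.Build _ _ _ rV_prod rV_prod_sigma_finite.
End step.

(* n-fold product of the one-dimensional Lebesgue measure, on Borel sets *)
Fixpoint borel_lebesgue n : {sigma_finite_measure set 'rV[R]_n -> \bar R} :=
  match n with
  | 0 => \d_(0 : 'rV[R]_0)
  | m.+1 => rV_prod (borel_lebesgue m)
  end.

(* R^n with the sigma-algebra of Lebesgue measurable sets, obtained as the
   Caratheodory measurable sets of the outer measure induced by the product
   measure; leb is therefore complete (leb_is_complete below). The instance on
   'rV[R]_n itself is the Borel sigma-algebra. *)
Definition RdL n := caratheodory_type ((@borel_lebesgue n)^*)%mu.
HB.instance Definition _ n := Measurable.on (RdL n).

Definition leb n : set (RdL n) -> \bar R :=
  @completed_measure_extension _ _ _ (borel_lebesgue n).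
HB.instance Definition _ n := Measure.on (@leb n).

Let leb_sigma_finite n : sigma_finite setT (@leb n).
Proof.
exact: (completed_measure_extension_sigma_finite (sigma_finiteT (borel_lebesgue n))).
Qed.

HB.instance Definition _ n :=
  @Measure_isSigmaFinite.Build _ _ _ (@leb n) (@leb_sigma_finite n).

Lemma leb_is_complete n : measure_is_complete (@leb n).
Proof. exact: measure_is_complete_caratheodory. Qed.

End Lebesgue.

Arguments RdL : clear implicits.
Arguments leb : clear implicits.

Section LebesgueBox.
Context {R : realType}.

Lemma measurable_box n (A : 'I_n -> set (measurableTypeR R)) :
  (forall i, measurable (A i)) ->
  measurable [set x : 'rV[R]_n | forall i, A i (x 0 i)].
Proof.
move=> mA; rewrite (_ : mkset _ = \bigcap_(i in [set: 'I_n])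
    ((fun x : 'rV[R]_n => (x 0 i : measurableTypeR R)) @^-1` A i)).
  apply: fin_bigcap_measurable => // i _.
  by rewrite -[X in measurable X]setTI; exact: measurable_coord.
by apply/seteqP; split=> x /= Ax i; [move=> _|]; exact: Ax.
Qed.

Lemma leb_box n (A : 'I_n -> set (measurableTypeR R)) :
  (forall i, measurable (A i)) ->
  leb R n [set x : RdL R n | forall i, A i (x 0 i)] =
  (\prod_(i < n) lebesgue_measure (A i))%E.
Proof.
move=> mA; rewrite /leb /completed_measure_extension measurable_mu_extE/=; last first.
  exact: measurable_box.
elim: n A mA => [|n IHn] A mA.
  by rewrite big_ord0 /= diracE mem_set// => -[].
have mB : measurable [set x : 'rV[R]_n | forall i, A (lift ord0 i) (x 0 i)].
  by apply: (@measurable_box _ (fun i => A (lift ord0 i))) => i; exact: mA.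
rewrite big_ord_recl /= -(IHn (fun i => A (lift ord0 i)))// -(product_measure1E _ (borel_lebesgue n))//.
rewrite /rV_prod /pushforward; congr (_ _); apply/seteqP; split=> -[x y] /=.
  move=> Axy; split; first by have := Axy ord0; rewrite mxE unlift_none.
  by move=> i; have := Axy (lift ord0 i); rewrite mxE liftK.
move=> [Ax Ay] i; rewrite mxE.
by case: (unliftP ord0 i) => [j ->|->] /=.
Qed.

End LebesgueBox.

Section MusielakOrlicz.
Context {R : realType} (d : nat).
Local Notation Rd := 'rV[R]_d.
Local Notation mu := (leb R d).
Local Notation normc := ComplexField.Normc.normc.
Local Open Scope complex_scope.
Implicit Types (A Omega : set Rd) (Phi : Rd -> R -> R).
Implicit Types (f g phi : Rd -> R[i]).

(* A function on a subset A of R^d is represented by a function on R^d whose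
   values outside A are irrelevant. *)

Definition cmeasurable_fun A f :=
  measurable_fun (A : set (RdL R d)) (fun x : RdL R d => complex.Re (f x)) /\
  measurable_fun (A : set (RdL R d)) (fun x : RdL R d => complex.Im (f x)).

Definition cintegral A f : R[i] :=
  (\int[mu]_(x in A) complex.Re (f x))%R +i* (\int[mu]_(x in A) complex.Im (f x))%R.

Definition L1loc Omega f :=
  cmeasurable_fun Omega f /\
  forall K : set Rd, compact K -> K `<=` Omega ->
    (\int[mu]_(x in K) (normc (f x))%:E < +oo)%E.

Definition MO_function A Phi :=
  [/\ forall x t, A x -> 0 <= t -> 0 <= Phi x t,
      forall x, A x -> @convex_function R R^o `[0, +oo[%classic (Phi x),
      forall x t, A x -> 0 <= t -> (Phi x t = 0 <-> t = 0) &
      forall t, 0 <= t ->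
        measurable_fun (A : set (RdL R d)) (fun x : RdL R d => Phi x t)].

Definition MO_inv Phi (x : Rd) (s : R) : R :=
  xget 0 [set t | 0 <= t /\ Phi x t = s].

Definition Delta2 A Phi :=
  exists (C : R) (h : Rd -> R),
    [/\ 0 < C,
        forall x, A x -> 0 < h x,
        mu.-integrable A (EFin \o h) &
        forall t, 0 <= t ->
          {ae mu, forall x, A x -> Phi x (2 * t) <= C * Phi x t + h x}].

(* The norm of 'rV[R]_d in the library is the sup norm. *)
Definition open_eball (c : Rd) (r : R) : set Rd :=
  [set x | Num.sqrt (\sum_(i < d) (x 0 i - c 0 i) ^+ 2) < r].

Definition A1 Omega Phi :=
  (* "almost all x, y" is read as: all x, y outside a common null set *)
  exists beta delta : R,
    [/\ 0 < beta < 1, 0 < delta < 1 &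
     forall (c : Rd) (r : R), 0 < r ->
       let B := open_eball c r in
       (mu B < delta%:E)%E ->
       exists2 N : set (RdL R d), mu.-negligible N &
         forall x y, (B `&` Omega `\` N) x -> (B `&` Omega `\` N) y ->
         forall t,
           MO_inv Phi y 1 <= t <= MO_inv Phi y (fine (mu B))^-1 ->
           Phi x (beta * t) <= Phi y t].

Definition modular A Phi f : \bar R :=
  (\int[mu]_(x in A) (Phi x (normc (f x)))%:E)%E.

Definition LPhi A Phi : set (Rd -> R[i]) :=
  [set f | cmeasurable_fun A f /\
     exists2 l : R, 0 < l & (modular A Phi (fun x => (l%:C * f x)%R) < +oo)%E].

(* The infimum over the empty set is +oo. *)
Definition LPhi_norm A Phi f : \bar R :=
  ereal_inf [set l%:E | l in
    [set l : R | 0 < l /\ (modular A Phi (fun x => (f x / l%:C)%R) <= 1)%E]].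

Definition rpartial (j : 'I_d) (u : Rd -> R) : Rd -> R :=
  'D_(delta_mx 0 j) u.

Definition rsmooth (u : Rd -> R) :=
  forall s : seq 'I_d, let v := foldr rpartial u s in
    continuous v /\ forall j x, derivable v x (delta_mx 0 j).

Definition partial (j : 'I_d) f : Rd -> R[i] :=
  fun x => rpartial j (fun y => complex.Re (f y)) x +i* rpartial j (fun y => complex.Im (f y)) x.

Definition support f : set Rd := closure [set x | f x != 0].

Definition Ccinfty : set (Rd -> R[i]) :=
  [set phi | [/\ rsmooth (fun x => complex.Re (phi x)), rsmooth (fun x => complex.Im (phi x)) &
                 compact (support phi)]].

Definition is_weak_partial Omega (j : 'I_d) f g :=
  L1loc Omega g /\
  forall phi, Ccinfty phi -> support phi `<=` Omega ->
    cintegral Omega (fun x => f x * partial j phi x) =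
    - cintegral Omega (fun x => g x * phi x).

Definition weakly_differentiable Omega f :=
  L1loc Omega f /\ forall j, exists g, is_weak_partial Omega j f g.

(* A weak derivative is only determined up to a null set: some representative
   is chosen. *)
Definition weak_partial Omega (j : 'I_d) f : Rd -> R[i] :=
  xget (cst 0) (is_weak_partial Omega j f).

Definition W1Phi Omega Phi : set (Rd -> R[i]) :=
  [set f | [/\ weakly_differentiable Omega f, LPhi Omega Phi f &
               forall j, LPhi Omega Phi (weak_partial Omega j f)]].

Definition W1Phi_norm Omega Phi f : \bar R :=
  (LPhi_norm Omega Phi f +
   \sum_(j < d) LPhi_norm Omega Phi (weak_partial Omega j f))%E.

Definition restriction Omega f : Rd -> R[i] := patch (cst 0) Omega f.

Definition W1Phi_dense Omega Phi (D : set (Rd -> R[i])) :=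
  D `<=` W1Phi Omega Phi /\
  forall f, W1Phi Omega Phi f -> forall eps : R, 0 < eps ->
    exists2 g, D g & (W1Phi_norm Omega Phi (fun x => (f x - g x)%R) < eps%:E)%E.

End MusielakOrlicz.
Arguments Ccinfty {R d}.

Section BoundaryC1.
Context {R : realType}.

Definition cube n (r : R) : set 'rV[R]_n := [set y | forall i, `|y 0 i| < r].

Definition C1_on n (Q : set 'rV[R]_n) (u : 'rV[R]_n -> R) :=
  forall y, Q y -> {for y, continuous u} /\
    forall j : 'I_n, derivable u y (delta_mx 0 j) /\
                     {for y, continuous (rpartial j u)}.

Definition rotation n (M : 'M[R]_n) := M *m M^T = 1%:M /\ \det M = 1.

Definition bd n (Omega : set 'rV[R]_n) : set 'rV[R]_n :=
  closure Omega `\` interior Omega.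

Definition hd_coords d (y : 'rV[R]_d.+1) : 'rV[R]_d :=
  \row_(i < d) y 0 (lift ord_max i).

Definition C1_boundary d (Omega : set 'rV[R]_d.+1) :=
  forall x0, bd Omega x0 ->
  exists (U : set 'rV[R]_d.+1) (M : 'M[R]_d.+1) (c : 'rV[R]_d.+1) (r : R)
         (ff : 'rV[R]_d -> R),
    let T := fun x : 'rV[R]_d.+1 => x *m M + c in
    [/\ open_nbhs x0 U, rotation M, 0 < r, C1_on (@cube d r) ff &
        T x0 = 0 /\
        T @` (Omega `&` U) =
          [set y | @cube d.+1 r y /\ ff (hd_coords y) < y 0 ord_max]].

End BoundaryC1.

(* Main.v *)
(* (A1) and Delta2 give a Jensen-type inequality for [Phi] at nearby points, from which
   convolution with a kernel concentrated at a small scale r is bounded in the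
   modular, uniformly in r. Hence, by density of Lipschitz functions, mollifications of
   a boundedly supported function in L^Phi converge to it in L^Phi. For a Sobolev
   function, one first cuts off at infinity (dominated convergence), then localizes. Near
   a point of R^d the domain satisfies x + s (nu + w) in Omega for x in Omega, small s > 0
   and small w: at boundary points because Omega is locally the supergraph of a Lipschitz
   function. Mollifying with kernels supported around s nu therefore only uses values
   inside Omega, commutes with weak derivatives on Omega, and produces functions that are
   smooth on the whole of R^d. *)
Require Import Defs.
From HB Require Import structures.
From mathcomp Require Import all_boot all_order all_algebra.
From mathcomp.real_closed Require Import complex.
From mathcomp Require Import all_classical all_reals all_analysis.
From mathcomp Require Import measurable_realfun.
From mathcomp Require Import ring lra.
Set Implicit Arguments.
Unset Strict Implicit.
Unset Printing Implicit Defensive.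
Import Order.TTheory GRing.Theory Num.Theory.
Import numFieldNormedType.Exports.
Local Open Scope classical_set_scope.
Local Open Scope ring_scope.

(** * Lebesgue measure on row vectors *)

(** Both ends of this range shape the estimates. Below 1 the comparison is silent, hence the maxima
    with 1 in the pointwise bounds; they cost the volume of the support, which must therefore be
    bounded. Above [1 / |B|] it is silent again, hence a kernel has height at most [K / |B|] and the
    modular of the mollified function is first made smaller than [1 / K]. This smallness is reached
    by scaling, and convexity then turns the estimate into a norm bound. The analysis is carried out
    for real functions extended by zero, each accompanied by its weak gradient as explicit data;
    real and imaginary parts are joined only at the end. As [weak_partial] is an arbitrarily chosen
    representative, uniqueness almost everywhere is then needed. *)

Section row_vectors.
Context {R : realType} {n : nat}.
Implicit Types (x y : 'rV[R]_n) (r : R).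

Lemma coord_le_norm x i : `|x 0 i| <= `|x|.
Proof.
rewrite [leRHS]/Num.norm/= mx_normrE.
by apply: (le_trans _ (le_bigmax _ _ (0, i))).
Qed.

Lemma norm_rV_ltP x r : 0 < r -> `|x| < r <-> forall i, `|x 0 i| < r.
Proof.
move=> r0; split=> [xr i|xr]; first exact: le_lt_trans (coord_le_norm _ _) xr.
rewrite [ltLHS]/Num.norm/= mx_normrE; apply/bigmax_ltP; split=> // -[i j] _ /=.
by rewrite ord1.
Qed.

Lemma norm_rV_leP x r : 0 <= r -> `|x| <= r <-> forall i, `|x 0 i| <= r.
Proof.
move=> r0; split=> [xr i|xr]; first exact: le_trans (coord_le_norm _ _) xr.
rewrite [leLHS]/Num.norm/= mx_normrE; apply/bigmax_leP; split=> // -[i j] _ /=.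
by rewrite ord1.
Qed.

Lemma rat_rV_dense x r : 0 < r -> exists q : 'rV[rat]_n, `|x - map_mx ratr q| < r.
Proof.
move=> r0.
have H i : exists q : rat, `|x 0 i - ratr q| < r.
  have [q] := rat_in_itvoo (x := x 0 i - r) (y := x 0 i + r) ltac:(lra).
  rewrite in_itv/= => /andP[q1 q2]; exists q.
  by rewrite ltr_norml; apply/andP; split; lra.
exists (\row_i projT1 (cid (H i))); apply/norm_rV_ltP => // i.
by rewrite !mxE; case: cid.
Qed.

End row_vectors.

Section measurable_RdL.
Context {R : realType} {n : nat}.
Local Notation Rn := 'rV[R]_n.

Lemma borel_RdL (A : set Rn) : measurable A -> measurable (A : set (RdL R n)).
Proof. exact: caratheodory_measurable_mu_ext. Qed.

(** Sup-norm balls with rational centre and radius are products of intervals, and an open set is the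
    union of the countably many of them that it contains. *)
Lemma open_borel (A : set Rn) : open A -> measurable A.
Proof.
move=> oA.
pose P (p : 'rV[rat]_n * rat) :=
  [set x : Rn | forall i, ball (ratr (p.1 0 i) : R) (ratr p.2) (x 0 i)].
have -> : A = \bigcup_p (if `[< P p `<=` A >] then P p else set0).
  apply/seteqP; split=> [x Ax|x [p _ /=]]; last by case: asboolP => // pA /pA.
  have : nbhs x A by exact: open_nbhs_nbhs.
  move=> /nbhs_normP[e /= e0 eA].
  have e20 : 0 < e / 2 by rewrite divr_gt0.
  have [q] := rat_in_itvoo e20.
  rewrite in_itv/= => /andP[q0 qe].
  have [c xc] := rat_rV_dense x q0.
  exists (c, q) => //; case: asboolP => [_|[]].
    move=> i /=; rewrite -ball_normE /= distrC.
    by have := (norm_rV_ltP _ q0).1 xc i; rewrite !mxE distrC.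
  move=> y /= yc; apply: eA => /=.
  apply/(norm_rV_ltP _ e0) => i; rewrite !mxE.
  have := yc i; rewrite -ball_normE /= => yci.
  have := (norm_rV_ltP _ q0).1 xc i; rewrite !mxE => xci.
  rewrite -(subrKA (ratr (c 0 i))) (le_lt_trans (ler_normD _ _))//.
  rewrite (@lt_le_trans _ _ (ratr q + ratr q))//; first exact: ltrD.
  by move: qe; lra.
apply: countable_bigcupT_measurable => // p; case: ifPn => // _.
apply: (@measurable_box R n (fun i => ball (ratr (p.1 0 i) : R) (ratr p.2))) => i.
exact: measurable_ball.
Qed.

Lemma open_RdL (A : set Rn) : open A -> measurable (A : set (RdL R n)).
Proof. by move=> /open_borel/borel_RdL. Qed.

Lemma continuous_borel (f : Rn -> R) : continuous f ->
  measurable_fun setT (f : Rn -> measurableTypeR R).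
Proof.
move=> cf; apply: (measurability _ (RGenOpens.measurableE R)).
move=> /= _ [_ [a [b ->] <-]]; rewrite setTI; apply: open_borel.
by apply: open_comp => //; exact: interval_open.
Qed.

Lemma continuous_RdL (f : Rn -> R) : continuous f ->
  measurable_fun setT (f : RdL R n -> R).
Proof.
by move=> /continuous_borel mf _ B mB; apply: borel_RdL; exact: mf.
Qed.

End measurable_RdL.

(** * Translations and reflections *)

Section affine_invariance.
Context {R : realType}.

(** One map for the translation [a + y] ([e] false) and the reflection [a - y] ([e] true): a kernel
    [k (y - x)] is integrated over [y] by means of the first and over [x] by means of the second. *)
Definition reflect_shift n (e : bool) (a y : 'rV[R]_n) : 'rV[R]_n :=
  a + (-1) ^+ e *: y.

Let lebesgue_shift (a : R) (A : set (measurableTypeR R)) : measurable A ->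
  lebesgue_measure ((fun t => a + t : measurableTypeR R) @^-1` A) =
  lebesgue_measure A.
Proof.
have ma : measurable_fun setT (fun t : measurableTypeR R => a + t : measurableTypeR R).
  exact: measurable_funD.
move=> mA; have := @lebesgue_measure_unique R
  (pushforward lebesgue_measure (fun t : measurableTypeR R => a + t : measurableTypeR R)).
move=> /(_ ma _ A mA) => h; apply/esym; apply: h => _ [[x y]] _ <- /=.
rewrite /pushforward.
rewrite (_ : _ @^-1` _ = `]x - a, y - a]%classic); last first.
  by apply/seteqP; split=> t /=; rewrite !in_itv/=; lra.
rewrite !lebesgue_measure_itv/= !lte_fin ltrD2r.
by case: ifP => // _; rewrite -!EFinB; congr (_%:E); lra.
Qed.

Let measurable_affine (e : bool) (a : R) :
  measurable_fun setT (fun t : measurableTypeR R => a + (-1) ^+ e * t : measurableTypeR R).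
Proof. by apply: measurable_funD => //; exact: measurable_funM. Qed.

Let measurable_affine_preimage (e : bool) (a : R) (A : set (measurableTypeR R)) :
  measurable A ->
  measurable ((fun t : measurableTypeR R => a + (-1) ^+ e * t : measurableTypeR R) @^-1` A).
Proof.
by move=> mA; rewrite -[X in measurable X]setTI; exact: measurable_affine.
Qed.

Let lebesgue_reflect_shift (e : bool) (a : R) (A : set (measurableTypeR R)) :
  measurable A ->
  lebesgue_measure ((fun t => a + (-1) ^+ e * t : measurableTypeR R) @^-1` A) =
  lebesgue_measure A.
Proof.
move=> mA; rewrite -[RHS](lebesgue_shift a)//.
have E0 : (fun t => a + (-1) ^+ false * t) = (fun t => a + t).
  by apply/funext => t; rewrite expr0 mul1r.
case: e => /=; last by rewrite E0.
rewrite -[RHS]lebesgue_measureN; last first.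
  by rewrite -E0; exact: (measurable_affine_preimage false a mA).
rewrite /pushforward -comp_preimage.
rewrite (_ : (fun t => a + (-1) ^+ true * t) = (fun t => a + t) \o -%R)//.
by apply/funext => t /=; rewrite expr1 mulN1r.
Qed.

Lemma measurable_reflect_shift n e (a : 'rV[R]_n) :
  measurable_fun setT (reflect_shift e a : 'rV[R]_n -> 'rV[R]_n).
Proof.
apply: measurable_fun_rV => i.
rewrite (_ : (fun t => _) = (fun t => a 0 i + (-1) ^+ e * t) \o
    (fun x : 'rV[R]_n => (x 0 i : measurableTypeR R))).
  apply: measurableT_comp; last exact: measurable_coord.
  apply: measurable_funD => //; exact: measurable_funM.
by apply/funext => x /=; rewrite !mxE.
Qed.

Lemma measurable_id_borel n : measurable_fun setT (id : RdL R n -> 'rV[R]_n).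
Proof. by move=> _ B mB; rewrite setTI; exact: borel_RdL. Qed.

Lemma measurable_reflect_shift_RdL n e (a : 'rV[R]_n) :
  measurable_fun setT (reflect_shift e a : RdL R n -> 'rV[R]_n).
Proof.
apply: (@measurableT_comp _ _ _ _ _ _ (reflect_shift e a : 'rV[R]_n -> 'rV[R]_n)).
  exact: measurable_reflect_shift.
exact: measurable_id_borel.
Qed.

Definition boxes n : set (set 'rV[R]_n) :=
  [set B | exists2 A : 'I_n -> set (measurableTypeR R), (forall i, measurable (A i)) &
    B = [set x : 'rV[R]_n | forall i, A i (x 0 i)]].

Lemma rV_borelE n : (@measurable _ 'rV[R]_n) = <<s @boxes n >>.
Proof.
apply/seteqP; split.
  apply: smallest_sub; first exact: smallest_sigma_algebra.
  rewrite -bigcup_seq => B [i _] [C mC <-] /=; rewrite setTI.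
  apply: sub_sigma_algebra; exists (fun j => if j == i then C else setT).
    by move=> j; case: ifP.
  apply/seteqP; split=> x /= Cx.
    by move=> j; case: eqP => [->|].
  by have := Cx i; rewrite eqxx.
apply: smallest_sub; first exact: sigma_algebra_measurable.
by move=> _ [A mA ->]; exact: measurable_box.
Qed.

Lemma boxesI n : setI_closed (@boxes n).
Proof.
move=> _ _ [A mA ->] [B mB ->]; exists (fun i => A i `&` B i).
  by move=> i; exact: measurableI.
by apply/seteqP; split=> x /= => [[Ax Bx] i|ABx]; [split|split=> i; have [] := ABx i].
Qed.

Definition cbox n (k : R) : set 'rV[R]_n := [set x | forall i, `[- k, k]%classic (x 0 i)].

Lemma measurable_cbox n (k : R) : measurable (@cbox n k).
Proof. exact: (@measurable_box R n (fun=> `[- k, k]%classic)). Qed.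

Lemma cboxP n (k : R) : 0 <= k -> @cbox n k = [set x | `|x| <= k].
Proof.
move=> k0; apply/seteqP; split=> x /=.
  move=> h; apply/norm_rV_leP => // i; have := h i.
  by rewrite /= in_itv/= ler_norml.
by move=> /(norm_rV_leP _ k0) h i; rewrite /= in_itv/= -ler_norml.
Qed.

Lemma bigcup_cbox n : \bigcup_(k : nat) @cbox n k%:R = setT.
Proof.
apply/seteqP; split=> // x _; exists (Num.bound `|x|) => //.
rewrite cboxP//=; exact/ltW/archi_boundP.
Qed.

Lemma leb_cbox n (k : R) : 0 <= k -> leb R n (@cbox n k) = ((2 * k) ^+ n)%:E.
Proof.
move=> k0; rewrite (leb_box (A := fun=> `[- k, k]%classic))//.
rewrite (eq_bigr (fun=> (2 * k)%:E)); last first.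
  move=> i _; rewrite lebesgue_measure_itv/= lte_fin; case: ifPn.
    by rewrite -EFinB => _; congr (_%:E); lra.
  by rewrite -leNgt => h; congr (_%:E); lra.
by rewrite prodEFin prodr_const card_ord.
Qed.

Lemma leb_borel n (A : set 'rV[R]_n) : measurable A ->
  leb R n A = borel_lebesgue n A.
Proof. by move=> mA; rewrite /leb /completed_measure_extension measurable_mu_extE. Qed.

(** Uniqueness of measures on the pi-system [boxes], where both sides are products of
    one-dimensional measures. Finiteness on the exhausting cubes holds because the preimage of a
    cube lies in a larger cube. *)
Lemma leb_reflect_shift n e (a : 'rV[R]_n) (A : set 'rV[R]_n) : measurable A ->
  leb R n (reflect_shift e a @^-1` A) = leb R n A.
Proof.
move=> mA; rewrite [RHS]leb_borel//.
have [m mE] : exists m : {measure set 'rV[R]_n -> \bar R}, forall A,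
    m A = leb R n (reflect_shift e a @^-1` A).
  have mf := measurable_reflect_shift_RdL e a.
  by unshelve eexists (pushforward (leb R n) (reflect_shift e a : RdL R n -> 'rV[R]_n)).
rewrite -mE.
apply: (measure_unique (@boxes n) (fun k => cbox k%:R)) => //.
- exact: rV_borelE.
- exact: boxesI.
- by move=> k; exists (fun=> `[- k%:R, k%:R]%classic).
- exact: bigcup_cbox.
- move=> _ [B mB ->]; rewrite mE [RHS](_ : _ = leb R n [set x : RdL R n | forall i, B i (x 0 i)]); last first.
    by rewrite leb_borel//; exact: measurable_box.
  rewrite (leb_box mB).
  have -> : reflect_shift e a @^-1` [set x | forall i, B i (x 0 i)] =
      [set x | forall i, ((fun t => a 0 i + (-1) ^+ e * t) @^-1` B i) (x 0 i)].
    by apply/seteqP; split=> x /= Bx i; have := Bx i; rewrite !mxE.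
  rewrite (@leb_box _ _ (fun i => (fun t => a 0 i + (-1) ^+ e * t) @^-1` B i)).
    by apply: eq_bigr => i _; exact: lebesgue_reflect_shift.
  by move=> i; exact: measurable_affine_preimage.
- move=> k; rewrite mE.
  rewrite (@le_lt_trans _ _ (leb R n (cbox (k%:R + `|a|))))//.
    apply: le_measure; rewrite ?inE.
    + rewrite -[X in measurable X]setTI; apply: measurable_reflect_shift_RdL => //.
      exact: measurable_cbox.
    + by apply: borel_RdL; exact: measurable_cbox.
    + rewrite !cboxP ?addr_ge0// => x /= h.
      have -> : x = (-1) ^+ e *: (reflect_shift e a x - a).
        by rewrite /reflect_shift addrC addKr scalerA -expr2 sqrr_sign scale1r.
      rewrite normrZ normrX normrN1 expr1n mul1r.
      by rewrite (le_trans (ler_normB _ _))// lerD2r.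
  by rewrite leb_cbox ?ltry// addr_ge0.
Qed.

(** For a Borel integrand both sides are integrals against [borel_lebesgue], which is the image of
    [leb] under the affine map and under the identity. *)
Lemma ge0_integral_reflect_shift n e (a : 'rV[R]_n) (f : 'rV[R]_n -> \bar R) :
  measurable_fun setT f -> (forall x, 0 <= f x)%E ->
  (\int[leb R n]_x f (reflect_shift e a x) = \int[leb R n]_x f x)%E.
Proof.
move=> mf f0.
have push (g : RdL R n -> 'rV[R]_n) (mg : measurable_fun setT g) :
  (forall A : set 'rV[R]_n, measurable A -> leb R n (g @^-1` A) = leb R n A) ->
  (\int[leb R n]_x f (g x) = \int[borel_lebesgue n]_x f x)%E.
  move=> gE; rewrite -(@ge0_integral_pushforward _ _ _ _ _ _ mg _ setT)//.
  by apply: eq_measure_integral => A mA _ /=; rewrite /pushforward gE// leb_borel.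
rewrite push; last exact: leb_reflect_shift.
  by rewrite (push id)//; exact: measurable_id_borel.
exact: measurable_reflect_shift_RdL.
Qed.

End affine_invariance.

(** * From Lipschitz functions to bounded measurable functions *)

Section lipschitz_approximation.
Context {R : realType} {n : nat}.
Local Notation Rn := 'rV[R]_n.

(** The measure of [A] is an infimum over countable Borel covers. Covers within [1 / (m + 1)] of the
    infimum are intersected. *)
Lemma borel_hull (A : set (RdL R n)) : measurable A -> (leb R n A < +oo)%E ->
  exists B : set Rn, [/\ measurable B, A `<=` B & leb R n (B `\` A) = 0%E].
Proof.
move=> mA Aoo.
have Afin : leb R n A \is a fin_num by rewrite ge0_fin_numE.
have cover m : exists B : set Rn, [/\ measurable B, A `<=` B &
    (leb R n B <= leb R n A + m.+1%:R^-1%:E)%E].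
  have m0 : 0 < m.+1%:R^-1 :> R by rewrite invr_gt0.
  have [_ [F [mF AF] <-] Fe] := lb_ereal_inf_adherent m0 Afin.
  exists (\bigcup_k F k); split => //.
    exact: bigcup_measurable.
  rewrite leb_borel; last exact: bigcup_measurable.
  apply: le_trans (ltW Fe).
  by apply: measure_sigma_subadditive => //; exact: bigcup_measurable.
have {cover} [B] := choice cover.
move=> /all_and3[mB AB Ble].
have mIB : measurable (\bigcap_k B k : set Rn) by exact: bigcapT_measurable.
exists (\bigcap_k B k); split => //.
  by move=> x Ax k _; exact: AB.
rewrite measureD//; last 2 first.
  exact: borel_RdL.
  rewrite (@le_lt_trans _ _ (leb R n (B 0)))//.
    apply: le_measure; rewrite ?inE; [exact: borel_RdL| |].
      by apply: borel_RdL; exact: mB.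
    by move=> x; apply.
  by rewrite (le_lt_trans (Ble 0))// lte_add_pinfty// ltry.
rewrite (_ : _ `&` A = A); last by apply/setIidr => x Ax k _; exact: AB.
suff h : leb R n (\bigcap_k B k) = leb R n A.
  by rewrite [X in (X - _)%E]h subee.
apply/eqP; rewrite eq_le; apply/andP; split.
  apply/lee_addgt0Pr => e e0.
  have [m me] : exists m : nat, m.+1%:R^-1 < e.
    by exists (Num.trunc e^-1); rewrite invf_plt ?posrE// truncnS_gt.
  apply: (@le_trans _ _ (leb R n (B m))).
    apply: le_measure; rewrite ?inE; [exact: borel_RdL| |by move=> x; apply].
    by apply: borel_RdL; exact: mB.
  by apply: (le_trans (Ble m)); rewrite leeD2l// lee_fin ltW.
apply: le_measure; rewrite ?inE//; first exact: borel_RdL.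
by move=> x Ax k _; exact: AB.
Qed.

Lemma clamp_lipschitz (a b x y : R) :
  `|Num.min a (Num.max b x) - Num.min a (Num.max b y)| <= `|x - y|.
Proof.
have := ler_norm (x - y); have := ler_norm (y - x); rewrite distrC.
move: `|_ - _| => D h1 h2; rewrite ler_norml.
case: (leP b x) => bx; case: (leP b y) => by_;
  repeat match goal with |- context [Num.min a ?u] => case: (leP a u) => ? end;
  apply/andP; split; lra.
Qed.

Lemma max0_lipschitz (u v : R) : `|Num.max 0 u - Num.max 0 v| <= `|u - v|.
Proof.
have := ler_norm (u - v); have := ler_norm (v - u); rewrite distrC.
move: `|_ - _| => D h1 h2; rewrite ler_norml.
case: (leP 0 u) => u0; case: (leP 0 v) => v0; apply/andP; split; lra.
Qed.

(** Orthants are stable under intersection and generate the Borel sets; cut by a cube they become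
    boxes with a coordinatewise projection, hence their indicators are limits of Lipschitz
    functions. *)
Definition upper_orthant (b : 'I_n -> R) := [set x : Rn | forall i, b i <= x 0 i].

Lemma borel_upper_orthants :
  (@measurable _ Rn) = <<s [set A | exists b, A = upper_orthant b] >>.
Proof.
apply/seteqP; split.
  apply: smallest_sub; first exact: smallest_sigma_algebra.
  rewrite -bigcup_seq => B [i _] [C mC <-] /=; rewrite setTI.
  pose G := [set A : set Rn | exists b, A = upper_orthant b].
  suff : measurable_fun setT
      ((fun x => x 0 i) : g_sigma_algebraType G -> measurableTypeR R).
    by move=> /(_ measurableT _ mC); rewrite setTI.
  apply: (measurability _ (RGenCInfty.measurableE R)).
  move=> /= _ [_ [a ->] <-]; rewrite setTI.
  (* A half-space is exhausted by orthants whose other bounds [- m] tend to minus infinity. *)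
  rewrite (_ : _ @^-1` _ = \bigcup_(m : nat)
      upper_orthant (fun j => if j == i then a else - m%:R)).
    apply: bigcupT_measurable => m; apply: sub_sigma_algebra.
    by eexists.
  apply/seteqP; split=> x /=.
    rewrite in_itv/= andbT => ax; exists (Num.bound `|x|) => // j.
    case: eqP => [->//|_]; rewrite lerNl.
    rewrite (le_trans _ (ltW (archi_boundP _)))//.
    by rewrite (le_trans _ (coord_le_norm x j))// -normrN ler_norm.
  by move=> [m _ /(_ i)]; rewrite eqxx in_itv/= andbT.
apply: smallest_sub; first exact: sigma_algebra_measurable.
move=> _ [b ->].
rewrite (_ : upper_orthant b = [set x : Rn | forall i, `[b i, +oo[%classic (x 0 i)]).
  by have := @measurable_box R n (fun i => `[b i, +oo[%classic); apply.
by apply/seteqP; split=> x /= bx i; have := bx i; rewrite /= in_itv/= andbT.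
Qed.

Import HBNNSimple.

(** A functional monotone class argument: Lipschitz functions give boxes, Dynkin's lemma gives Borel
    sets, hulls give Lebesgue sets, simple functions give the rest. The radius grows from [k] to
    [k + 1] because the Lipschitz approximants of an indicator spill over its cube. *)
Lemma lipschitz_class_ind (k : R) (E : (Rn -> R) -> Prop) : 0 <= k ->
  (forall g L, (forall x y, `|g x - g y| <= L * `|x - y|) ->
    (forall x, k + 1 < `|x| -> g x = 0) -> E g) ->
  (forall f g a, E f -> E g -> E (fun x => a * f x + g x)) ->
  (forall (f_ : nat -> Rn -> R) f c, (forall m, E (f_ m)) ->
    (forall m x, `|f_ m x| <= c * \1_(cbox (k + 1)) x) ->
    (forall x, f_ ^~ x @ \oo --> f x) -> E f) ->
  (forall f g, E f -> measurable_fun setT (g : RdL R n -> R) ->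
    (forall x, `|g x| <= \1_(cbox k) x) ->
    {ae leb R n, forall x, f x = g x} -> E g) ->
  forall f c, measurable_fun setT (f : RdL R n -> R) ->
    (forall x, `|f x| <= c * \1_(cbox k) x) -> E f.
Proof.
move=> k0 Elip Elin Elim Eae.
have E0 : E (fun=> 0).
  apply: (Elip _ 0) => // x y; by rewrite subrr normr0 mul0r.
have EZ f a : E f -> E (fun x => a * f x).
  move=> Ef; have := Elin _ _ a Ef E0.
  by under eq_fun do rewrite addr0.
have ED f g : E f -> E g -> E (fun x => f x + g x).
  by move=> Ef Eg; have := Elin _ _ 1 Ef Eg; under eq_fun do rewrite mul1r.
have subc : @cbox R n k `<=` cbox (k + 1).
  by rewrite !cboxP// ?addr_ge0// => x /= xk; lra.
have ind_le (A : set Rn) x : `|\1_(A `&` cbox k) x| <= 1 * \1_(cbox (k + 1)) x :> R.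
  rewrite mul1r !indicE ger0_norm// ler_nat.
  case: (boolP (x \in cbox (k + 1))) => [_|]; first exact: leq_b1.
  rewrite notin_setE => xk; rewrite memNset// => -[_ /subc]; exact: xk.
have Ebx b : E \1_(upper_orthant b `&` cbox k).
  have [[i bik]|/forallNP bk] := pselect (exists i, k < b i).
    rewrite (_ : \1__ = fun=> 0)//; apply/funext => x.
    rewrite indicE memNset// => -[/= /(_ i) h /(_ i)/=]; rewrite in_itv/=; lra.
  have {}bk i : b i <= k by rewrite leNgt; apply/negP/bk.
  (* [p] is the coordinatewise projection onto the box, with Lipschitz constant 1, and [g m]
     decreases to the indicator of its fixed points. As [p] takes values in the cube of radius [k],
     [g m] vanishes beyond radius [k + 1]. *)
  pose p (x : Rn) : Rn := \row_i Num.min k (Num.max (Num.max (- k) (b i)) (x 0 i)).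
  pose g (m : nat) (x : Rn) := Num.max 0 (1 - m.+1%:R * `|x - p x|).
  have plip x y : `|p x - p y| <= `|x - y|.
    apply/norm_rV_leP => // i; rewrite !mxE.
    have := coord_le_norm (x - y) i; rewrite !mxE; apply: le_trans.
    exact: clamp_lipschitz.
  have pk x : `|p x| <= k.
    apply/norm_rV_leP => // i; rewrite !mxE ler_norml ge_min lexx/= andbT.
    by rewrite le_min le_max le_max lexx/= andbT; lra.
  have pbx x : (upper_orthant b `&` cbox k) x <-> x = p x.
    split=> [[bx]|xp].
      rewrite cboxP//= => /(norm_rV_leP _ k0) xk; apply/rowP => i; rewrite !mxE.
      have := bx i; have := xk i; rewrite ler_norml => /andP[h1 h2] h3.
      by rewrite (max_idPr _) ?(min_idPr _)// ge_max h1.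
    split; last by rewrite cboxP//= xp.
    by move=> i; rewrite xp mxE le_min bk/= !le_max lexx orbT.
  have gout m x : k + 1 < `|x| -> g m x = 0.
    move=> xk; rewrite /g; apply/max_idPl.
    have h : 1 < `|x - p x|.
      have := lerB_dist x (p x); have := pk x; lra.
    rewrite subr_le0 (le_trans (ltW h))// ler_peMl//.
    by rewrite ler1n.
  apply: (Elim g _ 1).
  - move=> m; apply: (Elip _ (2 * m.+1%:R)) => [x y|x]; last exact: gout.
    apply: (le_trans (max0_lipschitz _ _)).
    rewrite (_ : _ - _ = m.+1%:R * (`|y - p y| - `|x - p x|)); last lra.
    rewrite normrM ger0_norm// [2 * _]mulrC -mulrA ler_pM2l//.
    apply: (le_trans (ler_dist_dist _ _)).
    rewrite (_ : y - p y - (x - p x) = (y - x) - (p y - p x)); last first.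
      by rewrite !opprB addrACA [RHS]addrACA; congr (_ + _); rewrite addrC.
    apply: (le_trans (ler_normB _ _)).
    by have := plip y x; rewrite [`|y - x|]distrC; lra.
  - move=> m x; rewrite mul1r indicE.
    case: (boolP (x \in cbox (k + 1))) => [_|].
      rewrite /= ger0_norm ?le_max ?lexx// ge_max ler01/=.
      by rewrite lerBlDr lerDl mulr_ge0.
    rewrite notin_setE cboxP ?addr_ge0//= => /negP; rewrite -ltNge => /gout ->.
    by rewrite normr0.
  - move=> x; rewrite indicE.
    have [/[dup] xp /pbx xb|xnp] := pselect (x = p x).
      rewrite mem_set//; apply: cvg_near_cst; apply: nearW => m.
      rewrite /g -xp subrr normr0 mulr0 subr0; exact/max_idPr.
    rewrite memNset; last by move/pbx.
    have d0 : 0 < `|x - p x|.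
      by rewrite normr_gt0 subr_eq0; apply/eqP.
    apply: cvg_near_cst; near=> m.
    apply/max_idPl; rewrite subr_le0 -ler_pdivrMr// mul1r.
    rewrite (@le_trans _ _ m%:R)// ?ler_nat//.
    by near: m; exact: nbhs_infty_ger.
have cboxE : cbox k = upper_orthant (fun=> - k) `&` cbox k.
  apply/seteqP; split=> [x /= h|x []//]; split=> // i.
  by have := h i; rewrite /= in_itv/= => /andP[].
have EB A : measurable (A : set Rn) -> E \1_(A `&` cbox k).
  rewrite borel_upper_orthants => mA.
  apply: (dynkin_induction (P := fun A => E \1_(A `&` cbox k)) borel_upper_orthants) => //.
  - move=> _ _ [a ->] [b ->]; exists (fun i => Num.max (a i) (b i)).
    apply/seteqP; split=> x /=.
      by move=> [h1 h2] i; rewrite ge_max h1 h2.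
    by move=> h; split=> i; have := h i; rewrite ge_max => /andP[].
  - by rewrite setTI cboxE.
  - by move=> _ [b ->]; exact: Ebx.
  - move=> S mS ES.
    rewrite (_ : \1__ = fun x => (-1) * \1_(S `&` cbox k) x + \1_(setT `&` cbox k) x).
      by apply: Elin => //; rewrite setTI cboxE.
    apply/funext => x; rewrite setTI !indicE !in_setI in_setC.
    by case: (x \in S); case: (x \in cbox k) => /=; lra.
  - move=> F mF tF EF.
    apply: (Elim (fun m => \1_((\bigcup_(j < m) F j) `&` cbox k)) _ 1) => //.
    + elim=> [|m IHm].
        rewrite (_ : \1__ = fun=> 0)//; apply/funext => x.
        by rewrite bigcup_mkord big_ord0 set0I indic0.
      rewrite (_ : \1__ = fun x => \1_((\bigcup_(j < m) F j) `&` cbox k) x + \1_(F m `&` cbox k) x).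
        exact: ED.
      apply/funext => x; rewrite !indicE !in_setI.
      case: (x \in cbox k); rewrite ?andbF ?addr0// !andbT.
      rewrite bigcup_mkord big_ord_recr/= in_setU -bigcup_mkord.
      case: (boolP (x \in F m)) => [/set_mem Fmx|_]; last by rewrite orbF addr0.
      rewrite orbT (_ : _ \in _ = false) ?add0r//; apply: memNset => -[j /= jm Fjx].
      have := tF j m Logic.I Logic.I; move=> /(_ (ex_intro _ x (conj Fjx Fmx))) jmE.
      by rewrite jmE ltnn in jm.
    + move=> x; apply: cvg_near_cst.
      have [[j _ Fjx]|nF] := pselect ((\bigcup_j F j) x).
        exists j.+1 => // m /= jm; rewrite !indicE !in_setI; congr (nat_of_bool (_ && _))%:R.
        by rewrite !mem_set//; exists j.
      apply: nearW => m; rewrite !indicE !in_setI; congr (nat_of_bool (_ && _))%:R.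
      rewrite !memNset//; by apply: contra_not nF => -[j _ Fj]; exists j.
have EL (A : set (RdL R n)) : measurable A -> E \1_(A `&` cbox k).
  move=> mA; have mAk : measurable (A `&` cbox k : set (RdL R n)).
    by apply: measurableI => //; apply: borel_RdL; exact: measurable_cbox.
  have [|B [mB AB B0]] := borel_hull mAk.
    rewrite (@le_lt_trans _ _ (leb R n (cbox k)))//; last by rewrite leb_cbox// ltry.
    by apply: le_measure; rewrite ?inE//; apply: borel_RdL; exact: measurable_cbox.
  apply: (Eae _ _ (EB _ mB)).
  - exact: measurable_indic.
  - by move=> x; rewrite !indicE in_setI; case: (x \in A); rewrite ger0_norm.
  exists (B `\` (A `&` cbox k)); split => //.
    by apply: measurableD => //; exact: borel_RdL.
  move=> x /=; apply: contra_notP => nBA; rewrite !indicE !in_setI.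
  case: (boolP (x \in cbox k)) => [/set_mem xk|]; last by rewrite !andbF.
  rewrite !andbT; have [Ax|nAx] := pselect (A x).
    by rewrite !mem_set//; apply: AB.
  rewrite (memNset nAx); case: (boolP (x \in B)) => // /set_mem Bx.
  by exfalso; apply: nBA; split=> // -[].
have EP h c : measurable_fun setT (h : RdL R n -> R) ->
    (forall x, 0 <= h x <= c * \1_(cbox k) x) -> E h.
  move=> mh h01.
  have mEh : measurable_fun setT (EFin \o h : RdL R n -> \bar R).
    exact/measurable_EFinP.
  have h0 x : [set: RdL R n] x -> (0 <= (EFin \o h) x)%E.
    by move=> _; rewrite lee_fin; have /andP[] := h01 x.
  pose g := nnsfun_approx measurableT mEh.
  have gh m x : g m x <= h x.
    rewrite -lee_fin -[leRHS]/((EFin \o h) x).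
    by rewrite nnsfun_approxE; exact: le_approx.
  have gout m x : ~ cbox k x -> g m x = 0.
    move=> xk; apply/eqP; rewrite eq_le fun_ge0 andbT.
    apply: (le_trans (gh m x)).
    by have /andP[_] := h01 x; rewrite indicE memNset// mulr0.
  apply: (Elim (fun m => g m : Rn -> R) _ c).
  - move=> m.
    have [N [s sE]] : exists N (s : seq R), forall x,
        g m x = \sum_(i < N) (s`_i * \1_(g m @^-1` [set s`_i]) x).
      by do 2 eexists; exact: fimfunEord.
    (* The level sets may be cut by the cube: outside it [g m] vanishes, so that only the level 0
       loses points. *)
    rewrite (_ : (g m : Rn -> R) = fun x => \sum_(i < N)
        (s`_i * \1_((g m @^-1` [set s`_i]) `&` cbox k) x)); last first.
      apply/funext => x; rewrite sE; apply: eq_bigr => i _.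
      rewrite !indicE in_setI.
      case: (boolP (x \in cbox k)) => [|]; first by rewrite andbT.
      rewrite notin_setE andbF => /(gout m) gx.
      have [->|s0] := eqVneq s`_i 0; first by rewrite !mul0r.
      rewrite memNset//= gx => /esym/eqP; exact/negP.
    elim: N {sE} => [|j IHj].
      by under eq_fun do rewrite big_ord0.
    under eq_fun do rewrite big_ord_recr.
    apply: ED => //; apply: EZ; apply: EL.
    rewrite -[X in measurable X]setTI; exact: measurable_funP.
  - move=> m x; rewrite ger0_norm ?fun_ge0//.
    apply: (le_trans (gh m x)); have /andP[_ h1] := h01 x; apply: (le_trans h1).
    have [xk|xk] := pselect (cbox k x).
      by rewrite !indicE !mem_set//; exact: subc.
    rewrite [X in _ * X <= _]indicE memNset// mulr0 mulr_ge0//.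
    have /andP[h2] := h01 0; rewrite indicE mem_set ?mulr1; first exact: le_trans.
    by rewrite cboxP//= normr0.
  - move=> x; have := cvg_nnsfun_approx measurableT mEh h0 (x := x) Logic.I.
    by move=> /fine_cvgP[_].
move=> f c mf fc.
(* Adding [c] on the cube makes the function nonnegative and at most [c + c]. *)
rewrite (_ : f = fun x => (- c) * \1_(setT `&` cbox k) x + (f x + c * \1_(cbox k) x)).
  apply: Elin; first exact: EL.
  apply: (EP _ (c + c)) => [|x].
    apply: measurable_funD; first exact: mf.
    apply: measurable_funM; first exact: measurable_cst.
    by apply: measurable_indic; apply: borel_RdL; exact: measurable_cbox.
  have := fc x; rewrite ler_norml => /andP[? ?]; lra.
by apply/funext => x; rewrite setTI; lra.
Unshelve. all: by end_near.
Qed.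

End lipschitz_approximation.

(** * Orlicz functions and the modular *)

Section orlicz_functions.
Context {R : realType}.

(** The conditions that [MO_function] imposes at one fixed point, with convexity unfolded to real
    numbers. *)
Definition orlicz (phi : R -> R) :=
  [/\ forall t, 0 <= t -> 0 <= phi t,
      forall p s t, 0 <= p <= 1 -> 0 <= s -> 0 <= t ->
        phi (p * s + (1 - p) * t) <= p * phi s + (1 - p) * phi t &
      forall t, 0 <= t -> (phi t = 0 <-> t = 0)].

Variable phi : R -> R.
Hypothesis ophi : orlicz phi.

Lemma orlicz_ge0 t : 0 <= t -> 0 <= phi t.
Proof. by case: ophi => + _ _; exact. Qed.

Lemma orlicz0 : phi 0 = 0.
Proof. by case: ophi => _ _ h; apply/h. Qed.

Lemma orlicz_gt0 t : 0 < t -> 0 < phi t.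
Proof.
move=> t0; rewrite lt_neqAle orlicz_ge0 ?(ltW t0)// andbT eq_sym.
by apply/eqP; case: ophi => _ _ /(_ t (ltW t0))[h _] /h t0'; rewrite t0' ltxx in t0.
Qed.

Lemma orliczM_le p t : 0 <= p <= 1 -> 0 <= t -> phi (p * t) <= p * phi t.
Proof.
move=> p01 t0; case: ophi => _ + _.
by move=> /(_ p t 0 p01 t0 (lexx _)); rewrite mulr0 addr0 orlicz0 mulr0 addr0.
Qed.

Lemma orliczM_ge c t : 1 <= c -> 0 <= t -> c * phi t <= phi (c * t).
Proof.
move=> c1 t0; have c0 : 0 < c by lra.
have := @orliczM_le c^-1 (c * t); rewrite mulrA mulVf ?gt_eqF// mul1r.
rewrite invr_ge0 ltW//= invf_le1// c1 mulr_ge0// ?(ltW c0)//.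
by move=> /(_ isT isT); rewrite mulrC ler_pdivlMr// mulrC.
Qed.

Lemma orlicz_lt s t : 0 <= s -> s < t -> phi s < phi t.
Proof.
move=> s0 st; have t0 : 0 < t by lra.
have -> : s = (s / t) * t by rewrite divfK ?gt_eqF.
have pt := orlicz_gt0 t0.
apply: (@le_lt_trans _ _ (s / t * phi t)).
  apply: orliczM_le; last exact: ltW.
  by rewrite divr_ge0 ?(ltW t0)//= ler_pdivrMr// mul1r ltW.
by rewrite gtr_pMl// ltr_pdivrMr// mul1r.
Qed.

Lemma orlicz_le s t : 0 <= s -> s <= t -> phi s <= phi t.
Proof.
by move=> s0; rewrite le_eqVlt => /predU1P[->//|st]; exact/ltW/orlicz_lt.
Qed.

(** Convexity on [s <= t <= 2 * T]. Going up to [2 * T] keeps the length [2 * T - s] at least [T],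
    so that the slope stays bounded up to [t = T]. *)
Lemma orlicz_lipschitz T s t : 0 < T -> 0 <= s -> s <= t -> t <= T ->
  phi t - phi s <= (t - s) * (phi (2 * T) / T).
Proof.
move=> T0 s0 st tT.
have D0 : 0 < 2 * T - s by lra.
pose p := (t - s) / (2 * T - s).
have p0 : 0 <= p by apply: divr_ge0; lra.
have p1 : p <= 1 by rewrite ler_pdivrMr//; lra.
have -> : phi t = phi (p * (2 * T) + (1 - p) * s).
  congr phi; rewrite /p; field; lra.
case: ophi => _ + _.
move=> /(_ p (2 * T) s); rewrite p0 p1 s0 => /(_ isT ltac:(lra) isT) h.
have P0 : 0 <= phi (2 * T) by apply: orlicz_ge0; lra.
have Ps : 0 <= phi s by exact: orlicz_ge0.
apply: (@le_trans _ _ (p * phi (2 * T))).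
  have : 0 <= p * phi s by rewrite mulr_ge0.
  lra.
rewrite [phi (2 * T) / T]mulrC mulrA ler_wpM2r// /p ler_wpM2l//.
  by rewrite subr_ge0.
by rewrite lef_pV2// ?posrE//; lra.
Qed.

(** The intermediate value theorem, applied to [phi] after clamping the argument to [[0, T]]: [phi]
    is unconstrained at negative arguments, while the clamped function is Lipschitz on the whole
    line. *)
Lemma orlicz_surj v : 0 <= v -> exists2 t, 0 <= t & phi t = v.
Proof.
move=> v0.
(* Since [T >= 1], convexity gives [phi T >= T * phi 1 >= v]. *)
pose T := 1 + v / phi 1.
have p1 : 0 < phi 1 by exact: orlicz_gt0.
have vp : 0 <= v / phi 1 by rewrite divr_ge0// ltW.
have T0 : 0 < T by rewrite /T; lra.
pose clamp (t : R) := Num.min T (Num.max 0 t).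
have clamp0 t : 0 <= clamp t by rewrite /clamp le_min le_max lexx ltW.
have clampT t : clamp t <= T by rewrite /clamp ge_min lexx.
pose L := phi (2 * T) / T.
have L0 : 0 <= L by rewrite divr_ge0 ?orlicz_ge0//; lra.
have lip x y : `|phi (clamp x) - phi (clamp y)| <= L * `|x - y|.
  have := clamp_lipschitz T 0 x y; rewrite -/(clamp x) -/(clamp y) => cxy.
  apply: (@le_trans _ _ (L * `|clamp x - clamp y|)); last by rewrite ler_wpM2l.
  wlog xy : x y cxy / clamp y <= clamp x.
    move=> h; have [yx|xy] := leP (clamp y) (clamp x); first exact: h.
    rewrite distrC [`|clamp x - _|]distrC; apply: h; last exact: ltW.
    by rewrite distrC [`|y - x|]distrC.
  rewrite ger0_norm ?subr_ge0 ?orlicz_le//.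
  by rewrite ger0_norm ?subr_ge0// mulrC; exact: orlicz_lipschitz.
have cont : continuous (phi \o clamp).
  move=> x; apply/cvgrPdist_lt => e e0; near=> y.
  rewrite /= (le_lt_trans (lip _ _))//.
  rewrite (@le_lt_trans _ _ ((L + 1) * `|x - y|))// ?ler_wpM2r ?lerDl//.
  rewrite mulrC -ltr_pdivlMr ?ltr_wpDl//.
  by near: y; apply: cvgr_dist_lt => //; rewrite divr_gt0 ?ltr_wpDl.
have [||t] := @IVT _ (phi \o clamp) 0 T v (ltW T0).
- exact: continuous_subspaceT.
- have -> : (phi \o clamp) 0 = 0.
    by rewrite /= /clamp maxxx (min_idPr _) ?(ltW T0)// orlicz0.
  have -> : (phi \o clamp) T = phi T.
    by rewrite /= /clamp (max_idPr _) ?minxx// ltW.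
  have vT : v <= phi T.
    apply: (@le_trans _ _ (T * phi 1)).
      by rewrite /T mulrDl mul1r divfK ?gt_eqF// lerDr ltW.
    have T1 : 1 <= T by rewrite /T lerDl.
    by have := orliczM_ge T1 ler01; rewrite mulr1.
  rewrite (min_idPl _) ?v0/=; last exact: le_trans vT.
  by rewrite le_max vT orbT.
- by move=> _ /= <-; exists (clamp t).
Unshelve. all: by end_near. Qed.

(** A strict inequality survives at a smaller rational argument. This reduces the measurability of
    [Phi x (F x)] and the null sets of [Delta2] to countably many arguments. *)
Lemma orlicz_lt_rat a t : 0 <= a -> 0 <= t -> a < phi t ->
  exists q : rat, [/\ 0 <= q, ratr q < t & a < phi (ratr q)].
Proof.
move=> a0 t0 aphi.
have {}t0 : 0 < t.
  by rewrite lt_neqAle t0 andbT; apply/eqP => t0'; move: aphi; rewrite -t0' orlicz0 ltNge a0.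
have [s s0 sa] := orlicz_surj a0.
have st : s < t.
  by rewrite ltNge; apply/negP => ts; move: aphi; rewrite ltNge -sa orlicz_le// ltW.
have [q] := rat_in_itvoo st; rewrite in_itv/= => /andP[sq qt].
exists q; split => //.
  by rewrite -(ler0q R) (le_trans s0)// ltW.
by rewrite -sa orlicz_lt.
Qed.

(** Convexity with weights [l / (l + m)] and [m / (l + m)]; the pointwise form of the triangle
    inequality for the Luxemburg norm. *)
Lemma orlicz_triangle a b l m : 0 <= a -> 0 <= b -> 0 < l -> 0 < m ->
  phi ((a + b) / (l + m)) <= l / (l + m) * phi (a / l) + m / (l + m) * phi (b / m).
Proof.
move=> a0 b0 l0 m0.
have lm0 : 0 < l + m by rewrite addr_gt0.
have := ophi => -[_ + _].
move=> /(_ (l / (l + m)) (a / l) (b / m)).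
rewrite (_ : 1 - l / (l + m) = m / (l + m)); last by field; lra.
rewrite (_ : l / (l + m) * (a / l) + m / (l + m) * (b / m) = (a + b) / (l + m)); last by field; lra.
apply; [|by rewrite divr_ge0// ltW..].
by rewrite divr_ge0 ?(ltW l0) ?(ltW lm0)//= ler_pdivrMr// mul1r lerDl ltW.
Qed.

End orlicz_functions.

Section box_induction.
Context {R : realType} {n : nat}.

Lemma cbox_compact (k : R) : 0 <= k -> compact (@cbox R n k).
Proof.
move=> k0; apply: bounded_closed_compact.
  exists k; split; first exact: num_real.
  by move=> M kM x; rewrite cboxP//= => xk; rewrite (le_trans xk)// ltW.
rewrite cboxP//; apply: (closed_comp (f := fun x : 'rV[R]_n => `|x|) (D := [set t : R | t <= k])).
  by move=> x _; exact: norm_continuous.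
exact: closed_le.
Qed.

(** Compactness as an induction principle, through a finite subcover. It turns constants found near
    each point into constants valid on a whole cube. *)
Lemma cbox_ind (P : set 'rV[R]_n -> Prop) (k : R) :
  P set0 -> (forall A B, P A -> P B -> P (A `|` B)) ->
  (forall A B, A `<=` B -> P B -> P A) ->
  (forall x, exists2 r, 0 < r & P (ball x r)) ->
  0 <= k -> P (cbox k).
Proof.
move=> P0 PU PS Pball k0.
have /choice[r /all_and2[r0 Pr]] : forall x, exists r, 0 < r /\ P (ball x r).
  by move=> x; have [r ? ?] := Pball x; exists r.
have := cbox_compact k0; rewrite compact_cover.
move=> /(_ _ setT (fun x => ball x (r x)) _ _)[|x xk|D _ kD].
- by move=> x _; apply: ball_open; exact: r0.
- by exists x => //; exact: ballxx.
by apply: PS kD _; rewrite /cover bigcup_fset; elim/big_ind : _.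
Qed.

End box_induction.

Lemma negligible_bigcup_countable d (T : measurableType d) (R : realType)
    (mu : {measure set T -> \bar R}) (I : countType) (N : I -> set T) :
  (forall i, mu.-negligible (N i)) -> mu.-negligible (\bigcup_i N i).
Proof.
move=> N0; pose M k := if unpickle k is Some i then N i else set0.
apply: (@negligibleS _ _ _ _ (\bigcup_k M k)).
  by move=> x [i _ Nix]; exists (pickle i) => //; rewrite /M pickleK.
apply: negligible_bigcup => k; rewrite /M.
by case: unpickle => // *; exact: negligible_set0.
Qed.

Lemma negligible_ae d (T : measurableType d) (R : realType)
    (mu : {measure set T -> \bar R}) (N : set T) (P : T -> Prop) :
  mu.-negligible N -> (forall x, ~ N x -> P x) -> {ae mu, forall x, P x}.
Proof.
move=> [M [mM M0 NM]] NP; exists M; split => // x /= nPx.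
by apply: NM; apply: contrapT => /NP.
Qed.

Section lebesgue_measurable_functions.
Context {R : realType} {n : nat}.
Implicit Types (D : set 'rV[R]_n) (f g : 'rV[R]_n -> R).

Definition lmeasurable D f := measurable_fun (D : set (RdL R n)) (f : RdL R n -> R).

Lemma lmeasurable_cst D c : lmeasurable D (fun=> c).
Proof. exact: measurable_cst. Qed.

Lemma lmeasurableD D f g : lmeasurable D f -> lmeasurable D g ->
  lmeasurable D (fun x => f x + g x).
Proof. exact: measurable_funD. Qed.

Lemma lmeasurableM D f g : lmeasurable D f -> lmeasurable D g ->
  lmeasurable D (fun x => f x * g x).
Proof. exact: measurable_funM. Qed.

Lemma lmeasurableZ D c f : lmeasurable D f -> lmeasurable D (fun x => c * f x).
Proof. by move=> mf; apply: lmeasurableM mf; exact: lmeasurable_cst. Qed.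

Lemma lmeasurableB D f g : lmeasurable D f -> lmeasurable D g ->
  lmeasurable D (fun x => f x - g x).
Proof. exact: measurable_funB. Qed.

Lemma lmeasurable_norm D f : lmeasurable D f -> lmeasurable D (fun x => `|f x|).
Proof. by move=> mf; exact: (measurableT_comp (@normr_measurable R setT) mf). Qed.

Lemma lmeasurable_div D f c : lmeasurable D f -> lmeasurable D (fun x => f x / c).
Proof. by move=> mf; apply: lmeasurableM mf _; exact: lmeasurable_cst. Qed.

Lemma lmeasurable_continuous D f : continuous f -> lmeasurable D f.
Proof. by move=> cf; apply: measurable_funTS; exact: continuous_RdL. Qed.

Lemma lmeasurableS D E f : measurable (E : set (RdL R n)) -> D `<=` E ->
  lmeasurable E f -> lmeasurable D f.
Proof. by move=> mE DE; exact: measurable_funS. Qed.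

Lemma lmeasurable_EFin D f : lmeasurable D f ->
  measurable_fun (D : set (RdL R n)) (fun x : RdL R n => (f x)%:E).
Proof. by move=> mf; apply/measurable_EFinP. Qed.

Lemma lmeasurable_indic D A : measurable (A : set (RdL R n)) ->
  lmeasurable D (\1_A : _ -> R).
Proof. exact: measurable_indic. Qed.

Lemma ae_imp (P Q : 'rV[R]_n -> Prop) : (forall x, P x -> Q x) ->
  {ae leb R n, forall x, P x} -> {ae leb R n, forall x, Q x}.
Proof.
move=> PQ [N [mN N0 PN]]; exists N; split => // x nQx; apply: PN => Px.
by apply: nQx; exact: PQ.
Qed.

Lemma ae_and (P Q : 'rV[R]_n -> Prop) : {ae leb R n, forall x, P x} ->
  {ae leb R n, forall x, Q x} -> {ae leb R n, forall x, P x /\ Q x}.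
Proof.
move=> P1 Q1; apply: (negligible_ae (negligibleU P1 Q1)) => x /= nPQ; split.
  by apply: contrapT => nPx; apply: nPQ; left.
by apply: contrapT => nPx; apply: nPQ; right.
Qed.

Lemma ae_all (P : 'rV[R]_n -> Prop) : (forall x, P x) -> {ae leb R n, forall x, P x}.
Proof. by move=> PT; apply: negligible_ae (@negligible_set0 _ _ _ _) _ => x _. Qed.

End lebesgue_measurable_functions.

Section nonnegative_integrals.
Context {R : realType} {n : nat}.
Implicit Types (D : set 'rV[R]_n) (f g : 'rV[R]_n -> R).
Local Notation mu := (leb R n).

Definition lint D f : \bar R := (\int[mu]_(x in D) (f x)%:E)%E.

Lemma lint_ge0 D f : (forall x, D x -> 0 <= f x) -> (0 <= lint D f)%E.
Proof. by move=> f0; apply: integral_ge0 => x Dx; rewrite lee_fin f0. Qed.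

Lemma eq_lint D f g : (forall x, D x -> f x = g x) -> lint D f = lint D g.
Proof. by move=> fg; apply: eq_integral => x /set_mem Dx; rewrite fg. Qed.

Lemma lint_le D f g : measurable (D : set (RdL R n)) ->
  lmeasurable D f -> lmeasurable D g ->
  (forall x, D x -> 0 <= f x) -> (forall x, D x -> 0 <= g x) ->
  {ae mu, forall x, D x -> f x <= g x} -> (lint D f <= lint D g)%E.
Proof.
move=> mD mf mg f0 g0 fg; apply: (ae_ge0_le_integral mD).
- by move=> x Dx; rewrite lee_fin f0.
- exact: lmeasurable_EFin.
- by move=> x Dx; rewrite lee_fin g0.
- exact: lmeasurable_EFin.
by apply: ae_imp fg => x fg Dx; rewrite lee_fin; exact: fg.
Qed.

Lemma lintD D f g : measurable (D : set (RdL R n)) ->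
  lmeasurable D f -> lmeasurable D g ->
  (forall x, D x -> 0 <= f x) -> (forall x, D x -> 0 <= g x) ->
  lint D (fun x => f x + g x) = (lint D f + lint D g)%E.
Proof.
move=> mD mf mg f0 g0; rewrite /lint -(ge0_integralD _ mD).
- by apply: eq_integral => x _; rewrite EFinD.
- by move=> x Dx; rewrite lee_fin f0.
- exact: lmeasurable_EFin.
- by move=> x Dx; rewrite lee_fin g0.
- exact: lmeasurable_EFin.
Qed.

Lemma lintZ D c f : measurable (D : set (RdL R n)) -> lmeasurable D f ->
  (forall x, D x -> 0 <= f x) -> 0 <= c ->
  lint D (fun x => c * f x) = (c%:E * lint D f)%E.
Proof.
move=> mD mf f0 c0; rewrite /lint -(ge0_integralZl_EFin _ mD _ _ c0).
- by apply: eq_integral => x _; rewrite EFinM.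
- by move=> x Dx; rewrite lee_fin f0.
- exact: lmeasurable_EFin.
Qed.

Lemma lintS D E f : measurable (D : set (RdL R n)) -> measurable (E : set (RdL R n)) ->
  lmeasurable E f -> (forall x, E x -> 0 <= f x) -> D `<=` E ->
  (lint D f <= lint E f)%E.
Proof.
move=> mD mE mf f0 DE; apply: (ge0_subset_integral mu mD mE _ _ DE).
- exact: lmeasurable_EFin.
- by move=> x Ex; rewrite lee_fin f0.
Qed.

End nonnegative_integrals.

Section MO_functions.
Context {R : realType} {n : nat}.
Local Notation Rn := 'rV[R]_n.
Local Notation mu := (leb R n).
Variables (Omega : set Rn) (Phi : Rn -> R -> R).
Hypothesis mOmega : measurable (Omega : set (RdL R n)).
Hypothesis PhiMO : MO_function Omega Phi.

Lemma MO_orlicz x : Omega x -> orlicz (Phi x).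
Proof.
move=> Ox; case: PhiMO => ge0 cvx eq0 _; split.
- by move=> t; exact: ge0.
- move=> p s t /andP[p0 p1] s0 t0.
  have := cvx x Ox (Itv01 p0 p1) s t.
  by rewrite !inE/= !in_itv/= !andbT s0 t0; apply.
- by move=> t; exact: eq0.
Qed.

(** By monotonicity and continuity in [t], the condition [a < Phi x (F x)] holds exactly when some
    rational [q < F x] satisfies [a < Phi x q]: a countable union. *)
Lemma measurable_MO_comp (F : Rn -> R) :
  lmeasurable Omega F ->
  (forall x, Omega x -> 0 <= F x) ->
  lmeasurable Omega (fun x => Phi x (F x)).
Proof.
move=> mF F0; have [_ _ _ mPhi] := PhiMO.
apply: (measurability _ (RGenOInfty.measurableE R)) => //.
move=> /= _ [_ [a ->] <-].
have [a0|a0] := ltP a 0.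
  rewrite (_ : _ `&` _ = Omega)//; apply/setIidl => x Ox /=.
  rewrite in_itv/= andbT (lt_le_trans a0)//.
  by apply: orlicz_ge0; [exact: MO_orlicz|exact: F0].
rewrite (_ : _ `&` _ = \bigcup_(q : rat) (if 0 <= q then
    (Omega `&` (Phi^~ (ratr q) @^-1` `]a, +oo[)) `&` (Omega `&` F @^-1` `]ratr q, +oo[)
    else set0)); last first.
  apply/seteqP; split=> x /=.
    rewrite in_itv/= andbT => -[Ox aF].
    have [q [q0 qF aq]] := orlicz_lt_rat (MO_orlicz Ox) a0 (F0 _ Ox) aF.
    by exists q => //; rewrite q0/= !in_itv/= !andbT.
  move=> [q _]; case: ifPn => // q0 /=; rewrite !in_itv/= !andbT => -[[Ox aq] [_ qF]].
  split => //; apply: (lt_le_trans aq); apply: orlicz_le; [exact: MO_orlicz| |exact: ltW].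
  by rewrite ler0q.
apply: bigcupT_measurable_rat => q; case: ifPn => // q0.
apply: measurableI.
  by apply: mPhi; rewrite ?ler0q//; exact: measurable_itv.
by apply: mF => //; exact: measurable_itv.
Qed.

Definition modul (F : Rn -> R) : \bar R := lint Omega (fun x => Phi x `|F x|).

Implicit Types F G : Rn -> R.

Lemma lmeasurable_Phi F : lmeasurable Omega F -> lmeasurable Omega (fun x => Phi x `|F x|).
Proof.
move=> mF; apply: measurable_MO_comp; first exact: lmeasurable_norm.
by move=> x _; exact: normr_ge0.
Qed.

Lemma Phi_ge0 F x : Omega x -> 0 <= Phi x `|F x|.
Proof. by move=> Ox; rewrite orlicz_ge0//; exact: MO_orlicz. Qed.

Lemma modul_ge0 F : (0 <= modul F)%E.
Proof. by apply: lint_ge0 => x; exact: Phi_ge0. Qed.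

Lemma le_modul F G : lmeasurable Omega F -> lmeasurable Omega G ->
  {ae mu, forall x, Omega x -> `|F x| <= `|G x|} ->
  (modul F <= modul G)%E.
Proof.
move=> mF mG FG; apply: (lint_le mOmega).
- exact: lmeasurable_Phi.
- exact: lmeasurable_Phi.
- by move=> x; exact: Phi_ge0.
- by move=> x; exact: Phi_ge0.
apply: ae_imp FG => x FGx Ox; apply: orlicz_le; [exact: MO_orlicz|exact: normr_ge0|].
exact: FGx.
Qed.

(** A witness that the Luxemburg norm of [F] is at most [l]. Estimates are carried by such
    witnesses, and the infimum is met only when the real and imaginary parts are put together. *)
Definition Nle (F : Rn -> R) (l : R) := 0 < l /\ (modul (fun x => F x / l)%R <= 1)%E.

Lemma Nle_triangle F G l m : lmeasurable Omega F -> lmeasurable Omega G ->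
  Nle F l -> Nle G m -> Nle (fun x => F x + G x) (l + m).
Proof.
move=> mF mG [l0 Fl] [m0 Gm]; have lm0 : 0 < l + m by exact: addr_gt0.
split=> //; pose a := l / (l + m); pose b := m / (l + m).
have a0 : 0 <= a by apply: divr_ge0; exact: ltW.
have b0 : 0 <= b by apply: divr_ge0; exact: ltW.
apply: (@le_trans _ _ (a%:E * modul (fun x => F x / l)%R +
                       b%:E * modul (fun x => G x / m)%R)%E).
  have mFl : lmeasurable Omega (fun x => Phi x `|F x / l|).
    by apply: lmeasurable_Phi; exact: lmeasurable_div.
  have mGm : lmeasurable Omega (fun x => Phi x `|G x / m|).
    by apply: lmeasurable_Phi; exact: lmeasurable_div.
  have F0 x : Omega x -> 0 <= Phi x `|F x / l| by exact: (@Phi_ge0 (fun x => F x / l)).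
  have G0 x : Omega x -> 0 <= Phi x `|G x / m| by exact: (@Phi_ge0 (fun x => G x / m)).
  have aF0 x : Omega x -> 0 <= a * Phi x `|F x / l| by move=> /F0; apply: mulr_ge0 a0.
  have bG0 x : Omega x -> 0 <= b * Phi x `|G x / m| by move=> /G0; apply: mulr_ge0 b0.
  rewrite -(lintZ mOmega mFl F0 a0) -(lintZ mOmega mGm G0 b0) -(lintD mOmega _ _ aF0 bG0).
  - apply: (lint_le mOmega).
    + by apply: lmeasurable_Phi; apply: lmeasurable_div; exact: lmeasurableD.
    + by apply: lmeasurableD; exact: lmeasurableZ.
    + by move=> x; exact: (@Phi_ge0 (fun x => (F x + G x) / (l + m))).
    + by move=> x Ox; apply: addr_ge0; [exact: aF0|exact: bG0].
    apply: ae_all => x Ox.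
    rewrite !normrM !normfV !(gtr0_norm l0) !(gtr0_norm m0) !(gtr0_norm lm0).
    have oP := MO_orlicz Ox.
    apply: le_trans (orlicz_triangle oP (normr_ge0 (F x)) (normr_ge0 (G x)) l0 m0).
    apply: (orlicz_le oP); first by apply: divr_ge0 => //; exact: ltW.
    by rewrite ler_pM2r ?invr_gt0//; exact: ler_normD.
  - exact: lmeasurableZ.
  - exact: lmeasurableZ.
have -> : 1%E = (a%:E * 1 + b%:E * 1)%E :> \bar R.
  by rewrite !mule1 -EFinD /a /b -mulrDl divff// gt_eqF.
by apply: leeD; apply: lee_wpmul2l; rewrite ?lee_fin.
Qed.

Lemma Nle_le F G l :
  lmeasurable Omega F ->
  lmeasurable Omega G ->
  {ae mu, forall x, Omega x -> `|F x| <= `|G x|} -> Nle G l -> Nle F l.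
Proof.
move=> mF mG FG [l0 Gl]; split => //; apply: le_trans Gl; apply: le_modul.
- exact: lmeasurable_div.
- exact: lmeasurable_div.
apply: ae_imp FG => x FGx Ox.
by rewrite !normrM ler_pM2r ?normr_gt0 ?invr_eq0 ?gt_eqF//; exact: FGx.
Qed.

Lemma NleZ F l c : c != 0 -> Nle F l -> Nle (fun x => c * F x)%R (`|c| * l).
Proof.
move=> c0 [l0 Fl]; split; first by rewrite mulr_gt0// normr_gt0.
rewrite (_ : modul _ = modul (fun x => F x / l)%R)//.
apply: eq_lint => x _; congr (Phi x _).
rewrite !normrM !normfV normrM !normr_id.
by rewrite invfM mulrACA divff ?mul1r ?normr_eq0.
Qed.

End MO_functions.

Section euclidean_balls.
Context {R : realType} {n : nat}.
Local Notation Rn := 'rV[R]_n.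
Local Notation mu := (leb R n).
Implicit Types (c x : Rn) (r : R).

(** A crude comparison of the Euclidean norm with the sup norm: the factor [n], in place of its
    square root, is enough for all volume estimates. *)
Lemma sum_sqr_lt x r : (0 < n)%N -> 0 < r -> (forall i, `|x 0 i| < r) ->
  Num.sqrt (\sum_(i < n) x 0 i ^+ 2) < n%:R * r.
Proof.
move=> n0 r0 xr; have nr0 : 0 < n%:R * r by rewrite mulr_gt0// ltr0n.
have <- : Num.sqrt ((n%:R * r) ^+ 2) = n%:R * r by rewrite sqrtr_sqr gtr0_norm.
rewrite ltr_sqrt ?exprn_gt0//.
apply: (@lt_le_trans _ _ (\sum_(i < n) r ^+ 2)).
  apply: ltr_sum; first by apply/hasP; exists (Ordinal n0); rewrite ?mem_index_enum.
  by move=> i _; rewrite -real_normK ?num_real// ltrXn2r// ?xr ?nnegrE// ltW.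
rewrite sumr_const card_ord exprMn -[r ^+ 2 *+ n]mulr_natl ler_wpM2r ?sqr_ge0//.
by rewrite expr2 ler_peMl// ler1n.
Qed.

Definition box c r := [set x : Rn | forall i, `[c 0 i - r, c 0 i + r]%classic (x 0 i)].

Lemma boxE c r x : box c r x <-> forall i, `|x 0 i - c 0 i| <= r.
Proof.
split=> h i; have := h i; rewrite /= in_itv/= ler_norml => /andP[? ?]; apply/andP; split; lra.
Qed.

Lemma measurable_box_RdL c r : measurable (box c r : set (RdL R n)).
Proof.
by apply: borel_RdL; have := @measurable_box R n (fun i => `[c 0 i - r, c 0 i + r]%classic); apply.
Qed.

Lemma leb_boxE c r : 0 <= r -> mu (box c r) = ((2 * r) ^+ n)%:E.
Proof.
move=> r0; rewrite (leb_box (A := fun i => `[c 0 i - r, c 0 i + r]%classic))//.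
rewrite (eq_bigr (fun=> (2 * r)%:E)); last first.
  move=> i _; rewrite lebesgue_measure_itv/= lte_fin; case: ifPn.
    by rewrite -EFinB => _; congr (_%:E); lra.
  by rewrite -leNgt => h; congr (_%:E); lra.
by rewrite prodEFin prodr_const card_ord.
Qed.

Lemma measurable_open_eball c r : 0 < r -> measurable (open_eball c r : set (RdL R n)).
Proof.
move=> r0.
have mf : lmeasurable setT (fun x : Rn => \sum_(i < n) (x 0 i - c 0 i) ^+ 2).
  apply: (@measurable_sum _ _ _ _ _ _ (fun i (x : RdL R n) => (x 0 i - c 0 i) ^+ 2)) => i.
  have mi : lmeasurable setT (fun x : Rn => x 0 i - c 0 i).
    apply: lmeasurableB; last exact: lmeasurable_cst.
    by apply: lmeasurable_continuous; exact: coord_continuous.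
  exact: (lmeasurableM mi mi).
have := mf measurableT `]-oo, r ^+ 2[%classic (measurable_itv _).
rewrite setTI (_ : _ @^-1` _ = open_eball c r)//.
apply/seteqP; split=> x /=; rewrite in_itv/= /open_eball/=.
  by move=> h; rewrite -[r]gtr0_norm// -sqrtr_sqr ltr_sqrt// exprn_gt0.
by rewrite -[r in X in X -> _]gtr0_norm// -sqrtr_sqr ltr_sqrt// exprn_gt0.
Qed.

Lemma open_eball_sub_box c r : open_eball c r `<=` box c r.
Proof.
move=> x /= xr; apply/boxE => i; apply: le_trans (ltW xr).
rewrite -sqrtr_sqr ler_wsqrtr// (bigD1 i)//= lerDl.
by apply: sumr_ge0 => j _; exact: sqr_ge0.
Qed.

Lemma box_sub_open_eball c r : (0 < n)%N -> 0 < r ->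
  box c (r / (2 * n%:R)) `<=` open_eball c r.
Proof.
move=> n0 r0 x /boxE xr; rewrite /open_eball/=.
have rn0 : 0 < r / n%:R by rewrite divr_gt0// ltr0n.
have := @sum_sqr_lt (x - c) (r / n%:R) n0 rn0.
rewrite (eq_bigr (fun i => (x 0 i - c 0 i) ^+ 2)); last by move=> i _; rewrite !mxE.
rewrite [n%:R * _]mulrC divfK ?pnatr_eq0 -?lt0n//; apply => i.
rewrite !mxE (le_lt_trans (xr i))// ltr_pM2l// ltf_pV2 ?posrE ?mulr_gt0 ?ltr0n//.
by rewrite ltr_pMl ?ltr0n// ltr1n.
Qed.

Lemma leb_open_eball c r : (0 < n)%N -> 0 < r ->
  (mu (open_eball c r) <= ((2 * r) ^+ n)%:E)%E /\
  (0 < mu (open_eball c r))%E.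
Proof.
move=> n0 r0; split.
  rewrite -(leb_boxE c (ltW r0)); apply: le_measure; rewrite ?inE.
  - exact: measurable_open_eball.
  - exact: measurable_box_RdL.
  - exact: open_eball_sub_box.
have rn0 : 0 < r / (2 * n%:R) by rewrite divr_gt0// mulr_gt0// ltr0n.
apply: (@lt_le_trans _ _ (mu (box c (r / (2 * n%:R))))).
  by rewrite leb_boxE ?(ltW rn0)// lte_fin exprn_gt0// mulr_gt0.
apply: le_measure; rewrite ?inE.
- exact: measurable_box_RdL.
- exact: measurable_open_eball.
- exact: box_sub_open_eball.
Qed.

End euclidean_balls.

(** * Doubling and the comparison of nearby points *)

Section Delta2.
Context {R : realType} {n : nat}.
Local Notation Rn := 'rV[R]_n.
Local Notation mu := (leb R n).
Variables (Omega : set Rn) (Phi : Rn -> R -> R).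
Hypothesis mOmega : measurable (Omega : set (RdL R n)).
Hypothesis PhiMO : MO_function Omega Phi.
Hypothesis Phi_Delta2 : Delta2 Omega Phi.

(** In [Delta2] the exceptional null set may depend on [t]. The sets of rational [t] are collected,
    and continuity in [t] gives one null set for all [t] and all iterates. *)
Lemma Delta2_iter : exists C h, [/\ 1 <= C, lmeasurable Omega h,
  forall x, Omega x -> 0 <= h x, (lint Omega h < +oo)%E &
  {ae mu, forall x, Omega x -> forall t, 0 <= t -> forall m : nat,
     Phi x (2 ^+ m * t) <= C ^+ m * (Phi x t + m%:R * h x)}].
Proof.
have [C [h [C0 h0 ih ae2]]] := Phi_Delta2.
have mh : lmeasurable Omega h.
  by have /integrableP[/measurable_EFinP] := ih.
(* A constant at least 1 lets each new error term [h x] be absorbed under the common factor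
   [C' ^+ m]. *)
pose C' := Num.max C 1.
have C1 : 1 <= C' by rewrite /C' le_max lexx orbT.
have C'0 : 0 < C' by lra.
have CC' : C <= C' by rewrite /C' le_max lexx.
exists C', h; split => //.
- by move=> x /h0/ltW.
- have /integrableP[_] := ih; apply: le_lt_trans.
  rewrite /lint le_eqVlt; apply/orP; left; apply/eqP/eq_integral => x /set_mem Ox.
  by rewrite /= ger0_norm// ltW// h0.
have : mu.-negligible (\bigcup_(q : rat) [set x | Omega x /\ 0 <= q /\
    ~ (Phi x (2 * ratr q) <= C * Phi x (ratr q) + h x)]).
  apply: negligible_bigcup_countable => q.
  have [q0|q0] := leP 0 q; last first.
    by apply: (negligibleS _ (@negligible_set0 _ _ _ _)) => x [_ []].
  have q0' : 0 <= ratr q :> R by rewrite ler0q.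
  apply: (negligibleS _ (ae2 _ q0')) => x [Ox [_ nP]] /= /(_ Ox); exact: nP.
move=> /negligible_ae; apply => x nx Ox.
have oP := MO_orlicz PhiMO Ox.
have hx : 0 <= h x by exact/ltW/h0.
have two t : 0 <= t -> Phi x (2 * t) <= C' * Phi x t + h x.
  move=> t0; rewrite leNgt; apply/negP => lt.
  have Pt : 0 <= Phi x t by exact: orlicz_ge0.
  (* A violation at [2 * t] persists at a rational [q < 2 * t]; at the argument [q / 2 < t] the
     right-hand side is no larger, so [x] would lie in the null set of [q / 2]. *)
  have [||q [q0 qt aq]] := orlicz_lt_rat oP _ _ lt.
  - by rewrite addr_ge0// mulr_ge0// ltW.
  - by rewrite mulr_ge0.
  apply: nx; exists (q / 2) => //=; split => //; split; first by rewrite divr_ge0.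
  have -> : ratr (q / 2) = ratr q / 2 :> R by rewrite rmorphM/= fmorphV/= ratr_nat.
  rewrite (_ : 2 * (_ / 2) = ratr q); last by field.
  apply/negP; rewrite -ltNge; apply: le_lt_trans aq.
  rewrite lerD2r; apply: ler_pM => //; first exact: ltW.
    by apply: orlicz_ge0 => //; rewrite divr_ge0// ler0q.
  by apply: orlicz_le => //; [rewrite divr_ge0// ler0q|lra].
move=> t t0; elim=> [|m IHm]; first by rewrite !expr0 !mul1r mul0r addr0.
have := two (2 ^+ m * t); rewrite mulr_ge0 ?exprn_ge0// => /(_ isT).
rewrite mulrA -exprS => /le_trans; apply.
apply: (@le_trans _ _ (C' * (C' ^+ m * (Phi x t + m%:R * h x)) + h x)).
  by rewrite lerD2r ler_pM2l.
rewrite mulrA -exprS -natr1.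
have K1 : 1 <= C' ^+ m.+1 by rewrite exprn_ege1.
have : h x <= C' ^+ m.+1 * h x by rewrite ler_peMl.
lra.
Qed.

(** [Delta2], iterated until [2 ^+ m] exceeds [|c|]. Functions of finite modular thus form a class
    stable under dilation, and norm convergence can be tested on modulars by dominated
    convergence. *)
Lemma modulZ_fin F c : lmeasurable Omega F -> (modul Omega Phi F < +oo)%E ->
  (modul Omega Phi (fun x => (c * F x)%R) < +oo)%E.
Proof.
move=> mF Foo.
have [C [h [C1 mh h0 hoo ae2]]] := Delta2_iter.
have [m cm] : exists m : nat, `|c| <= 2 ^+ m.
  exists (Num.bound `|c|); rewrite (le_trans (ltW (archi_boundP _)))//.
  by rewrite -natrX ler_nat; exact/ltnW/ltn_expl.
have C0 : 0 <= C ^+ m by rewrite exprn_ge0//; lra.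
have mP := lmeasurable_Phi mOmega PhiMO mF.
have P0 x : Omega x -> 0 <= Phi x `|F x| by exact: (Phi_ge0 PhiMO F).
have mh0 x : Omega x -> 0 <= m%:R * h x by move=> Ox; rewrite mulr_ge0// h0.
have Pm0 x : Omega x -> 0 <= Phi x `|F x| + m%:R * h x.
  by move=> Ox; rewrite addr_ge0 ?P0 ?mh0.
apply: (@le_lt_trans _ _ (lint Omega (fun x => C ^+ m * (Phi x `|F x| + m%:R * h x)))).
  apply: (lint_le mOmega).
  - by apply: lmeasurable_Phi => //; exact: lmeasurableZ.
  - by apply: lmeasurableZ; apply: lmeasurableD => //; exact: lmeasurableZ.
  - by move=> x Ox; exact: (@Phi_ge0 _ _ _ _ PhiMO (fun x => c * F x)).
  - by move=> x Ox; rewrite mulr_ge0// Pm0.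
  apply: ae_imp ae2 => x Hx Ox; apply: le_trans (Hx Ox _ (normr_ge0 _) m).
  apply: orlicz_le; [exact: (MO_orlicz PhiMO)|by []|].
  by rewrite normrM ler_wpM2r.
have mZh : lmeasurable Omega (fun x => m%:R * h x) by exact: lmeasurableZ.
rewrite lintZ//; last exact: lmeasurableD.
rewrite lintD// lintZ//.
rewrite lte_mul_pinfty// ?lee_fin// lte_add_pinfty// lte_mul_pinfty//.
Qed.

End Delta2.

Section A1_consequences.
Context {R : realType} {n : nat}.
Local Notation Rn := 'rV[R]_n.
Local Notation mu := (leb R n).
Hypothesis n0 : (0 < n)%N.
Variables (Omega : set Rn) (Phi : Rn -> R -> R).
Hypothesis mOmega : measurable (Omega : set (RdL R n)).
Hypothesis PhiMO : MO_function Omega Phi.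
Hypothesis PhiA1 : A1 Omega Phi.

Lemma MO_invE x s : Omega x -> 0 <= s -> MO_inv Phi x (Phi x s) = s.
Proof.
move=> Ox s0; have oP := MO_orlicz PhiMO Ox.
have [t0 ts] : [set t | 0 <= t /\ Phi x t = Phi x s] (MO_inv Phi x (Phi x s)).
  by apply: xgetPex; exists s.
apply/eqP; rewrite eq_le !leNgt; apply/andP; split; apply/negP => lt.
  by have := orlicz_lt oP s0 lt; rewrite ts ltxx.
by have := orlicz_lt oP t0 lt; rewrite ts ltxx.
Qed.

(** The volume of the cube enclosing a Euclidean ball of radius [2 * n * r]. Such a ball, centred at
    a rational point within [r] of [x], contains [x] and every point at sup-distance less than [r]
    from [x]. *)
Definition ball_volume_bound (r : R) : R := (4 * n%:R * r) ^+ n.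

Lemma ball_volume_bound_gt0 r : 0 < r -> 0 < ball_volume_bound r.
Proof. by move=> r0; rewrite exprn_gt0// !mulr_gt0// ltr0n. Qed.

(* The exceptional null set of (A1) depends on the ball; only the countably many
   balls with a rational centre and a radius fixed by [r] are used. *)
Lemma A1_local : exists beta r0, [/\ 0 < beta < 1, 0 < r0 &
  forall r, 0 < r -> r < r0 -> ball_volume_bound r < 1 /\
    exists2 N : set (RdL R n), mu.-negligible N &
      forall x y, Omega x -> ~ N x -> Omega y -> ~ N y -> `|x - y| < r ->
      forall t, 0 <= t -> Phi y t <= (ball_volume_bound r)^-1 ->
        Phi x (beta * t) <= Num.max 1 (Phi y t)].
Proof.
have [beta [delta [beta01 /andP[d0 d1] A1b]]] := PhiA1.
have nR0 : 0 < n%:R :> R by rewrite ltr0n.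
have n40 : 0 < 4 * n%:R :> R by rewrite mulr_gt0.
(* From [4 * n * r < delta < 1] the power [ball_volume_bound r] is below [delta] too. *)
exists beta, (delta / (4 * n%:R)); split=> //; first by rewrite divr_gt0.
move=> r r0; rewrite ltr_pdivlMr// mulrC => rd.
pose rho := 2 * n%:R * r.
have rho0 : 0 < rho by rewrite !mulr_gt0.
have rho2 : 2 * rho = 4 * n%:R * r by rewrite /rho; lra.
have Vd : ball_volume_bound r < delta.
  apply: (le_lt_trans _ rd); rewrite /ball_volume_bound.
  rewrite -[X in _ <= X]expr1 ler_wiXn2l//; last by lra.
  by rewrite mulr_ge0// ltW.
split; first exact: lt_trans d1.
have V0 := ball_volume_bound_gt0 r0.
pose B (q : 'rV[rat]_n) : set Rn := open_eball (map_mx ratr q) rho.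
have muB q : (mu (B q) <= (ball_volume_bound r)%:E)%E /\ (0 < mu (B q))%E.
  by have := leb_open_eball (map_mx ratr q) n0 rho0; rewrite rho2.
have muBd q : (mu (B q) < delta%:E)%E.
  by apply: le_lt_trans (proj1 (muB q)) _; rewrite lte_fin.
have /choice[N /all_and2[N0 NP]] : forall q, exists N : set (RdL R n),
    mu.-negligible N /\ forall x y, (B q `&` Omega `\` N) x -> (B q `&` Omega `\` N) y ->
      forall t, MO_inv Phi y 1 <= t <= MO_inv Phi y (fine (mu (B q)))^-1 ->
        Phi x (beta * t) <= Phi y t.
  by move=> q; have [N ? ?] := A1b _ _ rho0 (muBd q); exists N.
exists (\bigcup_q N q); first exact: negligible_bigcup_countable.
move=> x y Ox nNx Oy nNy xy t t0 Pt.
have [q xq] := rat_rV_dense x r0.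
have inB z : `|z - map_mx ratr q| < 2 * r -> B q z.
  move=> zq; rewrite /B /open_eball/=.
  have r20 : 0 < 2 * r by rewrite mulr_gt0.
  have := @sum_sqr_lt _ _ (z - map_mx ratr q) _ n0 r20.
  rewrite (eq_bigr (fun i => (z 0 i - (map_mx ratr q) 0 i) ^+ 2)); last first.
    by move=> i _; rewrite !mxE.
  rewrite mulrA [n%:R * 2]mulrC; apply => i.
  exact: le_lt_trans (coord_le_norm _ _) zq.
have Bx : B q x by apply: inB; apply: lt_trans xq _; lra.
have By : B q y.
  apply: inB; rewrite -(subrKA x) (le_lt_trans (ler_normD _ _))//.
  by rewrite distrC; lra.
have key := NP q x y.
have {}key : forall s, MO_inv Phi y 1 <= s <= MO_inv Phi y (fine (mu (B q)))^-1 ->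
    Phi x (beta * s) <= Phi y s.
  by apply: key; split=> // Nq; [apply: nNx|apply: nNy]; exists q.
have oPx := MO_orlicz PhiMO Ox; have oPy := MO_orlicz PhiMO Oy.
have [muBle muB0] := muB q.
have Bfin : mu (B q) \is a fin_num.
  by rewrite ge0_fin_numE ?ltW// (le_lt_trans muBle)// ltry.
have fB0 : 0 < fine (mu (B q)) by rewrite -lte_fin fineK.
have fBV : fine (mu (B q)) <= ball_volume_bound r by rewrite -lee_fin fineK.
have iV : (ball_volume_bound r)^-1 <= (fine (mu (B q)))^-1 by rewrite lef_pV2// posrE.
have V1 : 1 < (ball_volume_bound r)^-1 by rewrite invf_gt1// (lt_trans Vd).
have le_inv s v : 0 <= s -> Phi y s <= v -> s <= MO_inv Phi y v.
  move=> s0 sv; have v0 : 0 <= v by apply: le_trans sv; exact: orlicz_ge0.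
  have [u u0 uv] := orlicz_surj oPy v0; rewrite -uv MO_invE// leNgt.
  by apply/negP => /(orlicz_lt oPy u0); rewrite uv ltNge sv.
have [s1 s10 s1E] := orlicz_surj oPy ler01.
have inv1 : MO_inv Phi y 1 = s1 by rewrite -s1E MO_invE.
have beta0 : 0 <= beta by lra.
(* For [t] below [s1], where [Phi y s1 = 1], condition (A1) says nothing; monotonicity and (A1) at
   [s1] itself give the bound 1, whence the maximum. *)
rewrite le_max; have [s1t|ts1] := leP s1 t.
  apply/orP; right; apply: key; rewrite inv1 s1t/=.
  by apply: le_inv => //; exact: le_trans iV.
apply/orP; left; apply: (@le_trans _ _ (Phi x (beta * s1))).
  apply: (orlicz_le oPx); first exact: mulr_ge0.
  by rewrite ler_wpM2l// ltW.
rewrite -s1E; apply: key; rewrite inv1 lexx/=; apply: le_inv => //.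
by rewrite s1E; apply: le_trans iV; exact: ltW.
Qed.

End A1_consequences.

Section local_bounds.
Context {R : realType} {n : nat}.
Local Notation Rn := 'rV[R]_n.
Local Notation mu := (leb R n).
Hypothesis n0 : (0 < n)%N.
Variables (Omega : set Rn) (Phi : Rn -> R -> R).
Hypothesis mOmega : measurable (Omega : set (RdL R n)).
Hypothesis PhiMO : MO_function Omega Phi.
Hypothesis PhiA1 : A1 Omega Phi.

(** Near each point a single good [y] in the domain controls all other points, through [A1_local]
    used in both directions; compactness then gives constants for the cube. The bound at [c] yields
    local integrability of [Phi], the linear lower bound an embedding into L1. *)
Lemma local_normalization (k : R) : 0 <= k -> exists c T, [/\ 0 < c, 0 <= T &
  {ae mu, forall y, Omega y -> cbox k y ->
    Phi y c <= 1 /\ forall u, 0 <= u -> u <= T * (1 + Phi y u)}].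
Proof.
apply: (@cbox_ind R n (fun A => exists c T, [/\ 0 < c, 0 <= T &
  {ae mu, forall y, Omega y -> A y ->
    Phi y c <= 1 /\ forall u, 0 <= u -> u <= T * (1 + Phi y u)}])).
- by exists 1, 0; split => //; apply: ae_all.
- move=> A B [c1 [T1 [c10 T10 H1]]] [c2 [T2 [c20 T20 H2]]].
  exists (Num.min c1 c2), (Num.max T1 T2); split.
  + by rewrite lt_min c10.
  + by rewrite le_max T10.
  apply: ae_imp (ae_and H1 H2) => y [h1 h2] Oy AB.
  have oP := MO_orlicz PhiMO Oy.
  have cm0 : 0 <= Num.min c1 c2 by rewrite le_min !ltW.
  case: AB => [/(h1 Oy)|/(h2 Oy)] [Pc PT]; split.
  + by apply: le_trans Pc; apply: orlicz_le => //; rewrite ge_min lexx.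
  + move=> u u0; apply: (le_trans (PT u u0)).
    by rewrite ler_wpM2r ?le_max ?lexx// addr_ge0// orlicz_ge0.
  + by apply: le_trans Pc; apply: orlicz_le => //; rewrite ge_min lexx orbT.
  + move=> u u0; apply: (le_trans (PT u u0)).
    by rewrite ler_wpM2r ?le_max ?lexx ?orbT// addr_ge0// orlicz_ge0.
- move=> A B AB [c [T [c0 T0 H]]]; exists c, T; split => //.
  by apply: ae_imp H => y + Oy /AB; apply.
move=> x; have [beta [r0 [/andP[b0 b1] r00 Aloc]]] := A1_local n0 PhiMO PhiA1.
pose r := r0 / 2.
have [r_gt0 rr0] : 0 < r /\ r < r0 by rewrite /r; split; lra.
have [V1 [N N0 Nr]] := Aloc r r_gt0 rr0.
have V0 := ball_volume_bound_gt0 n0 r_gt0.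
have iV1 : 1 < (@ball_volume_bound R n r)^-1 by rewrite invf_gt1.
exists (r / 2); first by rewrite divr_gt0.
have near y z : ball x (r / 2) y -> ball x (r / 2) z -> `|y - z| < r.
  rewrite -!ball_normE/= => xy xz.
  by rewrite -(subrKA x) (le_lt_trans (ler_normD _ _))// [`|y - x|]distrC; lra.
(* If the ball has no admissible point, the claim is void almost everywhere and any constants do. *)
have [[y [Oy [nNy By]]]|none] := pselect (exists y, Omega y /\ ~ N y /\ ball x (r / 2) y);
    last first.
  exists 1, 0; split => //; apply: (negligible_ae N0) => y nNy Oy By.
  by exfalso; apply: none; exists y.
have oPy := MO_orlicz PhiMO Oy.
have [s s0 sE] := orlicz_surj oPy ler01.
have s_gt0 : 0 < s.
  rewrite lt_neqAle s0 andbT; apply/eqP => s0'.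
  by move: sE; rewrite -s0' (orlicz0 oPy) => /eqP; rewrite eq_sym oner_eq0.
(* The value 2 exceeds the 1 in the maximum of [A1_local], so a lower bound on [Phi z t] can be read
   off from it. *)
have [t' t'0 t'E] := orlicz_surj oPy (ler0n _ 2).
pose t := t' / beta.
have t0 : 0 <= t by rewrite divr_ge0// ltW.
have btE : beta * t = t' by rewrite /t mulrC divfK// gt_eqF.
exists (beta * s), t; split=> //; first exact: mulr_gt0.
apply: (negligible_ae N0) => z nNz Oz Bz; have oPz := MO_orlicz PhiMO Oz.
split.
  have := Nr z y Oz nNz Oy nNy (near _ _ Bz By) s s0; rewrite sE.
  by move=> /(_ (ltW iV1)); rewrite maxxx.
have Pzt : 1 <= Phi z t.
  have [Vz|/ltW Vz] := leP (Phi z t) (@ball_volume_bound R n r)^-1; last first.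
    by apply: le_trans Vz; exact: ltW.
  have := Nr y z Oy nNy Oz nNz (near _ _ By Bz) t t0 Vz.
  by rewrite btE t'E le_max; case: (leP 1 (Phi z t)) => //; lra.
move=> u u0; have Pu0 : 0 <= Phi z u by exact: orlicz_ge0.
have [ut|tu] := leP u t.
  by rewrite mulrDr mulr1 (le_trans ut)// lerDl mulr_ge0.
have [t0'|t_gt0] : t = 0 \/ 0 < t.
  by move: t0; rewrite le_eqVlt => /predU1P[<-|]; [left|right].
  by move: Pzt; rewrite t0' (orlicz0 oPz); lra.
have : u / t * Phi z t <= Phi z u.
  rewrite -[X in _ <= Phi z X](divfK (x := t)) ?gt_eqF//.
  by apply: orliczM_ge => //; rewrite ler_pdivlMr// mul1r ltW.
rewrite mulrAC ler_pdivrMr// => h.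
have : u * 1 <= u * Phi z t by rewrite ler_wpM2l.
lra.
Qed.

Lemma lint_indic (D A : set Rn) : measurable (D : set (RdL R n)) ->
  measurable (A : set (RdL R n)) -> lint D \1_A = mu (A `&` D).
Proof. by move=> mD mA; rewrite /lint integral_indic. Qed.

Hypothesis Phi_Delta2 : Delta2 Omega Phi.

(** On the cube the constant [c1] has [Phi x c1 <= 1], so its modular is at most the volume;
    [Delta2] rescales [c1] to [c]. *)
Lemma modul_cbox_fin (c k : R) : 0 <= k ->
  (modul Omega Phi (fun x => (c * \1_(cbox k) x)%R) < +oo)%E.
Proof.
move=> k0; have [c1 [T [c10 T0 H]]] := local_normalization k0.
have mk : measurable (cbox k : set (RdL R n)) by apply: borel_RdL; exact: measurable_cbox.
have mc : lmeasurable Omega (fun x => c1 * \1_(cbox k) x).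
  by apply: lmeasurableZ; exact: lmeasurable_indic.
have := @modulZ_fin _ _ _ _ mOmega PhiMO Phi_Delta2 _ (c / c1) mc.
rewrite (_ : (fun x : Rn => c / c1 * (c1 * \1_(cbox k) x)) = (fun x => c * \1_(cbox k) x)); last first.
  by apply/funext => x; rewrite mulrA divfK ?gt_eqF.
apply; apply: (@le_lt_trans _ _ (lint Omega \1_(cbox k))).
  apply: (lint_le mOmega).
  - exact: lmeasurable_Phi.
  - exact: lmeasurable_indic.
  - by move=> x Ox; exact: (Phi_ge0 PhiMO (fun x => c1 * \1_(cbox k) x)).
  - by [].
  apply: ae_imp H => x Hx Ox; rewrite indicE.
  have [xk|xk] := pselect (cbox k x).
    by rewrite mem_set// mulr1 gtr0_norm//; have [] := Hx Ox xk.
  by rewrite memNset// mulr0 normr0 (orlicz0 (MO_orlicz PhiMO Ox)).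
rewrite lint_indic// (@le_lt_trans _ _ (mu (cbox k)))//; last by rewrite leb_cbox// ltry.
by apply: le_measure; rewrite ?inE//; exact: measurableI.
Qed.

(** The lower bound [u <= T * (1 + Phi y u)], integrated over a cube of finite volume. It makes the
    convolution integrals meaningful. *)
Lemma modul_lint_fin (F : Rn -> R) (k : R) : 0 <= k -> lmeasurable Omega F ->
  (forall x, Omega x -> ~ cbox k x -> F x = 0) -> (modul Omega Phi F < +oo)%E ->
  (lint Omega (fun x => `|F x|%R) < +oo)%E.
Proof.
move=> k0 mF F0 Foo; have [c1 [T [_ T0 H]]] := local_normalization k0.
have mk : measurable (cbox k : set (RdL R n)) by apply: borel_RdL; exact: measurable_cbox.
have mI : lmeasurable Omega (\1_(cbox k)) by exact: lmeasurable_indic.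
have mP : lmeasurable Omega (fun x => Phi x `|F x|) by exact: lmeasurable_Phi.
have mIP : lmeasurable Omega (fun x => \1_(cbox k) x + Phi x `|F x|) by exact: lmeasurableD.
have P0 x : Omega x -> 0 <= Phi x `|F x| by exact: (Phi_ge0 PhiMO F).
have IP0 x : Omega x -> 0 <= \1_(cbox k) x + Phi x `|F x|.
  by move=> Ox; rewrite addr_ge0// P0.
apply: (@le_lt_trans _ _ (lint Omega (fun x => T * (\1_(cbox k) x + Phi x `|F x|)))).
  apply: (lint_le mOmega).
  - exact: lmeasurable_norm.
  - exact: lmeasurableZ.
  - by [].
  - by move=> x Ox; rewrite mulr_ge0// IP0.
  apply: ae_imp H => x Hx Ox; have [xk|xk] := pselect (cbox k x).
    by have [_] := Hx Ox xk; rewrite indicE mem_set//; exact.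
  by rewrite F0// normr0 mulr_ge0// addr_ge0// (orlicz0 (MO_orlicz PhiMO Ox)).
rewrite lintZ// lintD// lte_mul_pinfty// ?lee_fin// lte_add_pinfty//.
rewrite lint_indic// (@le_lt_trans _ _ (mu (cbox k)))//; last by rewrite leb_cbox// ltry.
by apply: le_measure; rewrite ?inE//; exact: measurableI.
Qed.

End local_bounds.

(** * Convolution with kernels *)

Section real_integrals.
Context {R : realType} {n : nat}.
Implicit Types (D : set 'rV[R]_n) (f g : 'rV[R]_n -> R).
Local Notation mu := (leb R n).

Definition lintegrable D f := mu.-integrable (D : set (RdL R n)) (EFin \o f : RdL R n -> \bar R).

Definition rint D f : R := (\int[mu]_(x in D) f x)%R.

Lemma lintegrableP D f :
  lintegrable D f <-> lmeasurable D f /\ (lint D (fun x => `|f x|%R) < +oo)%E.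
Proof.
split=> [/integrableP[/measurable_EFinP mf foo]|[mf foo]]; first by split.
by apply/integrableP; split => //; exact: lmeasurable_EFin.
Qed.

Lemma lintegrable_meas D f : lintegrable D f -> lmeasurable D f.
Proof. by move=> /lintegrableP[]. Qed.

Lemma lintegrable_le D f g : measurable (D : set (RdL R n)) -> lmeasurable D f ->
  (forall x, D x -> `|f x| <= `|g x|) -> lintegrable D g -> lintegrable D f.
Proof.
move=> mD mf fg /lintegrableP[mg goo]; apply/lintegrableP; split => //.
apply: le_lt_trans goo; apply: (lint_le mD).
- exact: lmeasurable_norm.
- exact: lmeasurable_norm.
- by [].
- by [].
- by apply: ae_all => x; exact: fg.
Qed.

Lemma lintegrableD D f g : measurable (D : set (RdL R n)) -> lintegrable D f ->
  lintegrable D g -> lintegrable D (fun x => f x + g x).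
Proof. by move=> mD i_f ig; exact: (integrableD mD i_f ig). Qed.

Lemma lintegrableZ D c f : measurable (D : set (RdL R n)) -> lintegrable D f ->
  lintegrable D (fun x => c * f x).
Proof. by move=> mD i_f; exact: (integrableZl mD c i_f). Qed.

Lemma lintegrableB D f g : measurable (D : set (RdL R n)) -> lintegrable D f ->
  lintegrable D g -> lintegrable D (fun x => f x - g x).
Proof. by move=> mD i_f ig; exact: (integrableB mD i_f ig). Qed.

Lemma lintegrable_norm D f : lintegrable D f -> lintegrable D (fun x => `|f x|).
Proof. by move=> i_f; exact: (integrable_norm i_f). Qed.

Lemma lintegrable_bounded_mul D c k f : measurable (D : set (RdL R n)) ->
  lmeasurable D k -> (forall x, D x -> `|k x| <= c) -> lintegrable D f ->
  lintegrable D (fun x => k x * f x).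
Proof.
move=> mD mk kc i_f; have mf := lintegrable_meas i_f.
apply: (@lintegrable_le _ _ (fun x => c * f x)) => //.
- exact: lmeasurableM.
- move=> x Dx; rewrite !normrM ler_wpM2r//.
  by apply: (le_trans (kc x Dx)); exact: ler_norm.
- exact: lintegrableZ.
Qed.

Lemma rintD D f g : measurable (D : set (RdL R n)) -> lintegrable D f ->
  lintegrable D g -> rint D (fun x => f x + g x) = rint D f + rint D g.
Proof. by move=> mD i_f ig; exact: (RintegralD mD i_f ig). Qed.

Lemma rintB D f g : measurable (D : set (RdL R n)) -> lintegrable D f ->
  lintegrable D g -> rint D (fun x => f x - g x) = rint D f - rint D g.
Proof. by move=> mD i_f ig; exact: (RintegralB mD i_f ig). Qed.

Lemma rintZ D c f : measurable (D : set (RdL R n)) -> lintegrable D f ->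
  rint D (fun x => c * f x) = c * rint D f.
Proof. by move=> mD i_f; exact: (RintegralZl c mD i_f). Qed.

Lemma rint_le D f g : measurable (D : set (RdL R n)) -> lintegrable D f ->
  lintegrable D g -> (forall x, D x -> f x <= g x) -> rint D f <= rint D g.
Proof. by move=> mD i_f ig fg; exact: (le_Rintegral mD i_f ig fg). Qed.

Lemma rint_norm D f : measurable (D : set (RdL R n)) -> lintegrable D f ->
  `|rint D f| <= rint D (fun x => `|f x|).
Proof. by move=> mD i_f; exact: (le_normr_Rintegral mD i_f). Qed.

Lemma rint_lint D f : lintegrable D f -> (forall x, D x -> 0 <= f x) ->
  (rint D f)%:E = lint D f.
Proof.
move=> /lintegrableP[mf foo] f0; rewrite /rint /Rintegral fineK//.
rewrite ge0_fin_numE; last exact: lint_ge0.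
rewrite (_ : integral _ _ _ = lint D (fun x => `|f x|)%R)//.
by apply: eq_lint => x Dx; rewrite ger0_norm// f0.
Qed.

Lemma eq_rint D f g : (forall x, D x -> f x = g x) -> rint D f = rint D g.
Proof. by move=> fg; apply: eq_Rintegral => x /set_mem; exact: fg. Qed.

Lemma rint_ge0 D f : (forall x, D x -> 0 <= f x) -> 0 <= rint D f.
Proof. by move=> f0; exact: Rintegral_ge0. Qed.

Lemma rint_ae_eq D f g : measurable (D : set (RdL R n)) -> lmeasurable D f ->
  lmeasurable D g -> {ae mu, forall x, D x -> f x = g x} -> rint D f = rint D g.
Proof.
move=> mD mf mg fg; rewrite /rint /Rintegral; congr fine.
have mf' := lmeasurable_EFin mf; have mg' := lmeasurable_EFin mg.
apply: (@ae_eq_integral _ _ _ mu D (EFin \o g) (EFin \o f) mD mf' mg').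
by apply: ae_imp fg => x fgx Dx; rewrite /= fgx.
Qed.

Lemma rint_setT D f : (forall x, ~ D x -> f x = 0) -> rint D f = rint setT f.
Proof.
move=> f0; rewrite /rint [LHS]Rintegral_mkcond; apply: eq_Rintegral => x _.
by rewrite patchE; case: ifPn => //; rewrite notin_setE => /f0.
Qed.

End real_integrals.

Section uniform_continuity.
Context {R : realType} {n : nat}.
Implicit Types f : 'rV[R]_n -> R.

Definition unif_cts f := forall e, 0 < e -> exists2 d, 0 < d &
  forall z w, `|z - w| < d -> `|f z - f w| < e.

Lemma compact_unif_cts f r : continuous f -> (forall z, r <= `|z| -> f z = 0) ->
  unif_cts f.
Proof.
move=> cf f0 e e0; have r0 : 0 <= Num.max 0 r by rewrite le_max lexx.
have [d d0 dP] : exists2 d, 0 < d & forall z w, cbox (Num.max 0 r) z -> `|z - w| < d -> `|f z - f w| < e.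
  apply: (@cbox_ind R n (fun A => exists2 d, 0 < d & forall z w, A z -> `|z - w| < d -> `|f z - f w| < e)).
  - by exists 1.
  - move=> A B [d1 d10 h1] [d2 d20 h2]; exists (Num.min d1 d2); first by rewrite lt_min d10.
    by move=> z w [/h1 + |/h2 +]; rewrite lt_min => h /andP[? ?]; apply: h.
  - by move=> A B AB [d d0 h]; exists d => // z w /AB; exact: h.
  - move=> x; have e20 : 0 < e / 2 by rewrite divr_gt0.
    have /cvgrPdist_lt/(_ _ e20) := cf x.
    move=> /nbhs_normP[d /= d0 dP].
    exists (d / 2); first by rewrite divr_gt0.
    exists (d / 2); first by rewrite divr_gt0.
    move=> z w; rewrite -ball_normE/= => xz zw.
    rewrite -(subrKA (f x)) (le_lt_trans (ler_normD _ _))//.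
    have h1 : `|f x - f z| < e / 2 by apply: dP => /=; lra.
    have h2 : `|f x - f w| < e / 2.
      apply: dP => /=; rewrite -(subrKA z) (le_lt_trans (ler_normD _ _))//; lra.
    by rewrite [`|f z - _|]distrC; lra.
  - exact: r0.
exists d => // z w zw; have [zr|zr] := leP `|z| (Num.max 0 r).
  by apply: dP => //; rewrite cboxP.
have [wr|wr] := leP `|w| (Num.max 0 r).
  by rewrite distrC; apply: dP; rewrite ?cboxP//= distrC.
rewrite !f0 ?subr0 ?normr0//.
  by rewrite (le_trans _ (ltW wr))// le_max lexx orbT.
by rewrite (le_trans _ (ltW zr))// le_max lexx orbT.
Qed.

Lemma compact_bounded f r : continuous f -> (forall z, r <= `|z| -> f z = 0) ->
  exists2 c, 0 <= c & forall z, `|f z| <= c.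
Proof.
move=> cf f0; have r0 : 0 <= Num.max 0 r by rewrite le_max lexx.
have [c c0 cP] : exists2 c, 0 <= c & forall z, cbox (Num.max 0 r) z -> `|f z| <= c.
  apply: (@cbox_ind R n (fun A => exists2 c, 0 <= c & forall z, A z -> `|f z| <= c)).
  - by exists 0.
  - move=> A B [c1 c10 h1] [c2 c20 h2]; exists (Num.max c1 c2); first by rewrite le_max c10.
    by move=> z [/h1 h|/h2 h]; rewrite le_max h ?orbT.
  - by move=> A B AB [d d0 h]; exists d => // z /AB; exact: h.
  - move=> x; have /cvgrPdist_lt/(_ _ ltr01) := cf x.
    move=> /nbhs_normP[d /= d0 dP]; exists d => //.
    exists (`|f x| + 1); first by rewrite addr_ge0.
    move=> z; rewrite -ball_normE/= => xz; have := dP z xz => /=.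
    by have := lerB_dist (f z) (f x); rewrite distrC; lra.
  - exact: r0.
exists c => // z; have [zr|zr] := leP `|z| (Num.max 0 r).
  by apply: cP; rewrite cboxP.
by rewrite f0 ?normr0// (le_trans _ (ltW zr))// le_max lexx orbT.
Qed.

End uniform_continuity.

Section convolution.
Context {R : realType} {n : nat}.
Local Notation Rn := 'rV[R]_n.
Local Notation mu := (leb R n).
Implicit Types (k F G : Rn -> R) (x : Rn).

(* Correlation rather than convolution: the derivative falls on [k] with a sign. *)
Definition kconv k F x : R := rint setT (fun y => k (y - x) * F y).

Definition bounded_cts k := continuous k /\ exists2 c, 0 <= c & forall z, `|k z| <= c.

Lemma continuous_rVP (f : Rn -> R) : continuous f <->
  forall x e, 0 < e -> exists2 d, 0 < d & forall y, `|x - y| < d -> `|f x - f y| < e.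
Proof.
split=> [cf x e e0|h x].
  by have /cvgrPdist_lt/(_ _ e0)/nbhs_normP[d /= d0 dP] := cf x; exists d.
have H e : 0 < e -> \forall y \near x, `|f x - f y| < e.
  by move=> e0; have [d d0 dP] := h x e e0; apply/nbhs_normP; exists d.
exact: (iffRL (@cvgrPdist_lt R R^o _ (nbhs x) _ f (f x)) H).
Qed.

Lemma continuous_normr k : continuous k -> continuous (fun y : Rn => `|k y|).
Proof.
move=> /continuous_rVP ck; apply/continuous_rVP => x e e0; have [d d0 dP] := ck x e e0.
by exists d => // y /dP; apply: le_lt_trans; exact: ler_dist_dist.
Qed.

Lemma continuous_shift k x : continuous k -> continuous (fun y : Rn => k (y - x)).
Proof.
move=> /continuous_rVP ck; apply/continuous_rVP => y e e0.
have [d d0 dP] := ck (y - x) e e0; exists d => // z yz; apply: dP.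
by rewrite opprB addrA subrK.
Qed.

Lemma continuous_reflect k y : continuous k -> continuous (fun x : Rn => k (y - x)).
Proof.
move=> /continuous_rVP ck; apply/continuous_rVP => x e e0.
have [d d0 dP] := ck (y - x) e e0; exists d => // z xz; apply: dP.
by rewrite opprB addrC subrKA distrC.
Qed.

Lemma kconv_integrable k F x : bounded_cts k -> lintegrable setT F ->
  lintegrable setT (fun y => k (y - x) * F y).
Proof.
move=> [ck [c c0 kc]] iF; apply: (lintegrable_bounded_mul _ _ _ iF (c := c)) => //.
by apply: lmeasurable_continuous; exact: continuous_shift.
Qed.

Lemma kconvDZ k F G a x : bounded_cts k -> lintegrable setT F -> lintegrable setT G ->
  kconv k (fun y => a * F y + G y) x = a * kconv k F x + kconv k G x.
Proof.
move=> bk iF iG; have iF' := kconv_integrable x bk iF.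
have iG' := kconv_integrable x bk iG.
rewrite /kconv -rintZ// -rintD//; last exact: lintegrableZ.
by apply: eq_rint => y _; rewrite mulrDr mulrCA.
Qed.

Lemma kconvB k F G x : bounded_cts k -> lintegrable setT F -> lintegrable setT G ->
  kconv k (fun y => F y - G y) x = kconv k F x - kconv k G x.
Proof.
move=> bk iF iG; rewrite /kconv -rintB//; [|exact: kconv_integrable..].
by apply: eq_rint => y _; rewrite mulrBr.
Qed.

Lemma kconv_le_bound k F x c : bounded_cts k -> lintegrable setT F ->
  (forall z, `|k z| <= c) -> `|kconv k F x| <= c * rint setT (fun y => `|F y|).
Proof.
move=> bk iF kc; have iF' := kconv_integrable x bk iF.
apply: (le_trans (rint_norm measurableT iF')).
rewrite -rintZ//; last exact: lintegrable_norm.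
apply: rint_le => //; first exact: lintegrable_norm.
  by apply: lintegrableZ => //; exact: lintegrable_norm.
by move=> y _; rewrite normrM ler_wpM2r.
Qed.

Lemma kconv_continuous k F : bounded_cts k -> unif_cts k -> lintegrable setT F ->
  continuous (kconv k F).
Proof.
move=> bk uk iF; apply/continuous_rVP => x e e0.
pose I := rint setT (fun y => `|F y|).
have I0 : 0 <= I by apply: rint_ge0.
have eI0 : 0 < e / (I + 1) by rewrite divr_gt0// ltr_wpDl.
have [d d0 dP] := uk _ eI0; exists d => // z xz.
have iFx := kconv_integrable x bk iF; have iFz := kconv_integrable z bk iF.
rewrite /kconv -rintB//; apply: (le_lt_trans (rint_norm measurableT _)).
  exact: lintegrableB.
apply: (@le_lt_trans _ _ (rint setT (fun y => (e / (I + 1)) * `|F y|))).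
  apply: rint_le => //.
  - by apply: lintegrable_norm; exact: lintegrableB.
  - by apply: lintegrableZ => //; exact: lintegrable_norm.
  move=> y _; rewrite -mulrBl normrM ler_wpM2r// ltW// dP//.
  by rewrite opprB addrC subrKA distrC.
rewrite rintZ//; last exact: lintegrable_norm.
by rewrite -/I mulrAC -mulrA gtr_pMr// ltr_pdivrMr ?ltr_wpDl// mul1r ltrDl.
Qed.

Lemma kconv_lint k F x : bounded_cts k -> lintegrable setT F ->
  (forall z, 0 <= k z) -> (forall y, 0 <= F y) ->
  (kconv k F x)%:E = lint setT (fun y => k (y - x) * F y).
Proof.
move=> bk iF k0 F0; apply: rint_lint; first exact: kconv_integrable.
by move=> y _; rewrite mulr_ge0.
Qed.

Lemma lint_kernel_shift k x : continuous k -> (forall z, 0 <= k z) ->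
  lint setT (fun y => k (y - x)) = lint setT k.
Proof.
move=> ck k0; have := @ge0_integral_reflect_shift R n false (- x) (EFin \o k).
rewrite /lint => <-; last 2 first.
- apply/measurable_EFinP; exact: continuous_borel.
- by move=> z; rewrite lee_fin.
apply: eq_integral => y _; rewrite /reflect_shift expr0 scale1r/=.
by rewrite addrC.
Qed.

Lemma lint_kernel_reflect k y : continuous k -> (forall z, 0 <= k z) ->
  lint setT (fun x => k (y - x)) = lint setT k.
Proof.
move=> ck k0; have := @ge0_integral_reflect_shift R n true y (EFin \o k).
rewrite /lint => <-; last 2 first.
- apply/measurable_EFinP; exact: continuous_borel.
- by move=> z; rewrite lee_fin.
by apply: eq_integral => x _; rewrite /reflect_shift expr1 scaleN1r.
Qed.

(** Tonelli: for fixed [y] the reflected kernel [k (y - x)] has mass 1 in [x]. *)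
Lemma lint_kconv k G : bounded_cts k -> (forall z, 0 <= k z) -> lint setT k = 1%E ->
  lintegrable setT G -> (forall y, 0 <= G y) ->
  lint setT (kconv k G) = lint setT G.
Proof.
move=> bk k0 k1 iG G0; have ck := bk.1.
have mG := lintegrable_meas iG.
pose f (p : RdL R n * RdL R n) : \bar R := (k (p.2 - p.1) * G p.2)%:E.
have f0 p : (0 <= f p)%E by rewrite lee_fin mulr_ge0.
have mf : measurable_fun setT f.
  apply/measurable_EFinP; apply: measurable_funM.
    apply: (@measurableT_comp _ _ _ _ _ _ (k : Rn -> measurableTypeR R)).
      exact: continuous_borel.
    apply: measurable_fun_rV => i.
    rewrite (_ : (fun t => _) = (fun p : RdL R n * RdL R n => (p.2 : Rn) 0 i - (p.1 : Rn) 0 i)).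
      have mc : lmeasurable setT (fun x : Rn => x 0 i).
        by apply: lmeasurable_continuous; exact: coord_continuous.
      apply: measurable_funB.
        exact: (measurableT_comp mc measurable_snd).
      exact: (measurableT_comp mc measurable_fst).
    by apply/funext => p; rewrite !mxE.
  exact: (measurableT_comp mG measurable_snd).
transitivity (\int[mu]_x \int[mu]_y f (x, y))%E.
  by apply: eq_integral => x _; rewrite kconv_lint.
rewrite fubini_tonelli//; apply: eq_integral => y _.
transitivity (lint setT (fun x => G y * k (y - x))).
  by apply: eq_integral => x _; rewrite /f/= mulrC.
rewrite lintZ// ?lint_kernel_reflect// ?k1 ?mule1//.
by apply: lmeasurable_continuous; exact: continuous_reflect.
Qed.

End convolution.

(** * Boundedness of mollification in the modular *)

Section extension_by_zero.
Context {R : realType} {n : nat}.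
Implicit Types (D : set 'rV[R]_n) (f : 'rV[R]_n -> R).

Lemma lint_setT D f : (forall x, ~ D x -> f x = 0) -> lint D f = lint setT f.
Proof.
move=> f0; rewrite /lint [LHS]integral_mkcond; apply: eq_integral => x _.
by rewrite patchE; case: ifPn => //; rewrite notin_setE => /f0 ->.
Qed.

Lemma lmeasurable_patch D f : measurable (D : set (RdL R n)) -> lmeasurable D f ->
  lmeasurable setT (f \_ D).
Proof. by move=> mD mf; apply/(measurable_restrictT _ mD). Qed.

Lemma rint0 D : rint D (fun=> 0) = 0.
Proof.
rewrite /rint /Rintegral (_ : integral _ _ _ = 0%E)//.
by apply: integral0_eq => x _.
Qed.

Lemma measurable_cbox_RdL (k : R) : measurable (cbox k : set (RdL R n)).
Proof. by apply: borel_RdL; exact: measurable_cbox. Qed.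

End extension_by_zero.

Section kernels.
Context {R : realType} {n : nat}.
Local Notation Rn := 'rV[R]_n.
Hypothesis n0 : (0 < n)%N.

(** The height is bounded by [K] over the volume bound of [A1_local] at the same scale [r], with [K]
    to be kept independent of [r]. The support may lie off-centre in the ball of radius [r], which
    leaves room for kernels pushed into the domain. *)
Definition kernel (K r : R) (k : Rn -> R) :=
  [/\ continuous k, forall z, 0 <= k z, forall z, r <= `|z| -> k z = 0,
      lint setT k = 1%E & forall z, k z * @ball_volume_bound R n r <= K].

Lemma kernel_bounded K r k : 0 < r -> kernel K r k -> bounded_cts k.
Proof.
move=> r0 [ck k0 _ _ kK]; have V0 := ball_volume_bound_gt0 n0 r0.
split=> //; exists (K / @ball_volume_bound R n r).
  by rewrite divr_ge0 ?(ltW V0)//; apply: le_trans (kK 0); rewrite mulr_ge0// ltW.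
by move=> z; rewrite ger0_norm// ler_pdivlMr.
Qed.

Lemma kernel_unif K r k : kernel K r k -> unif_cts k.
Proof. by move=> [ck _ kr _ _]; exact: compact_unif_cts kr. Qed.

Lemma kernel_kconv_meas K r k F : 0 < r -> kernel K r k -> lintegrable setT F ->
  lmeasurable setT (kconv k F).
Proof.
move=> r0 kk iF; apply: lmeasurable_continuous; apply: kconv_continuous => //.
- exact: kernel_bounded kk.
- exact: kernel_unif kk.
Qed.

Lemma kconv_supp K r k F M x : kernel K r k -> (forall y, M < `|y| -> F y = 0) ->
  M + r <= `|x| -> kconv k F x = 0.
Proof.
move=> [_ _ kr _ _] FM xM; rewrite /kconv.
rewrite -[RHS](rint0 (n := n) setT); apply: eq_rint => y _.
have [yM|/FM ->] := leP `|y| M; last by rewrite mulr0.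
rewrite kr ?mul0r//; have := lerB_dist x y; rewrite distrC; lra.
Qed.

Lemma rint_kernel_shift K r k x : 0 < r -> kernel K r k ->
  lintegrable setT (fun y => k (y - x)) /\ rint setT (fun y => k (y - x)) = 1.
Proof.
move=> r0 [ck k0 kr k1 kK]; have i_k : lintegrable setT (fun y => k (y - x)).
  apply/lintegrableP; split.
    by apply: lmeasurable_continuous; exact: continuous_shift.
  rewrite (_ : lint _ _ = lint setT (fun y => k (y - x))); last first.
    by apply: eq_lint => y _; rewrite ger0_norm.
  by rewrite lint_kernel_shift// k1 ltry.
split=> //; apply: EFin_inj; rewrite rint_lint//.
by rewrite lint_kernel_shift.
Qed.

Lemma kconv_norm_le K r k F x : 0 < r -> kernel K r k -> lintegrable setT F ->
  `|kconv k F x| <= kconv k (fun y => `|F y|) x.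
Proof.
move=> r0 kk iF; have bk := kernel_bounded r0 kk.
apply: (le_trans (rint_norm measurableT (kconv_integrable x bk iF))).
rewrite le_eqVlt; apply/orP; left; apply/eqP; apply: eq_rint => y _.
by case: kk => _ k0 _ _ _; rewrite normrM ger0_norm.
Qed.

End kernels.

Section mollification.
Context {R : realType} {n : nat}.
Local Notation Rn := 'rV[R]_n.
Local Notation mu := (leb R n).
Hypothesis n0 : (0 < n)%N.
Variables (Omega : set Rn) (Phi : Rn -> R -> R).
Hypothesis mOmega : measurable (Omega : set (RdL R n)).
Hypothesis PhiMO : MO_function Omega Phi.

Implicit Types F : Rn -> R.

Lemma modul_patch F : lint setT ((fun y => Phi y `|F y|) \_ Omega) = modul Omega Phi F.
Proof.
rewrite -(@lint_setT _ _ Omega).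
  by apply: eq_lint => y Oy; rewrite patchE mem_set.
by move=> y nOy; rewrite patchE memNset.
Qed.

Lemma patch_Phi_ge0 F y : 0 <= ((fun y => Phi y `|F y|) \_ Omega) y.
Proof.
rewrite patchE; case: ifPn => // /set_mem Oy.
exact: (Phi_ge0 PhiMO F).
Qed.

Lemma lintegrable_patch F : lmeasurable setT F -> (modul Omega Phi F < +oo)%E ->
  lintegrable setT ((fun y => Phi y `|F y|) \_ Omega).
Proof.
move=> mF Foo; apply/lintegrableP; split.
  apply: lmeasurable_patch => //; apply: lmeasurable_Phi => //.
  exact: lmeasurableS mF.
move: Foo; rewrite -modul_patch; congr (_ < _)%E.
by apply: eq_lint => y _; rewrite ger0_norm// patch_Phi_ge0.
Qed.

(* A Jensen inequality without convexity in the space variable: with [t] half of the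
   mean value of [|F|] near [x], the part of [F] above [t] carries at least half
   of the mean, and there [Phi y |F y| >= |F y| / t * Phi y t]. *)
Lemma mollified_Phi_le beta K r sigma k F (N : set Rn) x : 0 < beta -> 0 < r ->
  (forall x y, Omega x -> ~ N x -> Omega y -> ~ N y -> `|x - y| < r ->
     forall t, 0 <= t -> Phi y t <= (@ball_volume_bound R n r)^-1 ->
     Phi x (beta * t) <= Num.max 1 (Phi y t)) ->
  mu.-negligible (N : set (RdL R n)) ->
  kernel K r k -> lintegrable setT F -> (forall y, ~ Omega y -> F y = 0) ->
  (modul Omega Phi F <= sigma%:E)%E -> K * sigma < 1 ->
  Omega x -> ~ N x ->
  Phi x (beta / 2 * kconv k (fun y => `|F y|) x) <=
  Num.max 1 (kconv k ((fun y => Phi y `|F y|) \_ Omega) x).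
Proof.
move=> b0 r0 loc N0 kk iF FO Fs Ks Ox nNx.
have [ck k0 kr k1 kK] := kk; have bk := kernel_bounded n0 r0 kk.
have V0 := ball_volume_bound_gt0 (R := R) n0 r0.
set G := _ \_ Omega; set M := kconv k _ x; set J := kconv k G x.
have mF := lintegrable_meas iF.
have Foo : (modul Omega Phi F < +oo)%E by apply: le_lt_trans Fs _; rewrite ltry.
have iG : lintegrable setT G by exact: lintegrable_patch.
have G0 y : 0 <= G y by exact: patch_Phi_ge0.
have oPx := MO_orlicz PhiMO Ox.
have iaF := lintegrable_norm iF.
have M0 : 0 <= M by apply: rint_ge0 => y _; rewrite mulr_ge0.
pose P := (@ball_volume_bound R n r)^-1.
(* The height of the kernel together with [K * sigma < 1] keeps the mean [J] strictly below [P], the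
   top of the range where points can be compared. *)
have JP : J < P.
  have : J <= K / @ball_volume_bound R n r * rint setT (fun y => `|G y|).
    apply: (le_trans (ler_norm _)); apply: kconv_le_bound => // z.
    by rewrite ger0_norm// ler_pdivlMr.
  rewrite (eq_rint (g := G)); last by move=> y _; rewrite ger0_norm.
  have Gs : rint setT G <= sigma by rewrite -lee_fin rint_lint// modul_patch.
  move=> /le_lt_trans; apply; rewrite mulrAC /P ltr_pdivrMr// mulVf ?gt_eqF//.
  apply: le_lt_trans Ks; apply: ler_wpM2l => //.
  by apply: le_trans (kK 0); rewrite mulr_ge0// ltW.
pose t := M / 2; have -> : beta / 2 * M = beta * t by rewrite /t; lra.
have [t0|t_gt0] : t = 0 \/ 0 < t.
  have : 0 <= t by rewrite divr_ge0.
  by rewrite le_eqVlt => /predU1P[<-|]; [left|right].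
  by rewrite t0 mulr0 (orlicz0 oPx) le_max ler01.
have [small|big] := leP (Phi x (beta * t)) 1; first by rewrite le_max small.
(* The cap [P] serves those [y] for which [Phi y t] exceeds the range of (A1); in the end [J < P]
   removes it. *)
pose m := Num.min (Phi x (beta * t)) P.
have P0 : 0 < P by rewrite invr_gt0.
have m0 : 0 < m by rewrite lt_min P0 andbT; exact: lt_trans big.
suff mJ : m <= J.
  rewrite le_max; apply/orP; right; move: mJ; rewrite /m.
  by case: (leP (Phi x (beta * t)) P) => // _ PJ; move: JP; rewrite ltNge PJ.
have [ik ik1] := rint_kernel_shift x r0 kk.
(* Under the kernel [|F y| <= t + t / m * G y]. Averaged, this reads [M <= t + t / m * J], and
   [M = 2 * t] leaves [m <= J]. *)
have key : (lint setT (fun y : Rn => (k (y - x) * `|F y|)%R) <=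
    lint setT (fun y : Rn => (t * k (y - x) + t / m * (k (y - x) * G y))%R))%E.
  have mk : lmeasurable setT (fun y => k (y - x)) by exact: lintegrable_meas ik.
  have mG := lintegrable_meas iG.
  have tm0 : 0 <= t / m by rewrite divr_ge0// ltW.
  apply: lint_le => //.
  - by apply: lmeasurableM => //; exact: lmeasurable_norm.
  - apply: lmeasurableD; first exact: lmeasurableZ.
    by apply: lmeasurableZ; exact: lmeasurableM.
  - by move=> y _; rewrite mulr_ge0.
  - by move=> y _; rewrite addr_ge0// mulr_ge0// ?(ltW t_gt0)// mulr_ge0.
  apply: (negligible_ae N0) => y nNy _.
  rewrite [t / m * _]mulrCA [t * _]mulrC -mulrDr.
  have [yr|yr] := leP r `|y - x|; first by rewrite kr// !mul0r.
  rewrite ler_wpM2l//.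
  have [Oy|nOy] := pselect (Omega y); last first.
    by rewrite FO// normr0 addr_ge0 ?(ltW t_gt0)// mulr_ge0.
  have oPy := MO_orlicz PhiMO Oy.
  have [Ft|tF] := leP `|F y| t; first by rewrite (le_trans Ft)// lerDl mulr_ge0.
  (* In range, [Phi x (beta * t)] is at most the maximum of 1 and [Phi y t]; as it exceeds 1, the
     maximum is [Phi y t]. *)
  have mPy : m <= Phi y t.
    have [Py|Py] := leP (Phi y t) P; last by rewrite ge_min (ltW Py) orbT.
    rewrite ge_min; apply/orP; left.
    have := loc x y Ox nNx Oy nNy; rewrite distrC => /(_ yr t (ltW t_gt0) Py).
    rewrite le_max; case: (leP (Phi x (beta * t)) (Phi y t)) => //.
    by move=> _; rewrite orbF; lra.
  have GE : G y = Phi y `|F y| by rewrite /G patchE mem_set.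
  have : `|F y| / t * Phi y t <= Phi y `|F y|.
    rewrite -[X in _ <= Phi y X](divfK (x := t)) ?gt_eqF//.
    by apply: (orliczM_ge oPy); [rewrite ler_pdivlMr// mul1r|]; exact: ltW.
  rewrite -GE => h.
  have h2 : `|F y| / t * m <= G y.
    by apply: le_trans h; rewrite ler_wpM2l// divr_ge0// ltW.
  apply: (@le_trans _ _ (t / m * G y)); last by rewrite lerDr ltW.
  rewrite mulrAC ler_pdivlMr//; move: h2.
  by rewrite mulrAC ler_pdivrMr// [G y * t]mulrC.
move: key; rewrite -kconv_lint//.
have -> : lint setT (fun y => t * k (y - x) + t / m * (k (y - x) * G y)) =
    (t + t / m * J)%:E.
  rewrite -rint_lint; last 2 first.
  - apply: lintegrableD => //; apply: lintegrableZ => //.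
    exact: kconv_integrable.
  - move=> y _; rewrite addr_ge0// mulr_ge0 ?(ltW t_gt0)//.
      by rewrite divr_ge0// ltW.
    by rewrite mulr_ge0.
  rewrite rintD//; last 2 first.
  - exact: lintegrableZ.
  - by apply: lintegrableZ => //; exact: kconv_integrable.
  rewrite rintZ// ik1 mulr1 rintZ//; exact: kconv_integrable.
rewrite lee_fin -/M => h.
have : t <= t / m * J by rewrite /t in h *; lra.
rewrite mulrAC ler_pdivlMr// ler_pM2l//.
Qed.

End mollification.

Section distance_to_complement.
Context {R : realType} {n : nat}.
Local Notation Rn := 'rV[R]_n.
Variable Omega : set Rn.
Hypothesis oOmega : open Omega.

(** The distance to the complement, capped at 1 so that the supremum is finite even when [Omega] is
    the whole space. *)
Definition inner_radius (x : Rn) : R :=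
  sup [set r : R | 0 <= r <= 1 /\ forall y, `|x - y| < r -> Omega y].

Let S (x : Rn) := [set r : R | 0 <= r <= 1 /\ forall y, `|x - y| < r -> Omega y].

Let S0 x : S x 0.
Proof. by split; [rewrite lexx ler01|move=> y; rewrite ltNge normr_ge0]. Qed.

Let Ssup x : has_sup (S x).
Proof. by split; [exists 0; exact: S0|exists 1 => r [/andP[]]]. Qed.

Lemma inner_radius_ge0 x : 0 <= inner_radius x.
Proof. by apply: sup_upper_bound; [exact: Ssup|exact: S0]. Qed.

Lemma inner_radius_out x : ~ Omega x -> inner_radius x = 0.
Proof.
move=> nOx; apply/eqP; rewrite eq_le inner_radius_ge0 andbT.
apply: ge_sup; first by exists 0; exact: S0.
move=> r [_ rO]; rewrite leNgt; apply/negP => r0; apply: nOx; apply: rO.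
by rewrite subrr normr0.
Qed.

Lemma inner_radius_gt0 x : Omega x -> 0 < inner_radius x.
Proof.
move=> Ox; have : nbhs x Omega by exact: open_nbhs_nbhs.
move=> /nbhs_normP[e /= e0 eO].
have m0 : 0 < Num.min e 1 by rewrite lt_min e0 ltr01.
apply: lt_le_trans m0 _; apply: sup_upper_bound; first exact: Ssup.
split; first by rewrite ge_min lexx orbT andbT le_min ler01 ltW.
by move=> y; rewrite lt_min => /andP[+ _]; exact: eO.
Qed.

Lemma inner_radius_lipschitz x y : `|inner_radius x - inner_radius y| <= `|x - y|.
Proof.
suff h u v : inner_radius u <= inner_radius v + `|u - v|.
  have h1 := h x y; have h2 := h y x; rewrite distrC in h2.
  by rewrite ler_norml; apply/andP; split; lra.
apply: ge_sup; first by exists 0; exact: S0.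
move=> r [/andP[r0 r1] rO]; have [ruv|uvr] := leP r `|u - v|.
  by rewrite (le_trans ruv)// lerDr inner_radius_ge0.
rewrite -lerBlDr; apply: sup_upper_bound; first exact: Ssup.
split; first by have := normr_ge0 (u - v); lra.
move=> z vz; apply: rO; rewrite -(subrKA v) (le_lt_trans (ler_normD _ _))//; lra.
Qed.

End distance_to_complement.

(** * Uniform bounds and norm convergence of mollifications *)

Section mollification_convergence.
Context {R : realType} {n : nat}.
Local Notation Rn := 'rV[R]_n.
Hypothesis n0 : (0 < n)%N.
Variables (Omega : set Rn) (Phi : Rn -> R -> R).
Hypothesis oOmega : open Omega.
Hypothesis PhiMO : MO_function Omega Phi.
Hypothesis PhiA1 : A1 Omega Phi.
Implicit Types F G : Rn -> R.

Let mOmega : measurable (Omega : set (RdL R n)).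
Proof. exact: open_RdL. Qed.

(** Boundedly supported elements of L^Phi, extended by zero so that they can be convolved over the
    whole space. *)
Definition LPhi0 (kk : R) F := [/\ lmeasurable setT F, forall x, ~ Omega x -> F x = 0,
  forall x, kk < `|x| -> F x = 0 & (modul Omega Phi F < +oo)%E].

Lemma LPhi0_meas kk F : LPhi0 kk F -> lmeasurable Omega F.
Proof. by move=> [mF _ _ _]; exact: lmeasurableS mF. Qed.

Lemma LPhi0_integrable kk F : 0 <= kk -> LPhi0 kk F -> lintegrable setT F.
Proof.
move=> kk0 HF; have [mF FO Fk Foo] := HF; apply/lintegrableP; split=> //.
rewrite -(@lint_setT _ _ Omega); last by move=> x /FO ->; rewrite normr0.
apply: (modul_lint_fin n0 mOmega PhiMO PhiA1 kk0) Foo; first exact: LPhi0_meas HF.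
move=> x _; rewrite cboxP//= => /negP; rewrite -ltNge; exact: Fk.
Qed.

Lemma modulZ_le (c : R) F : 0 <= c <= 1 -> lmeasurable Omega F ->
  (modul Omega Phi (fun x => c * F x)%R <= c%:E * modul Omega Phi F)%E.
Proof.
move=> /andP[c0 c1] mF; have mP := lmeasurable_Phi mOmega PhiMO mF.
rewrite /modul -lintZ//; last by move=> x Ox; exact: (Phi_ge0 PhiMO F).
apply: lint_le => //.
- by apply: lmeasurable_Phi => //; exact: lmeasurableZ.
- exact: lmeasurableZ.
- by move=> x Ox; exact: (Phi_ge0 PhiMO (fun x => c * F x)).
- by move=> x Ox; rewrite mulr_ge0//; exact: (Phi_ge0 PhiMO F).
apply: ae_all => x Ox; rewrite normrM ger0_norm//.
by apply: orliczM_le; [exact: (MO_orlicz PhiMO)|rewrite c0|].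
Qed.

(** Integrating [mollified_Phi_le], the 1 in its maximum contributes at most the volume [V] of a
    cube containing the support of the convolution, and the mean of [Phi] contributes at most
    [sigma <= 1]. Convexity divides the total by [D = V + 1]. *)
Lemma kconv_bounded (K kk : R) : 0 < K -> 0 <= kk -> exists r0 C sigma,
  [/\ 0 < r0, 0 < C, 0 < sigma <= 1 &
  forall F l r k, LPhi0 kk F -> 0 < l ->
    (modul Omega Phi (fun x => F x / l)%R <= sigma%:E)%E ->
    0 < r -> r < r0 -> kernel K r k -> Nle Omega Phi (kconv k F) (C * l)].
Proof.
move=> K0 kk0.
have [beta [r0 [/andP[b0 b1] r00 Aloc]]] := A1_local n0 PhiMO PhiA1.
pose V : R := (2 * (kk + 1)) ^+ n.
have V0 : 0 <= V by rewrite exprn_ge0// mulr_ge0// addr_ge0.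
pose D := V + 1; have D1 : 1 <= D by rewrite /D lerDr.
have D0 : 0 < D by lra.
(* The factor 2 makes [K * sigma] at most one half, as the strict inequality in [mollified_Phi_le]
   requires. *)
pose sigma := Num.min 1 ((2 * K)^-1).
have s0 : 0 < sigma by rewrite lt_min ltr01 invr_gt0 mulr_gt0.
have Ks : K * sigma < 1.
  apply: (@le_lt_trans _ _ (K * (2 * K)^-1)).
    by rewrite ler_wpM2l ?(ltW K0)// ge_min lexx orbT.
  by rewrite invfM mulrCA mulfV ?gt_eqF//; lra.
have s1 : sigma <= 1 by rewrite ge_min lexx.
(* [2 / beta] undoes the factor of the Jensen inequality and [D] is the divisor supplied by
   convexity. Radii below 1 keep the convolution inside the cube of radius [kk + 1]. *)
exists (Num.min r0 1), (2 * D / beta), sigma; split => //.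
- by rewrite lt_min r00 ltr01.
- by rewrite divr_gt0// mulr_gt0.
- by rewrite s0.
move=> F l r k HF l0 Fl r_gt0; rewrite lt_min => /andP[rr0 r1] kk_.
have [_ [N N0 loc]] := Aloc r r_gt0 rr0.
have iF := LPhi0_integrable kk0 HF.
have [mF FO Fk Foo] := HF.
pose F' x := F x / l.
have iF' : lintegrable setT F'.
  by rewrite /F'; under eq_fun do rewrite mulrC; exact: lintegrableZ.
have F'O y : ~ Omega y -> F' y = 0 by move=> /FO; rewrite /F' => ->; rewrite mul0r.
have F'k y : kk < `|y| -> F' y = 0 by move=> /Fk; rewrite /F' => ->; rewrite mul0r.
have bk := kernel_bounded n0 r_gt0 kk_.
split; first by rewrite mulr_gt0// divr_gt0// mulr_gt0.
set G := (fun y => Phi y `|F' y|) \_ Omega.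
have F'oo : (modul Omega Phi F' < +oo)%E by apply: le_lt_trans Fl _; rewrite ltry.
have mF' : lmeasurable setT F' := lintegrable_meas iF'.
have iG : lintegrable setT G by exact: lintegrable_patch.
have G0 y : 0 <= G y by exact: patch_Phi_ge0.
have [ck k0 kr k1 kK] := kk_.
have mJ : lmeasurable setT (kconv k G) by exact: kernel_kconv_meas kk_ iG.
have J0 x : 0 <= kconv k G x by apply: rint_ge0 => y _; rewrite mulr_ge0.
have mI : lmeasurable setT (\1_(cbox (kk + 1)) : Rn -> R).
  by apply: lmeasurable_indic; exact: measurable_cbox_RdL.
have mkF : lmeasurable setT (kconv k F) by exact: kernel_kconv_meas kk_ iF.
have Di0 : 0 <= D^-1 by rewrite invr_ge0 ltW.
have IJ0 x : 0 <= \1_(cbox (kk + 1)) x + kconv k G x by rewrite addr_ge0.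
apply: (@le_trans _ _ (lint setT (fun x => D^-1 * (\1_(cbox (kk + 1)) x + kconv k G x)))).
  apply: (@le_trans _ _ (lint Omega (fun x => D^-1 * (\1_(cbox (kk + 1)) x + kconv k G x)))).
    apply: lint_le => //.
    - apply: lmeasurable_Phi => //; apply: lmeasurable_div; exact: lmeasurableS mkF.
    - apply: lmeasurableS (lmeasurableZ _ (lmeasurableD mI mJ)); last by [].
      exact: measurableT.
    - by move=> x Ox; exact: (Phi_ge0 PhiMO (fun x => kconv k F x / _)).
    - by move=> x _; rewrite mulr_ge0.
    apply: (negligible_ae N0) => x nNx Ox; have oPx := MO_orlicz PhiMO Ox.
    have [xk|xk] := leP `|x| (kk + 1); last first.
      rewrite (@kconv_supp _ _ _ _ _ _ kk _ kk_)//; last by apply: le_trans (ltW xk); lra.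
      by rewrite mul0r normr0 (orlicz0 oPx) mulr_ge0.
    have := mollified_Phi_le n0 mOmega PhiMO b0 r_gt0 loc N0 kk_ iF' F'O Fl Ks Ox nNx.
    rewrite -/G => key.
    have kF' : kconv k F x = l * kconv k F' x.
      have := kconvDZ l x bk iF' (integrable0 _ _ : lintegrable setT (fun=> 0)).
      rewrite (_ : (fun y => _) = F); last first.
        by apply/funext => y; rewrite addr0 /F' mulrC divfK// gt_eqF.
      move=> ->; rewrite [X in _ + X](_ : _ = 0) ?addr0//.
      by rewrite /kconv -[RHS](rint0 (n := n) setT); apply: eq_rint => y _; rewrite mulr0.
    have -> : kconv k F x / (2 * D / beta * l) = D^-1 * (beta / 2 * kconv k F' x).
      by rewrite kF'; field; rewrite !gt_eqF.
    rewrite normrM ger0_norm//.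
    have Di1 : D^-1 <= 1 by rewrite invf_le1.
    apply: (le_trans (orliczM_le oPx _ _)); rewrite ?Di0//.
    rewrite ler_wpM2l//; apply: (@le_trans _ _ (Num.max 1 (kconv k G x))).
      apply: le_trans key; apply: (orlicz_le oPx); first exact: normr_ge0.
      have bb : 0 <= beta / 2 by lra.
      by rewrite normrM (ger0_norm bb) ler_wpM2l// (kconv_norm_le n0 x r_gt0 kk_ iF').
    rewrite indicE mem_set ?cboxP ?addr_ge0//= ge_max lerDl J0/=.
    by rewrite lerDr.
  apply: lintS => //; first by apply: lmeasurableZ; exact: lmeasurableD.
  by move=> x _; rewrite mulr_ge0.
rewrite lintZ// ?lintD//; last exact: lmeasurableD.
rewrite lint_indic//; last exact: measurable_cbox_RdL.
rewrite setIT leb_cbox ?addr_ge0// (lint_kconv bk k0 k1 iG G0) modul_patch.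
have : (V%:E + modul Omega Phi F' <= D%:E)%E.
  by rewrite /D EFinD leeD2l// (le_trans Fl)// lee_fin.
move=> h; apply: (@le_trans _ _ (D^-1%:E * D%:E)%E); first by rewrite lee_wpmul2l// lee_fin.
by rewrite -EFinM mulVf// gt_eqF.
Qed.

End mollification_convergence.

Section mollifiable.
Context {R : realType} {n : nat}.
Local Notation Rn := 'rV[R]_n.
Local Notation mu := (leb R n).
Hypothesis n0 : (0 < n)%N.
Variables (Omega : set Rn) (Phi : Rn -> R -> R).
Hypothesis oOmega : open Omega.
Hypothesis PhiMO : MO_function Omega Phi.
Hypothesis PhiA1 : A1 Omega Phi.
Hypothesis Phi_Delta2 : Delta2 Omega Phi.
Implicit Types F G H : Rn -> R.

Let mOmega : measurable (Omega : set (RdL R n)).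
Proof. exact: open_RdL. Qed.

Lemma modul_cvg0 (f_ : nat -> Rn -> R) H :
  (forall m, lmeasurable Omega (f_ m)) -> lmeasurable Omega H ->
  (modul Omega Phi H < +oo)%E ->
  (forall m x, Omega x -> `|f_ m x| <= `|H x|) ->
  (forall x, Omega x -> f_ ^~ x @ \oo --> (0 : R)) ->
  forall e, 0 < e -> \forall m \near \oo, (modul Omega Phi (f_ m) <= e%:E)%E.
Proof.
move=> mf mH Hoo fH f0 e e0.
have [|||||_ _] := @dominated_convergence _ _ _ mu Omega mOmega
  (fun m x => (Phi x `|f_ m x|)%:E) (cst 0%E) (fun x => (Phi x `|H x|)%:E).
- by move=> m; apply: lmeasurable_EFin; exact: lmeasurable_Phi.
- exact: measurable_cst.
- apply: ae_all => x Ox; have oPx := MO_orlicz PhiMO Ox.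
  apply: cvg_EFin; first exact: nearW.
  apply/cvgrPdist_lt => eta eta0.
  have [t t0 tE] := orlicz_surj oPx (ltW eta0).
  have {}t0 : 0 < t.
    rewrite lt_neqAle t0 andbT; apply/eqP => t0'.
    by move: eta0; rewrite -tE -t0' (orlicz0 oPx) ltxx.
  have /cvgrPdist_lt/(_ t t0) := f0 x Ox; apply: filterS => m /=.
  rewrite !sub0r !normrN => ft; rewrite ger0_norm; last exact: (orlicz_ge0 oPx).
  by rewrite -tE; exact: (orlicz_lt oPx).
- apply/lintegrableP; split; first exact: lmeasurable_Phi.
  move: Hoo; congr (_ < _)%E; apply: eq_lint => x Ox.
  by rewrite (ger0_norm (Phi_ge0 PhiMO H Ox)).
- apply: ae_all => x m Ox; rewrite lee_fin (ger0_norm (Phi_ge0 PhiMO (f_ m) Ox)).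
  by apply: (orlicz_le (MO_orlicz PhiMO Ox)) => //; exact: fH.
rewrite integral0 => /fine_cvgP[ffin /cvgrPdist_lt/(_ e e0) flt].
near=> m; have h1 : lint Omega (fun x => Phi x `|f_ m x|) \is a fin_num by near: m.
rewrite /modul -[X in (X <= _)%E](fineK h1) lee_fin.
have h2 : `|0 - fine (lint Omega (fun x => Phi x `|f_ m x|))| < e by near: m.
by move: h2; rewrite sub0r normrN => h2; exact: le_trans (ler_norm _) (ltW h2).
Unshelve. all: by end_near. Qed.

Lemma Nle_mono F l l' : lmeasurable Omega F -> l <= l' -> Nle Omega Phi F l ->
  Nle Omega Phi F l'.
Proof.
move=> mF ll' [l0 Fl]; have l'0 : 0 < l' by exact: lt_le_trans ll'.
split=> //; apply: le_trans Fl; apply: le_modul => //.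
- exact: lmeasurable_div.
- exact: lmeasurable_div.
apply: ae_all => x Ox; rewrite !normrM !normfV (gtr0_norm l0) (gtr0_norm l'0).
by rewrite ler_wpM2l// lef_pV2.
Qed.

Lemma Nle0 l : 0 < l -> Nle Omega Phi (fun=> 0) l.
Proof.
move=> l0; split=> //; rewrite (_ : modul _ _ _ = 0%E)//.
apply: integral0_eq => x Ox; rewrite mul0r normr0.
by rewrite (orlicz0 (MO_orlicz PhiMO Ox)).
Qed.

Lemma NleZ_le F a l l' : lmeasurable Omega F -> `|a| * l <= l' -> 0 < l' ->
  Nle Omega Phi F l -> Nle Omega Phi (fun x => a * F x) l'.
Proof.
move=> mF al l'0 Fl; have [->|a0] := eqVneq a 0.
  by under eq_fun do rewrite mul0r; exact: Nle0.
apply: (Nle_mono _ al); first exact: lmeasurableZ.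
exact: NleZ.
Qed.

Lemma modulD_fin F G : lmeasurable Omega F -> lmeasurable Omega G ->
  (modul Omega Phi F < +oo)%E -> (modul Omega Phi G < +oo)%E ->
  (modul Omega Phi (fun x => F x + G x)%R < +oo)%E.
Proof.
move=> mF mG Foo Goo.
have F2 := modulZ_fin mOmega PhiMO Phi_Delta2 2 mF Foo.
have G2 := modulZ_fin mOmega PhiMO Phi_Delta2 2 mG Goo.
have m2F := lmeasurable_Phi mOmega PhiMO (lmeasurableZ 2 mF).
have m2G := lmeasurable_Phi mOmega PhiMO (lmeasurableZ 2 mG).
have F0 x : Omega x -> 0 <= Phi x `|2 * F x| by exact: (Phi_ge0 PhiMO (fun x => 2 * F x)).
have G0 x : Omega x -> 0 <= Phi x `|2 * G x| by exact: (Phi_ge0 PhiMO (fun x => 2 * G x)).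
apply: (@le_lt_trans _ _ (lint Omega (fun x => Phi x `|2 * F x| + Phi x `|2 * G x|))).
  apply: lint_le => //.
  - by apply: lmeasurable_Phi => //; exact: lmeasurableD.
  - exact: lmeasurableD.
  - by move=> x Ox; exact: (Phi_ge0 PhiMO (fun x => F x + G x)).
  - by move=> x Ox; rewrite addr_ge0 ?F0 ?G0.
  apply: ae_all => x Ox; have oPx := MO_orlicz PhiMO Ox.
  have FG := ler_normD (F x) (G x).
  have [h|h] := leP `|F x| `|G x|.
    rewrite (@le_trans _ _ (Phi x `|2 * G x|)) ?lerDr ?F0//.
    apply: (orlicz_le oPx) => //; rewrite normrM gtr0_norm//; lra.
  rewrite (@le_trans _ _ (Phi x `|2 * F x|)) ?lerDl ?G0//.
  apply: (orlicz_le oPx) => //; rewrite normrM gtr0_norm//; lra.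
by rewrite lintD// lte_add_pinfty.
Qed.

Lemma LPhi0_lin kk a F G : LPhi0 Omega Phi kk F -> LPhi0 Omega Phi kk G ->
  LPhi0 Omega Phi kk (fun x => a * F x + G x).
Proof.
move=> HF HG; have mF := LPhi0_meas HF; have mG := LPhi0_meas HG.
have [mF' FO Fk Foo] := HF; have [mG' GO Gk Goo] := HG; split.
- by apply: lmeasurableD => //; exact: lmeasurableZ.
- by move=> x nO; rewrite FO// GO// mulr0 addr0.
- by move=> x xk; rewrite Fk// Gk// mulr0 addr0.
- by apply: modulD_fin => //; [exact: lmeasurableZ|exact: modulZ_fin].
Qed.

(** Norm convergence, uniform over all kernels with constant [K]. The three lemmas on this class
    below are made to be fed to [lipschitz_class_ind]. *)
Definition mollifiable (K kk : R) F := LPhi0 Omega Phi kk F /\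
  forall l, 0 < l -> exists2 r1, 0 < r1 &
    forall r k, 0 < r -> r < r1 -> kernel K r k ->
      Nle Omega Phi (fun x => kconv k F x - F x) l.

Variables (K kk : R).
Hypotheses (K0 : 0 < K) (kk0 : 0 <= kk).

Let kconv_meas F r k : LPhi0 Omega Phi kk F -> 0 < r -> kernel K r k ->
  lmeasurable Omega (kconv k F).
Proof.
move=> HF r0 kker.
have iF := LPhi0_integrable n0 oOmega PhiMO PhiA1 kk0 HF.
by apply: lmeasurableS (kernel_kconv_meas n0 r0 kker iF).
Qed.

Lemma mollifiable_lin a F G : mollifiable K kk F -> mollifiable K kk G ->
  mollifiable K kk (fun x => a * F x + G x).
Proof.
move=> [HF cF] [HG cG]; split; first exact: LPhi0_lin.
move=> l l0; have a1 : 0 < 2 * (`|a| + 1) by rewrite mulr_gt0// ltr_wpDl.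
have l10 : 0 < l / (2 * (`|a| + 1)) by rewrite divr_gt0.
have l20 : 0 < l / 2 by rewrite divr_gt0.
have [r1 r10 F1] := cF _ l10; have [r2 r20 G1] := cG _ l20.
exists (Num.min r1 r2); first by rewrite lt_min r10.
move=> r k r0; rewrite lt_min => /andP[rr1 rr2] kker.
have mkF := kconv_meas HF r0 kker; have mkG := kconv_meas HG r0 kker.
have iF := LPhi0_integrable n0 oOmega PhiMO PhiA1 kk0 HF.
have iG := LPhi0_integrable n0 oOmega PhiMO PhiA1 kk0 HG.
have bk := kernel_bounded n0 r0 kker.
have mF := LPhi0_meas HF; have mG := LPhi0_meas HG.
rewrite (_ : (fun x => _) = (fun x => a * (kconv k F x - F x) + (kconv k G x - G x))).
  rewrite [l](_ : _ = l / 2 + l / 2); last by lra.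
  apply: Nle_triangle => //.
  - by apply: lmeasurableZ; exact: lmeasurableB.
  - exact: lmeasurableB.
  - apply: NleZ_le (F1 r k r0 rr1 kker) => //; first exact: lmeasurableB.
    by rewrite mulrA ler_pdivrMr//; lra.
  - exact: (G1 r k r0 rr2 kker).
by apply/funext => x; rewrite kconvDZ//; lra.
Qed.

(** The error for [f] is the mollified difference [f - f_ m], plus the error for [f_ m], minus the
    difference itself. Dominated convergence makes the difference small for one fixed [m], and
    [kconv_bounded] transfers this to its mollification uniformly in the kernel. *)
Lemma mollifiable_lim (f_ : nat -> Rn -> R) f H :
  (forall m, mollifiable K kk (f_ m)) -> LPhi0 Omega Phi kk H ->
  (forall m x, `|f_ m x| <= H x) -> (forall x, f_ ^~ x @ \oo --> f x) ->
  mollifiable K kk f.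
Proof.
move=> cf HH fH ff.
have fle x : `|f x| <= H x.
  rewrite leNgt; apply/negP => lt.
  have [N _ /(_ N (leqnn N))] := cvgr_gt _ (cvg_norm (ff x)) _ lt.
  by rewrite /= ltNge fH.
have mH := LPhi0_meas HH; have [mH' HO Hk Hoo] := HH.
have mf : lmeasurable setT f.
  apply: (measurable_fun_cvg (h := f_ : nat -> RdL R n -> R)) => [m|x _]; last exact: ff.
  by have [[]] := cf m.
have mfO : lmeasurable Omega f by exact: lmeasurableS mf.
have Hf : LPhi0 Omega Phi kk f.
  split => //.
  - by move=> x /HO Hx; apply/eqP; rewrite -normr_le0 -Hx.
  - by move=> x /Hk Hx; apply/eqP; rewrite -normr_le0 -Hx.
  - apply: le_lt_trans Hoo; apply: le_modul => //.
    by apply: ae_all => x Ox; rewrite (le_trans (fle x))// ler_norm.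
split=> // l l0.
have [r0 [C [sigma [r00 C0 /andP[s0 s1] bnd]]]] := kconv_bounded n0 oOmega PhiMO PhiA1 K0 kk0.
(* [C * l'] for the mollified difference and [l'] for each of the two other terms. *)
pose l' := l / (C + 2).
have C2 : 0 < C + 2 by lra.
have l'0 : 0 < l' by rewrite divr_gt0.
have mfm m : lmeasurable Omega (f_ m) by exact: LPhi0_meas (proj1 (cf m)).
have [m Hm] : exists m, (modul Omega Phi (fun x => (f x - f_ m x) / l')%R <= sigma%:E)%E.
  have := @modul_cvg0 (fun m x => (f x - f_ m x) / l') (fun x => 2 / l' * H x).
  move=> /(_ _ _ _ _ _ sigma s0)[|||||N _ /(_ N (leqnn N))].
  - by move=> m; apply: lmeasurable_div; exact: lmeasurableB.
  - exact: lmeasurableZ.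
  - exact: modulZ_fin.
  - move=> m x Ox; rewrite !normrM normfV mulrAC ler_wpM2r ?invr_ge0//.
    rewrite (le_trans (ler_normB _ _))// gtr0_norm// mulr_natl mulr2n lerD//.
      by rewrite (le_trans (fle x))// ler_norm.
    by rewrite (le_trans (fH m x))// ler_norm.
  - move=> x Ox; rewrite -(mul0r l'^-1); apply: cvgM; last exact: cvg_cst.
    by rewrite -(subrr (f x)); apply: cvgB; [exact: cvg_cst|exact: ff].
  - by exists N.
have [HFm cFm] := cf m.
have [r1 r10 F1] := cFm _ l'0.
exists (Num.min r0 r1); first by rewrite lt_min r00.
move=> r k r_gt0; rewrite lt_min => /andP[rr0 rr1] kker.
have HfB : LPhi0 Omega Phi kk (fun x => f x - f_ m x).
  have := LPhi0_lin (-1) HFm Hf.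
  by congr (LPhi0 _ _ _ _); apply/funext => x; lra.
have i_f := LPhi0_integrable n0 oOmega PhiMO PhiA1 kk0 Hf.
have ifm := LPhi0_integrable n0 oOmega PhiMO PhiA1 kk0 HFm.
have bk := kernel_bounded n0 r_gt0 kker.
have mkf := kconv_meas HfB r_gt0 kker.
have mkfm := kconv_meas HFm r_gt0 kker.
rewrite (_ : (fun x => _) = (fun x => kconv k (fun x => f x - f_ m x) x +
    ((kconv k (f_ m) x - f_ m x) + (-1) * (f x - f_ m x)))); last first.
  by apply/funext => x; rewrite kconvB//; lra.
have lE : l = C * l' + (l' + l') by rewrite /l'; field; rewrite gt_eqF.
rewrite lE.
apply: Nle_triangle => //.
- by apply: lmeasurableD; [exact: lmeasurableB|apply: lmeasurableZ; exact: lmeasurableB].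
- exact: bnd HfB l'0 Hm r_gt0 rr0 kker.
apply: Nle_triangle => //.
- exact: lmeasurableB.
- by apply: lmeasurableZ; exact: lmeasurableB.
- exact: (F1 r k r_gt0 rr1 kker).
apply: (@NleZ_le _ _ l'); [exact: lmeasurableB| |exact: l'0|].
  by rewrite normrN1 mul1r.
by split=> //; apply: le_trans Hm _; rewrite lee_fin.
Qed.

(** The error is at most [L * r] everywhere and vanishes beyond radius [kk + 1]. Constants have
    finite modular there, and convexity pulls the factor [L * r <= 1] out of the modular. *)
Lemma mollifiable_lipschitz g L : (forall x y, `|g x - g y| <= L * `|x - y|) ->
  (forall x, kk < `|x| -> g x = 0) -> (forall x, ~ Omega x -> g x = 0) ->
  mollifiable K kk g.
Proof.
move=> gL_ gk gO.
have {gL_}[{}L L0 gL] : exists2 L, 0 <= L & forall x y, `|g x - g y| <= L * `|x - y|.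
  exists (Num.max 0 L) => [|x y]; first by rewrite le_max lexx.
  by rewrite (le_trans (gL_ x y))// ler_wpM2r// le_max lexx orbT.
have cg : continuous g.
  apply/continuous_rVP => x e e0; exists (e / (L + 1)); first by rewrite divr_gt0// ltr_wpDl.
  move=> y; rewrite ltr_pdivlMr ?ltr_wpDl// => xy; apply: (le_lt_trans (gL x y)).
  have := normr_ge0 (x - y); lra.
have [c c0 cP] : exists2 c, 0 <= c & forall z, `|g z| <= c.
  by apply: (@compact_bounded _ _ _ (kk + 1) cg) => z zk; apply: gk; lra.
have mg : lmeasurable setT g by exact: lmeasurable_continuous.
have mgO : lmeasurable Omega g by exact: lmeasurable_continuous.
have mI k : lmeasurable Omega (\1_(cbox k) : Rn -> R).
  by apply: lmeasurable_indic; exact: measurable_cbox_RdL.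
have Hg : LPhi0 Omega Phi kk g.
  split=> //; apply: le_lt_trans (modul_cbox_fin n0 mOmega PhiMO PhiA1 Phi_Delta2 c kk0).
  apply: le_modul => //; first exact: lmeasurableZ.
  apply: ae_all => x Ox; rewrite indicE; have [xk|/gk ->] := leP `|x| kk; last by rewrite normr0.
  by rewrite mem_set ?cboxP//= mulr1 (le_trans (cP x))// ler_norm.
split=> // l l0.
have k10 : 0 <= kk + 1 by rewrite addr_ge0.
have Ifin := modul_cbox_fin n0 mOmega PhiMO PhiA1 Phi_Delta2 l^-1 k10.
set I := modul _ _ _ in Ifin.
have I0 : (0 <= I)%E by exact: modul_ge0.
have Ifn : I \is a fin_num by rewrite ge0_fin_numE.
have fI0 : 0 <= fine I by rewrite fine_ge0.
(* Ensures [L * r * I <= 1]; the added units avoid division by zero. *)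
pose r1 := Num.min 1 ((L + 1)^-1 * (fine I + 1)^-1).
have L10 : 0 < L + 1 by lra.
have fI10 : 0 < fine I + 1 by lra.
exists r1; first by rewrite lt_min ltr01 mulr_gt0 ?invr_gt0.
move=> r k r_gt0; rewrite lt_min => /andP[rlt1 rL] kker.
have mkg := kconv_meas Hg r_gt0 kker.
have ig := LPhi0_integrable n0 oOmega PhiMO PhiA1 kk0 Hg.
have bk := kernel_bounded n0 r_gt0 kker.
have [ck kpos kr k1 kK] := kker.
have Lr1 : L * r <= (fine I + 1)^-1.
  apply: (@le_trans _ _ ((L + 1) * r)); first by rewrite ler_wpM2r ?lerDl// ltW.
  by move: rL; rewrite mulrC -ltr_pdivrMr ?invr_gt0// invrK mulrC => /ltW.
have Lr01 : 0 <= L * r <= 1.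
  rewrite mulr_ge0 ?(ltW r_gt0)//= (le_trans Lr1)// invf_le1//; lra.
have close x : `|kconv k g x - g x| <= L * r.
  have [ik ik1] := rint_kernel_shift x r_gt0 kker.
  have igx := kconv_integrable x bk ig.
  have -> : kconv k g x - g x = rint setT (fun y => k (y - x) * g y - g x * k (y - x)).
    rewrite rintB//; last exact: lintegrableZ.
    by rewrite rintZ// ik1 mulr1.
  have iB : lintegrable setT (fun y => k (y - x) * g y - g x * k (y - x)).
    by apply: lintegrableB => //; exact: lintegrableZ.
  apply: (le_trans (rint_norm measurableT iB)).
  apply: (@le_trans _ _ (rint setT (fun y => L * r * k (y - x)))); last first.
    by rewrite rintZ// ik1 mulr1.
  apply: rint_le => //; [exact: lintegrable_norm|exact: lintegrableZ|].
  move=> y _; rewrite [g x * _]mulrC -mulrBr normrM (ger0_norm (kpos _)) [leRHS]mulrC.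
  have [yr|yr] := leP r `|y - x|; first by rewrite kr// !mul0r.
  by rewrite ler_wpM2l// (le_trans (gL _ _))// ler_wpM2l// ltW.
split=> //.
apply: (@le_trans _ _ (modul Omega Phi (fun x => L * r * (l^-1 * \1_(cbox (kk + 1)) x))%R)).
  apply: le_modul => //.
  - by apply: lmeasurable_div; exact: lmeasurableB.
  - by do 2 apply: lmeasurableZ.
  apply: ae_all => x Ox; have [xk|xk] := leP `|x| (kk + 1).
    rewrite indicE mem_set ?cboxP//= mulr1 !normrM ler_wpM2r//.
    by rewrite -normrM (le_trans (close x))// ler_norm.
  rewrite (gk x) ?subr0; last by lra.
  rewrite (@kconv_supp _ _ _ _ _ _ kk _ kker)//; last by lra.
  by rewrite mul0r normr0.
apply: (le_trans (modulZ_le oOmega PhiMO Lr01 _)); first exact: lmeasurableZ.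
rewrite -/I -(fineK Ifn) -EFinM lee_fin.
apply: (@le_trans _ _ ((fine I + 1)^-1 * fine I)); first by rewrite ler_wpM2r.
by rewrite mulrC ler_pdivrMr//; lra.
Qed.

End mollifiable.

Section mollification_theorem.
Context {R : realType} {n : nat}.
Local Notation Rn := 'rV[R]_n.
Hypothesis n0 : (0 < n)%N.
Variables (Omega : set Rn) (Phi : Rn -> R -> R).
Hypothesis oOmega : open Omega.
Hypothesis PhiMO : MO_function Omega Phi.
Hypothesis PhiA1 : A1 Omega Phi.
Hypothesis Phi_Delta2 : Delta2 Omega Phi.
Implicit Types F G : Rn -> R.

Let mOmega : measurable (Omega : set (RdL R n)).
Proof. exact: open_RdL. Qed.

Lemma LPhi0_le kk F G : LPhi0 Omega Phi kk G -> lmeasurable setT F ->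
  (forall x, `|F x| <= `|G x|) -> LPhi0 Omega Phi kk F.
Proof.
move=> HG mF FG; have [mG GO Gk Goo] := HG; split => //.
- by move=> x /GO Gx; apply/eqP; rewrite -normr_le0 (le_trans (FG x))// Gx normr0.
- by move=> x /Gk Gx; apply/eqP; rewrite -normr_le0 (le_trans (FG x))// Gx normr0.
- apply: le_lt_trans Goo; apply: le_modul => //.
  + exact: lmeasurableS mF.
  + exact: LPhi0_meas HG.
  + by apply: ae_all => x _; exact: FG.
Qed.

Lemma LPhi0_indic kk c : 0 <= kk ->
  LPhi0 Omega Phi kk (fun x => c * \1_(cbox kk) x * \1_Omega x).
Proof.
move=> kk0.
have mI D : lmeasurable D (\1_(cbox kk) : Rn -> R).
  by apply: lmeasurable_indic; exact: measurable_cbox_RdL.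
have mO D : lmeasurable D (\1_Omega : Rn -> R) by exact: lmeasurable_indic.
split.
- by apply: lmeasurableM => //; exact: lmeasurableZ.
- by move=> x nO; rewrite [\1_Omega x]indicE memNset// mulr0.
- move=> x xk; rewrite [\1_(cbox kk) x]indicE memNset ?mulr0 ?mul0r//.
  by rewrite cboxP//=; apply/negP; rewrite -ltNge.
- apply: le_lt_trans (modul_cbox_fin n0 mOmega PhiMO PhiA1 Phi_Delta2 c kk0).
  apply: le_modul => //; [by apply: lmeasurableM => //; exact: lmeasurableZ|exact: lmeasurableZ|].
  by apply: ae_all => x Ox; rewrite [\1_Omega x]indicE mem_set// mulr1.
Qed.

Lemma lipschitz_continuous (g : Rn -> R) L : (forall x y, `|g x - g y| <= L * `|x - y|) ->
  continuous g.
Proof.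
move=> gL; apply/continuous_rVP => x e e0.
exists (e / (`|L| + 1)); first by rewrite divr_gt0// ltr_wpDl.
move=> y; rewrite ltr_pdivlMr ?ltr_wpDl// => xy; apply: (le_lt_trans (gL x y)).
have := normr_ge0 (x - y); move: xy; set d := `|x - y|; move: d => d xy d0.
have : L * d <= `|L| * d by rewrite ler_wpM2r// ler_norm.
lra.
Qed.

(** Bounded functions are reached by [lipschitz_class_ind], whose enlargement of the cube explains
    the radius [kk + 1]; unbounded ones by truncation. *)
Theorem kconv_cvg (K kk : R) F : 0 < K -> 0 <= kk -> LPhi0 Omega Phi kk F ->
  forall l, 0 < l -> exists2 r1, 0 < r1 & forall r k, 0 < r -> r < r1 ->
    kernel K r k -> Nle Omega Phi (fun x => kconv k F x - F x) l.
Proof.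
move=> K0 kk0 HF; have k10 : 0 <= kk + 1 by rewrite addr_ge0.
suff [_ //] : mollifiable Omega Phi K (kk + 1) F.
have molin := mollifiable_lin n0 oOmega PhiMO PhiA1 Phi_Delta2 (K := K) k10.
have molim := mollifiable_lim n0 oOmega PhiMO PhiA1 Phi_Delta2 K0 k10.
have mO : lmeasurable setT (\1_Omega : Rn -> R) by exact: lmeasurable_indic.
have IO0 (x : Rn) : 0 <= \1_Omega x :> R by rewrite indicE.
have IO1 (x : Rn) : \1_Omega x <= 1 :> R by rewrite indicE lern1 leq_b1.
have IOle (a : R) x : `|a * \1_Omega x| <= `|a|.
  by rewrite normrM [X in _ * X]ger0_norm// ler_piMr.
(* [lipschitz_class_ind] ranges over functions on the whole space, whereas [mollifiable] asks for
   functions that vanish outside [Omega]; the factor [\1_Omega] mediates. *)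
pose E (f : Rn -> R) := mollifiable Omega Phi K (kk + 1) (fun x => f x * \1_Omega x).
have Ebd f c : lmeasurable setT f -> (forall x, `|f x| <= c * \1_(cbox kk) x) -> E f.
  apply: (@lipschitz_class_ind R n kk E kk0).
  - move=> g L gL gk; have cg := lipschitz_continuous gL.
    have [c0 c00 gc] : exists2 c, 0 <= c & forall z, `|g z| <= c.
      by apply: (@compact_bounded _ _ _ (kk + 2) cg) => z zk; apply: gk; lra.
    (* Multiplication by [\1_Omega] destroys the Lipschitz property. The cutoffs [chi m] have
       Lipschitz constant [m] and increase to [\1_Omega], so the limit lemma applies. *)
    pose chi (m : nat) x : R := Num.min 1 (Num.max 0 (m%:R * inner_radius Omega x)).
    have chi01 m x : 0 <= chi m x <= 1.
      by rewrite /chi le_min ler01 le_max lexx/= ge_min lexx.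
    have chiL m x y : `|chi m x - chi m y| <= m%:R * `|x - y|.
      apply: (le_trans (clamp_lipschitz _ _ _ _)).
      by rewrite -mulrBr normrM ger0_norm// ler_wpM2l// inner_radius_lipschitz.
    apply: (molim (fun m x => g x * chi m x) _ _ _ (LPhi0_indic c0 k10)).
    + move=> m; apply: (@mollifiable_lipschitz R n n0 Omega Phi oOmega PhiMO PhiA1 Phi_Delta2 K _ k10 _ (L + c0 * m%:R)).
      * move=> x y.
        rewrite (_ : _ - _ = (g x - g y) * chi m x + g y * (chi m x - chi m y)); last lra.
        have /andP[h0 h1] := chi01 m x.
        rewrite (le_trans (ler_normD _ _))// !normrM mulrDl -mulrA lerD//.
          by rewrite (ger0_norm h0) (le_trans _ (gL x y))// ler_piMr.
        exact: ler_pM.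
      * by move=> x /gk ->; rewrite mul0r.
      * move=> x nO; rewrite /chi inner_radius_out// mulr0 maxxx.
        by rewrite (min_idPr _) ?ler01// mulr0.
    + move=> m x; have /andP[h0 h1] := chi01 m x.
      have [Ox|nOx] := pselect (Omega x); last first.
        rewrite /chi inner_radius_out// mulr0 maxxx (min_idPr _) ?ler01// mulr0 normr0.
        by rewrite !mulr_ge0.
      have [xk|xk] := leP `|x| (kk + 1); last first.
        by rewrite gk// mul0r normr0 !mulr_ge0.
      rewrite !indicE !mem_set ?cboxP//= !mulr1 normrM (ger0_norm h0).
      by rewrite (le_trans _ (gc x))// ler_piMr.
    + move=> x; have [Ox|nOx] := pselect (Omega x); last first.
        apply: cvg_near_cst; apply: nearW => m.
        by rewrite /chi inner_radius_out// mulr0 maxxx (min_idPr _) ?ler01// indicE memNset.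
      apply: cvg_near_cst; near=> m; rewrite indicE mem_set//; congr (_ * _).
      apply/min_idPl; rewrite le_max; apply/orP; right.
      have i0 := inner_radius_gt0 oOmega Ox.
      by rewrite -ler_pdivrMr// div1r; near: m; exact: nbhs_infty_ger.
  - move=> f1 f2 a E1 E2; rewrite /E (_ : (fun x => _) = (fun x => a * (f1 x * \1_Omega x) + f2 x * \1_Omega x)).
      exact: molin.
    by apply/funext => x; rewrite mulrDl mulrA.
  - move=> f_ f1 c1 Ef fc ff.
    apply: (molim (fun m x => f_ m x * \1_Omega x) _ _ Ef (LPhi0_indic c1 k10)).
      by move=> m x; rewrite normrM [X in _ * X]ger0_norm// ler_wpM2r.
    by move=> x; apply: cvgM; [exact: ff|exact: cvg_cst].
  - move=> f1 g Ef mg gc fg; have [Hf cf] := Ef.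
    have Hg : LPhi0 Omega Phi (kk + 1) (fun x => g x * \1_Omega x).
      apply: (LPhi0_le (LPhi0_indic 1 k10)); first exact: lmeasurableM.
      move=> x; rewrite !normrM ler_wpM2r// normr1 mul1r (le_trans (gc x))//.
      rewrite (le_trans _ (ler_norm _))// !indicE ler_nat.
      case: (boolP (x \in cbox kk)) => //; rewrite !inE !cboxP//= => xk.
      by rewrite mem_set//=; lra.
    split=> // l l0; have [r1 r10 h] := cf l l0; exists r1 => // r k r0 rr1 kker.
    have i_f := LPhi0_integrable n0 oOmega PhiMO PhiA1 k10 Hf.
    have ig := LPhi0_integrable n0 oOmega PhiMO PhiA1 k10 Hg.
    have bk := kernel_bounded n0 r0 kker.
    have kE x : kconv k (fun x => f1 x * \1_Omega x) x = kconv k (fun x => g x * \1_Omega x) x.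
      apply: rint_ae_eq => //.
      - exact: lintegrable_meas (kconv_integrable x bk i_f).
      - exact: lintegrable_meas (kconv_integrable x bk ig).
      - by apply: ae_imp fg => y fgy _; rewrite fgy.
    have mkf := kernel_kconv_meas n0 r0 kker i_f.
    have mkg := kernel_kconv_meas n0 r0 kker ig.
    apply: (Nle_le mOmega PhiMO _ _ _ (h r k r0 rr1 kker)).
    + by apply: lmeasurableS (lmeasurableB mkg (lintegrable_meas ig)).
    + by apply: lmeasurableS (lmeasurableB mkf (lintegrable_meas i_f)).
    + by apply: ae_imp fg => x fgx Ox; rewrite kE fgx.
have [mF FO Fk Foo] := HF.
have mFle (m : nat) : measurable ([set x | `|F x| <= m%:R] : set (RdL R n)).
  have mnF := lmeasurable_norm mF.
  have := mnF measurableT `]-oo, (m%:R : R)]%classic (measurable_itv _).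
  by rewrite setTI; congr measurable; apply/seteqP; split=> x /=; rewrite in_itv.
(* Truncation at height [m]: at each point the sequence is eventually [F x], and [|F|] dominates. *)
apply: (molim (fun m x => F x * \1_[set x | `|F x| <= m%:R] x * \1_Omega x) F (fun x => `|F x|)).
- move=> m; apply: (Ebd _ m%:R); first by apply: lmeasurableM => //; exact: lmeasurable_indic.
  move=> x; rewrite !indicE.
  have [xk|xk] := leP `|x| kk; last by rewrite Fk// mul0r normr0 mulr_ge0.
  rewrite [x \in cbox kk]mem_set ?cboxP//= mulr1.
  case: (boolP (x \in [set x | `|F x| <= m%:R])) => [/set_mem /=|_]; first by rewrite mulr1.
  by rewrite mulr0 normr0.
- apply: (@LPhi0_le _ _ F) => //; last by move=> x; rewrite normr_id.
    by split=> // x xk; apply: Fk; lra.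
  exact: lmeasurable_norm.
- move=> m x; rewrite (le_trans (IOle _ _))// normrM ler_piMr// ger0_norm indicE//.
  by rewrite lern1 leq_b1.
- move=> x; have [Ox|nOx] := pselect (Omega x); last first.
    by rewrite FO//; apply: cvg_near_cst; apply: nearW => m; rewrite !mul0r.
  apply: cvg_near_cst; near=> m; rewrite !indicE !mem_set ?mulr1//=.
  by near: m; exact: nbhs_infty_ger.
Unshelve. all: by end_near. Qed.

End mollification_theorem.

(** * Smooth functions and mollifiers *)

Section directional_derivatives.
Context {R : realType} {V : normedModType R}.
Implicit Types (f : V -> R).

Lemma is_derive_epsP f x v l : is_derive x v f l <->
  forall e, 0 < e -> exists2 d, 0 < d & forall h, h != 0 -> `|h| < d ->
    `|l - h^-1 * (f (h *: v + x) - f x)| < e.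
Proof.
split=> [[df dl] e e0|H].
  have : (fun h : R => h^-1 *: ((f \o shift x) (h *: v) - f x)) @ 0^' --> l.
    by rewrite -dl; exact: df.
  move=> /cvgrPdist_lt/(_ _ e0); rewrite /dnbhs /within/=.
  move=> /nbhs_normP[d /= d0 dP]; exists d => // h h0 hd.
  by apply: dP => //=; rewrite sub0r normrN.
have cv : (fun h : R => h^-1 *: ((f \o shift x) (h *: v) - f x)) @ 0^' --> l.
  apply/cvgrPdist_lt => e e0; have [d d0 dP] := H e e0.
  rewrite /dnbhs /within/=; apply/nbhs_normP; exists d => // h /=.
  by rewrite sub0r normrN => hd h0; exact: dP.
split; first by apply/cvg_ex; exists l.
exact/cvg_lim.
Qed.

End directional_derivatives.

Section flat_function.
Context {R : realType}.
Implicit Types p : {poly R}.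

Lemma poly_expRN_bounded p : exists2 C, 0 <= C &
  forall s, 0 <= s -> `|p.[s]| * expR (- s) <= C.
Proof.
have Xn k : exists2 C, 0 <= C & forall s : R, 0 <= s -> s ^+ k * expR (- s) <= C.
  case: k => [|k].
    by exists 1 => // s s0; rewrite expr0 mul1r expR_le1 oppr_le0.
  exists (k.+1)`!%:R => // s s0; rewrite expRN ler_pdivrMr ?expR_gt0//.
  have := expR_ge1Dxn k s0; rewrite -lerBrDl => /le_trans; move=> /(_ (expR s)).
  rewrite lerBlDr lerDl ler01 => /(_ isT).
  by rewrite ler_pdivrMr ?ltr0n ?fact_gt0// mulrC.
(* The extra power [s ^+ k] is the induction hypothesis that survives multiplication of the
   polynomial by the variable. *)
suff H : forall k, exists2 C, 0 <= C &
    forall s, 0 <= s -> s ^+ k * `|p.[s]| * expR (- s) <= C.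
  have [C C0 h] := H 0%N; exists C => // s s0.
  by have := h s s0; rewrite expr0 mul1r.
elim/poly_ind: p => [k|p c IHp k].
  by exists 0 => // s s0; rewrite horner0 normr0 mulr0 mul0r.
have [C1 C10 h1] := IHp k.+1; have [C2 C20 h2] := Xn k.
exists (C1 + `|c| * C2); first by rewrite addr_ge0// mulr_ge0.
move=> s s0; rewrite hornerD hornerM hornerX hornerC.
apply: (@le_trans _ _ (s ^+ k * (`|p.[s]| * s + `|c|) * expR (- s))).
  rewrite ler_wpM2r ?expR_ge0// ler_wpM2l ?exprn_ge0//.
  by rewrite (le_trans (ler_normD _ _))// normrM (ger0_norm s0).
rewrite mulrDr mulrDl lerD//.
  by have := h1 s s0; rewrite exprSr [`|_| * s]mulrC !mulrA.
by rewrite mulrAC mulrC ler_wpM2l//; exact: h2.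
Qed.

(* All derivatives of [exp (- 1 / t)], [t > 0], extended by zero, are of this form. *)
Definition flat p (t : R) : R := if 0 < t then p.[t^-1] * expR (- t^-1) else 0.

(** The preceding bound for ['X^2 * p] at [s = t^-1]. Quadratic decay makes the difference quotient
    at 0 tend to 0. *)
Lemma flat_le_sqr p : exists2 C, 0 <= C & forall t, `|flat p t| <= C * t ^+ 2.
Proof.
have [C C0 h] := poly_expRN_bounded ('X^2 * p).
exists C => // t; rewrite /flat; case: ifPn => [t0|_]; last first.
  by rewrite normr0 mulr_ge0// sqr_ge0.
have ti0 : 0 <= t^-1 by rewrite invr_ge0 ltW.
rewrite normrM [X in _ * X]ger0_norm ?expR_ge0// -ler_pdivrMr ?exprn_gt0//.
have := h _ ti0; rewrite hornerM hornerXn normrM ger0_norm ?exprn_ge0//.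
by rewrite exprVn -mulrA mulrC.
Qed.

(** For [t > 0] the inner derivative [t ^- 2] becomes the factor ['X^2], and the exponential and the
    polynomial contribute [p] and minus its derivative. The family is thus closed under
    differentiation, also at 0. *)
Lemma is_derive_flat p (t : R) : is_derive t (1 : R) (flat p) (flat ('X^2 * (p - p^`())) t).
Proof.
have [t0|t0|t0] := ltgtP 0 t.
- apply: (@near_eq_is_derive R R R (fun t : R => p.[t^-1] * expR (- t^-1) : R)).
    near=> s; rewrite /flat ifT//; near: s; exact: lt_nbhsr.
  rewrite /flat t0 hornerM hornerXn hornerD hornerN.
  have dV : is_derive t (1 : R) (fun s : R => s^-1) (- t ^- 2).
    have tn0 : id t != 0 :> R by rewrite gt_eqF.
    split; first exact: (derivableV tn0 (@derivable_id _ _ _ _)).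
    by rewrite (deriveV tn0 (@derivable_id _ _ _ _)) derive_id /GRing.scale/= mulr1.
  have d1 : is_derive t (1 : R) (fun s => p.[s^-1]) (p^`().[t^-1] * (- t ^- 2)).
    exact: (@is_derive1_comp _ (horner p) _ t).
  have dN : is_derive t (1 : R) (fun s : R => - s^-1) (t ^- 2).
    by rewrite -[t ^- 2]opprK; exact: is_deriveN.
  have d2 : is_derive t (1 : R) (fun s => expR (- s^-1)) (expR (- t^-1) * t ^- 2).
    exact: (@is_derive1_comp _ expR _ t).
  apply: (trigger_derive (is_deriveM d1 d2)).
  by rewrite /GRing.scale/= exprVn; ring.
- apply: (@near_eq_is_derive R R R (cst (0 : R))).
    near=> s; rewrite /flat ifF//; apply/negbTE; rewrite -leNgt ltW//.
    by near: s; exact: lt_nbhsl.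
  by rewrite /flat ltNge (ltW t0)/=; exact: is_derive_cst.
- subst t; have f0 q : flat q 0 = 0 by rewrite /flat ltxx.
  rewrite f0; apply/is_derive_epsP => e e0.
  have [C C0 h] := flat_le_sqr p.
  exists (e / (C + 1)); first by rewrite divr_gt0// ltr_wpDl.
  move=> s s0; rewrite ltr_pdivlMr ?ltr_wpDl// => se.
  rewrite sub0r normrN addr0 /GRing.scale/= mulr1 f0 subr0.
  rewrite normrM normfV ltr_pdivrMl ?normr_gt0//.
  apply: (le_lt_trans (h s)); rewrite -real_normK ?num_real// expr2 mulrCA.
  rewrite ltr_pM2l ?normr_gt0//; have := normr_ge0 s; lra.
Unshelve. all: by end_near. Qed.

Lemma flat_gt0 t : 0 < t -> 0 < flat 1 t.
Proof. by move=> t0; rewrite /flat t0 hornerC mul1r expR_gt0. Qed.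

Lemma flat_le0 p t : t <= 0 -> flat p t = 0.
Proof. by move=> t0; rewrite /flat ltNge t0. Qed.

Lemma flat1_ge0 t : 0 <= flat 1 t.
Proof. by have [t0|t0] := leP t 0; [rewrite flat_le0|rewrite ltW// flat_gt0]. Qed.

Lemma flat1_le1 t : flat 1 t <= 1.
Proof.
rewrite /flat; case: ifPn => // t0; rewrite hornerC mul1r expR_le1 oppr_le0.
by rewrite invr_ge0 ltW.
Qed.

Lemma flat1_le s t : s <= t -> flat 1 s <= flat 1 t.
Proof.
move=> st; have [s0|s0] := leP s 0; first by rewrite flat_le0// flat1_ge0.
have t0 : 0 < t by exact: lt_le_trans st.
by rewrite /flat s0 t0 !hornerC !mul1r ler_expR lerN2 lef_pV2.
Qed.

End flat_function.

Section smooth_functions.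
Context {R : realType} {n : nat}.
Local Notation Rn := 'rV[R]_n.
Local Notation e_ j := (delta_mx 0 j : 'rV[R]_n).
Implicit Types (u v : Rn -> R) (x : Rn) (j : 'I_n).

Lemma is_derive_line (f : Rn -> R) x (w : Rn) (t l : R) :
  is_derive t (1 : R) (fun s => f (s *: w + x)) l <-> is_derive (t *: w + x) w f l.
Proof.
have E h : f ((h *: (1 : R) + t) *: w + x) = f (h *: w + (t *: w + x)).
  have -> : h *: (1 : R) = h by exact: mulr1.
  by rewrite scalerDl addrA.
by split=> /is_derive_epsP H; apply/is_derive_epsP => e e0;
  have [d d0 dP] := H e e0; exists d => // h h0 hd; have := dP h h0 hd; rewrite E.
Qed.

(** A coinduction principle: [rsmooth] speaks of all iterated partials, so a class of continuous,
    derivable functions stable under partials consists of smooth functions. *)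
Lemma rsmooth_class (C : (Rn -> R) -> Prop) :
  (forall u, C u -> continuous u) ->
  (forall u j x, C u -> derivable u x (e_ j)) ->
  (forall u j, C u -> C (rpartial j u)) ->
  forall u, C u -> rsmooth u.
Proof.
move=> Cc Cd Cp u Cu s; have Cf : C (foldr (@rpartial R n) u s) by elim: s => //= j s; exact: Cp.
by split; [exact: Cc|move=> j x; exact: Cd].
Qed.

Lemma rsmooth_continuous u : rsmooth u -> continuous u.
Proof. by move=> /(_ [::])[]. Qed.

Lemma rsmooth_derivable u j x : rsmooth u -> derivable u x (e_ j).
Proof. by move=> /(_ [::])[_]. Qed.

Lemma rsmooth_is_derive u j x : rsmooth u -> is_derive x (e_ j) u (rpartial j u x).
Proof. by move=> su; split; [exact: rsmooth_derivable|]. Qed.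

Lemma rsmooth_rpartial u j : rsmooth u -> rsmooth (rpartial j u).
Proof. by move=> su s; have := su (rcons s j); rewrite foldr_rcons. Qed.

Lemma rpartialE u j (g : Rn -> R) :
  (forall x, is_derive x (e_ j) u (g x)) -> rpartial j u = g.
Proof. by move=> ug; apply/funext => x; have [_] := ug x. Qed.

Lemma is_derive_const (c : R) x (w : Rn) : is_derive x w (fun _ : Rn => c) 0.
Proof.
apply/is_derive_epsP => e e0; exists 1 => // h _ _.
by rewrite subrr mulr0 subrr normr0.
Qed.

Lemma is_derive_add u v x (w : Rn) : derivable u x w -> derivable v x w ->
  is_derive x w (fun y => u y + v y) ('D_w u x + 'D_w v x).
Proof.
move=> du dv; split; first exact: (@derivableD _ _ _ u v x w du dv).
exact: (@deriveD _ _ _ u v x w du dv).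
Qed.

Lemma is_derive_mul u v x (w : Rn) : derivable u x w -> derivable v x w ->
  is_derive x w (fun y => u y * v y) (u x * 'D_w v x + v x * 'D_w u x).
Proof.
move=> du dv; split; first exact: (@derivableM _ _ u v x w du dv).
exact: (@deriveM _ _ u v x w du dv).
Qed.

Lemma rsmooth_cst (c : R) : rsmooth (fun _ : Rn => c).
Proof.
apply: (@rsmooth_class (fun u => exists c, u = fun=> c)); last by exists c.
- move=> _ [a ->]; apply/continuous_rVP => x e e0.
  by exists 1 => // y _; rewrite subrr normr0.
- by move=> _ j x [a ->]; have [] := is_derive_const a x (e_ j).
- move=> _ j [a ->]; exists 0; apply: rpartialE => x; exact: is_derive_const.
Qed.

(** By the Leibniz rule a partial of a product is a sum of products, so the stable class needed for
    [rsmooth_class] is the closure under both operations at once. *)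
Inductive smooth_algebra : (Rn -> R) -> Prop :=
| smooth_algebra_base u : rsmooth u -> smooth_algebra u
| smooth_algebra_add u v : smooth_algebra u -> smooth_algebra v ->
    smooth_algebra (fun x => u x + v x)
| smooth_algebra_mul u v : smooth_algebra u -> smooth_algebra v ->
    smooth_algebra (fun x => u x * v x).

Lemma smooth_algebra_rsmooth u : smooth_algebra u -> rsmooth u.
Proof.
have Cd u0 j x : smooth_algebra u0 -> derivable u0 x (e_ j).
  elim=> {u0} [u0 su|u1 u2 _ d1 _ d2|u1 u2 _ d1 _ d2].
  - exact: rsmooth_derivable.
  - exact: (@derivableD _ _ _ u1 u2 x (e_ j) d1 d2).
  - exact: (@derivableM _ _ u1 u2 x (e_ j) d1 d2).
apply: rsmooth_class => //.
- move=> u0; elim=> {u0} [u0 su|u1 u2 _ c1 _ c2|u1 u2 _ c1 _ c2].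
  + exact: rsmooth_continuous.
  + by move=> x; exact: (cvgD (c1 x) (c2 x)).
  + by move=> x; exact: (cvgM (c1 x) (c2 x)).
- move=> u0 j; elim=> {u0} [u0 su|u1 u2 s1 p1 s2 p2|u1 u2 s1 p1 s2 p2].
  + by apply: smooth_algebra_base; exact: rsmooth_rpartial.
  + rewrite (_ : rpartial j _ = fun x => rpartial j u1 x + rpartial j u2 x).
      exact: smooth_algebra_add.
    apply: rpartialE => x; exact: is_derive_add (Cd u1 j x s1) (Cd u2 j x s2).
  + rewrite (_ : rpartial j _ = fun x => u1 x * rpartial j u2 x + u2 x * rpartial j u1 x).
      by apply: smooth_algebra_add; exact: smooth_algebra_mul.
    apply: rpartialE => x; exact: is_derive_mul (Cd u1 j x s1) (Cd u2 j x s2).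
Qed.

Lemma rsmoothD u v : rsmooth u -> rsmooth v -> rsmooth (fun x => u x + v x).
Proof.
move=> su sv; apply: smooth_algebra_rsmooth.
by apply: smooth_algebra_add; exact: smooth_algebra_base.
Qed.

Lemma rsmoothM u v : rsmooth u -> rsmooth v -> rsmooth (fun x => u x * v x).
Proof.
move=> su sv; apply: smooth_algebra_rsmooth.
by apply: smooth_algebra_mul; exact: smooth_algebra_base.
Qed.

Lemma rsmoothZ c u : rsmooth u -> rsmooth (fun x => c * u x).
Proof. by move=> su; exact: (rsmoothM (rsmooth_cst c) su). Qed.

Lemma rsmooth_prod (I : Type) (s : seq I) (f : I -> Rn -> R) :
  (forall i, rsmooth (f i)) -> rsmooth (fun x => \prod_(i <- s) f i x).
Proof.
move=> sf; elim: s => [|i s IHs].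
  rewrite (_ : (fun x => _) = fun=> 1); first exact: rsmooth_cst.
  by apply/funext => x; rewrite big_nil.
rewrite (_ : (fun x => _) = fun x => f i x * \prod_(i <- s) f i x).
  exact: (rsmoothM (sf i) IHs).
by apply/funext => x; rewrite big_cons.
Qed.

Lemma rpartialD u v j : rsmooth u -> rsmooth v ->
  rpartial j (fun x => u x + v x) = fun x => rpartial j u x + rpartial j v x.
Proof.
move=> su sv; apply: rpartialE => x.
exact (is_derive_add (rsmooth_derivable su) (rsmooth_derivable sv)).
Qed.

Lemma rpartialM u v j : rsmooth u -> rsmooth v ->
  rpartial j (fun x => u x * v x) = fun x => u x * rpartial j v x + v x * rpartial j u x.
Proof.
move=> su sv; apply: rpartialE => x.
exact (is_derive_mul (rsmooth_derivable su) (rsmooth_derivable sv)).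
Qed.

Lemma rpartial_cst c j : rpartial j (fun _ : Rn => c) = fun=> 0.
Proof. by apply: rpartialE => x; exact: is_derive_const. Qed.

Lemma rpartialZ c u j : rsmooth u -> rpartial j (fun x => c * u x) = fun x => c * rpartial j u x.
Proof.
move=> su; rewrite (rpartialM j (rsmooth_cst c) su).
by apply/funext => x; rewrite rpartial_cst mulr0 addr0.
Qed.

Lemma flat_continuous (p : {poly R}) : continuous (flat p).
Proof.
move=> t; apply: differentiable_continuous; apply/derivable1_diffP.
by have [] := is_derive_flat p t.
Qed.

Lemma flatZ (p : {poly R}) c t : flat (c%:P * p) t = c * flat p t.
Proof. by rewrite /flat; case: ifP => _; rewrite ?mulr0// hornerM hornerC mulrA. Qed.

Lemma is_derive_affine (a b t : R) : is_derive t (1 : R) (fun s => a * s + b) a.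
Proof.
apply/is_derive_epsP => e e0; exists 1 => // h h0 _.
rewrite [X in `|X|](_ : _ = 0) ?normr0// /GRing.scale/=; field.
exact: h0.
Qed.

(** The chain-rule factor is a constant and is absorbed into the polynomial by [flatZ], so the
    functions of this form, for all polynomials, are a stable class. *)
Lemma rsmooth_flat (p : {poly R}) (a b : R) j : rsmooth (fun x : Rn => flat p (a * x 0 j + b)).
Proof.
have D (q : {poly R}) i x : is_derive x (e_ i) (fun x : Rn => flat q (a * x 0 j + b))
    (flat ((a * (i == j)%:R)%:P * ('X^2 * (q - q^`()))) (a * x 0 j + b)).
  rewrite flatZ mulrC.
  have H : is_derive (0 : R) (1 : R)
      (fun s : R => flat q (a * (s *: e_ i + x) 0 j + b))
      (flat ('X^2 * (q - q^`())) (a * x 0 j + b) * (a * (i == j)%:R)).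
    have -> : (fun s : R => flat q (a * (s *: e_ i + x) 0 j + b)) =
        flat q \o (fun s : R => a * (i == j)%:R * s + (a * x 0 j + b)).
      apply/funext => s /=; rewrite !mxE eqxx/= [j == i]eq_sym; congr flat; ring.
    apply: is_derive1_comp; last exact: is_derive_affine.
    by rewrite mulr0 add0r; exact: is_derive_flat.
  have := iffLR (is_derive_line (fun x : Rn => flat q (a * x 0 j + b)) x (e_ i) 0 _) H.
  by rewrite scale0r add0r.
apply: (@rsmooth_class (fun u => exists q, u = fun x => flat q (a * x 0 j + b)));
  last by exists p.
- move=> _ [q ->] x.
  apply: (@continuous_comp Rn R R (fun x : Rn => a * x 0 j + b) (flat q)).
    apply: (@lipschitz_continuous _ _ _ `|a|) => y z.
    rewrite opprD addrACA subrr addr0 -mulrBr normrM ler_wpM2l//.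
    by have := coord_le_norm (y - z) j; rewrite !mxE.
  exact: flat_continuous.
- by move=> _ i x [q ->]; have [] := D q i x.
- by move=> _ i [q ->]; eexists; apply: rpartialE => x; exact: D.
Qed.

Lemma rpartial_mvt u j x h : rsmooth u -> exists2 c, `|c| <= `|h| &
  u (h *: e_ j + x) - u x = rpartial j u (c *: e_ j + x) * h.
Proof.
move=> su; pose g (s : R) := u (s *: e_ j + x).
have dg s : is_derive s (1 : R) g (rpartial j u (s *: e_ j + x)).
  by apply/is_derive_line; exact: rsmooth_is_derive.
have cg a b : {within `[a, b], continuous g}.
  apply: continuous_subspaceT => s; apply: differentiable_continuous.
  by apply/derivable1_diffP; have [] := dg s.
have g0 : g 0 = u x by rewrite /g scale0r add0r.
have [h0|h0] := leP 0 h.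
  have [c] := MVT_segment h0 (fun s _ => dg s) (cg 0 h).
  rewrite in_itv/= => /andP[c0 ch]; rewrite g0 subr0 => ->; exists c => //.
  by rewrite !ger0_norm.
have [c] := MVT_segment (ltW h0) (fun s _ => dg s) (cg h 0).
rewrite in_itv/= => /andP[hc c0]; rewrite g0 sub0r mulrN => E; exists c.
  by rewrite (ler0_norm c0) (ltr0_norm h0) lerN2.
by rewrite -[LHS]opprB -/(g h) E opprK.
Qed.

End smooth_functions.

Section smooth_convolution.
Context {R : realType} {n : nat}.
Local Notation Rn := 'rV[R]_n.
Local Notation e_ j := (delta_mx 0 j : 'rV[R]_n).
Implicit Types (k F : Rn -> R).

Definition cut_off k := exists r : R, forall z : Rn, r <= `|z| -> k z = 0.

Lemma cut_offM k F : cut_off F -> cut_off (fun z => k z * F z).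
Proof. by move=> [r Fr]; exists r => z /Fr ->; rewrite mulr0. Qed.

Lemma norm_delta_mx j : `|e_ j| <= (1 : R).
Proof. by apply/norm_rV_leP => // i; rewrite mxE eqxx/= normr_nat lern1 leq_b1. Qed.

Lemma rpartial_near_cst k x j (e : R) : 0 < e ->
  (forall y, `|y - x| < e -> k y = k x) -> rpartial j k x = 0.
Proof.
move=> e0 ke; have : is_derive x (e_ j) k 0; last by case.
apply/is_derive_epsP => a a0; exists e => // h h0 he.
rewrite ke ?subrr ?mulr0 ?subrr ?normr0//.
rewrite addrK normrZ (le_lt_trans _ he)// -[leRHS]mulr1 ler_wpM2l//.
exact: norm_delta_mx.
Qed.

Lemma rpartial_off k j (r : R) : (forall z, r <= `|z| -> k z = 0) ->
  forall z : Rn, r < `|z| -> rpartial j k z = 0.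
Proof.
move=> kr z zr; apply: (@rpartial_near_cst _ _ _ (`|z| - r)).
  by rewrite subr_gt0.
move=> y yz; rewrite !kr//; first exact: ltW.
by have := lerB_dist z y; rewrite distrC; lra.
Qed.

Lemma cut_off_rpartial k j : cut_off k -> cut_off (rpartial j k).
Proof.
by move=> [r kr]; exists (r + 1) => z zr; apply: (rpartial_off j kr); lra.
Qed.

Lemma cut_off_bounded k : continuous k -> cut_off k -> bounded_cts k /\ unif_cts k.
Proof.
move=> ck [r kr]; split; last exact: compact_unif_cts kr.
by split=> //; have [c c0 kc] := compact_bounded ck kr; exists c.
Qed.

Lemma cut_off_indic_le k : continuous k -> cut_off k -> exists c M,
  [/\ 0 <= c, 0 <= M & forall x, `|k x| <= c * \1_(cbox M) x].
Proof.
move=> ck kc; have [[_ [c c0 cP]] _] := cut_off_bounded ck kc.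
have [r rP] := kc; pose M := Num.max 0 r; have M0 : 0 <= M by rewrite le_max lexx.
exists c, M; split=> // x; rewrite indicE; have [xM|xM] := leP `|x| M.
  by rewrite mem_set ?mulr1// cboxP.
by rewrite rP ?normr0 ?mulr_ge0// (le_trans _ (ltW xM))// le_max lexx orbT.
Qed.

(** By the mean value theorem the difference quotient of the kernel is a partial taken within [|h|];
    uniform continuity of that partial bounds the error by a small multiple of the L1 norm of [F].
    The sign comes from [x] entering as [y - x]. *)
Lemma is_derive_kconv k F j x : rsmooth k -> cut_off k -> lintegrable setT F ->
  is_derive x (e_ j) (kconv k F) (kconv (fun z => (-1) * rpartial j k z) F x).
Proof.
move=> sk kc iF.
have sdk := rsmooth_rpartial j sk; have dkc := cut_off_rpartial j kc.
have [bk _] := cut_off_bounded (rsmooth_continuous sk) kc.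
have [bdk udk] := cut_off_bounded (rsmooth_continuous sdk) dkc.
have bNdk : bounded_cts (fun z => (-1) * rpartial j k z).
  split; first by apply: rsmooth_continuous; exact: rsmoothZ.
  by have [_ [c c0 cP]] := bdk; exists c => // z; rewrite mulN1r normrN.
apply/is_derive_epsP => e e0.
pose I := rint setT (fun y => `|F y|); have I0 : 0 <= I by apply: rint_ge0.
have eI0 : 0 < e / (I + 1) by rewrite divr_gt0// ltr_wpDl.
have [d d0 dP] := udk _ eI0; exists d => // h h0 hd.
have i1 := kconv_integrable (h *: e_ j + x) bk iF.
have i2 := kconv_integrable x bk iF.
have i3 := kconv_integrable x bNdk iF.
rewrite /kconv -rintB// -rintZ//; last exact: lintegrableB.
rewrite -rintB//; last by apply: lintegrableZ => //; exact: lintegrableB.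
have iD : lintegrable setT (fun y => -1 * rpartial j k (y - x) * F y -
    h^-1 * (k (y - (h *: e_ j + x)) * F y - k (y - x) * F y)).
  by apply: lintegrableB => //; apply: lintegrableZ => //; exact: lintegrableB.
apply: (le_lt_trans (rint_norm measurableT iD)).
apply: (@le_lt_trans _ _ (rint setT (fun y => (e / (I + 1)) * `|F y|))).
  apply: rint_le => //.
  - exact: lintegrable_norm.
  - by apply: lintegrableZ => //; exact: lintegrable_norm.
  move=> y _; have [c cle cE] := rpartial_mvt j (y - x) (- h) sk.
  have -> : y - (h *: e_ j + x) = - h *: e_ j + (y - x).
    by rewrite opprD scaleNr addrCA.
  rewrite -mulrBl cE [X in `|X|](_ : _ =
    (rpartial j k (c *: e_ j + (y - x)) - rpartial j k (y - x)) * F y); last by field.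
  rewrite normrM ler_wpM2r// ltW// dP// addrK normrZ (le_lt_trans _ hd)//.
  move: cle; rewrite normrN; apply: le_trans; rewrite ler_piMr//.
  exact: norm_delta_mx.
rewrite rintZ//; last exact: lintegrable_norm.
by rewrite -/I mulrAC -mulrA gtr_pMr// ltr_pdivrMr ?ltr_wpDl// mul1r ltrDl.
Qed.

Lemma rsmooth_kconv k F : rsmooth k -> cut_off k -> lintegrable setT F ->
  rsmooth (kconv k F).
Proof.
move=> sk kc iF.
apply: (@rsmooth_class _ _ (fun u => exists k, [/\ rsmooth k, cut_off k & u = kconv k F]));
  last by exists k.
- move=> _ [k1 [s1 c1 ->]].
  by have [b1 u1] := cut_off_bounded (rsmooth_continuous s1) c1; exact: kconv_continuous.
- by move=> _ j x [k1 [s1 c1 ->]]; have [] := is_derive_kconv j x s1 c1 iF.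
- move=> _ j [k1 [s1 c1 ->]]; exists (fun z => (-1) * rpartial j k1 z); split.
  + by apply: rsmoothZ; exact: rsmooth_rpartial.
  + by apply: cut_offM; exact: cut_off_rpartial.
  + by apply: rpartialE => x; exact: is_derive_kconv.
Qed.

Lemma rpartial_kconv k F j : rsmooth k -> cut_off k -> lintegrable setT F ->
  rpartial j (kconv k F) = kconv (fun z => (-1) * rpartial j k z) F.
Proof. by move=> sk kc iF; apply: rpartialE => x; exact: is_derive_kconv. Qed.

End smooth_convolution.

Section mollifiers.
Context {R : realType} {n : nat}.
Local Notation Rn := 'rV[R]_n.

(** The two affine arguments are [1 + (z 0 i - a 0 i) / s] and [1 - (z 0 i - a 0 i) / s], expanded
    to the form required by [rsmooth_flat]; their factor is positive exactly when
    [|z 0 i - a 0 i| < s]. *)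
Definition bump (a : Rn) (s : R) (z : Rn) : R :=
  \prod_(i < n) (flat 1 (s^-1 * z 0 i + (1 - a 0 i / s)) *
                 flat 1 (- s^-1 * z 0 i + (1 + a 0 i / s))).

Variables (a : Rn) (s : R).
Hypothesis s0 : 0 < s.

Lemma rsmooth_bump : rsmooth (bump a s).
Proof.
apply: (@rsmooth_prod R n _ _ (fun i z => flat 1 (s^-1 * z 0 i + (1 - a 0 i / s)) *
                 flat 1 (- s^-1 * z 0 i + (1 + a 0 i / s)))) => i.
by apply: rsmoothM; exact: rsmooth_flat.
Qed.

Lemma bump_ge0 z : 0 <= bump a s z.
Proof. by apply: prodr_ge0 => i _; rewrite mulr_ge0// flat1_ge0. Qed.

Lemma bump_le1 z : bump a s z <= 1.
Proof.
apply: prodr_ile1 => i _; rewrite mulr_ge0 ?flat1_ge0//=.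
by apply: mulr_ile1; rewrite ?flat1_ge0// flat1_le1.
Qed.

Lemma bump_out z : s <= `|z - a| -> bump a s z = 0.
Proof.
move=> zs; have [i si] : exists i, s <= `|(z - a) 0 i|.
  apply: contrapT => /forallNP h.
  have : `|z - a| < s by apply/norm_rV_ltP => // i; rewrite ltNge; apply/negP/h.
  by rewrite ltNge zs.
rewrite /bump (bigD1 i)//= [X in X * _](_ : _ = 0) ?mul0r//.
move: si; rewrite !mxE ler_normr => /orP[h|h].
  rewrite [X in _ * X]flat_le0 ?mulr0//.
  have -> : - s^-1 * z 0 i + (1 + a 0 i / s) = (s - (z 0 i - a 0 i)) / s.
    by field; rewrite gt_eqF.
  by rewrite ler_pdivrMr// mul0r; lra.
rewrite flat_le0 ?mul0r//.
have -> : s^-1 * z 0 i + (1 - a 0 i / s) = (s + (z 0 i - a 0 i)) / s.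
    by field; rewrite gt_eqF.
by rewrite ler_pdivrMr// mul0r; lra.
Qed.

(** A lower bound for each coordinate factor on the cube of half radius, where both arguments of
    [flat] are at least one half. *)
Definition bump_height : R := flat 1 2^-1 ^+ 2.

Lemma bump_height_gt0 : 0 < bump_height.
Proof. by rewrite exprn_gt0// flat_gt0. Qed.

Lemma bump_inner z : box a (s / 2) z -> bump_height ^+ n <= bump a s z.
Proof.
move=> /boxE za; rewrite -[X in _ ^+ X]card_ord -prodr_const; apply: ler_prod => i _.
rewrite ltW ?bump_height_gt0//= /bump_height expr2.
have := za i; rewrite ler_norml => /andP[h1 h2].
apply: ler_pM; rewrite ?flat1_ge0//; apply: flat1_le.
  have -> : s^-1 * z 0 i + (1 - a 0 i / s) = (s + (z 0 i - a 0 i)) / s.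
    by field; rewrite gt_eqF.
  by rewrite ler_pdivlMr//; lra.
have -> : - s^-1 * z 0 i + (1 + a 0 i / s) = (s - (z 0 i - a 0 i)) / s.
    by field; rewrite gt_eqF.
by rewrite ler_pdivlMr//; lra.
Qed.

Lemma lmeasurable_bump : lmeasurable setT (bump a s).
Proof. by apply: lmeasurable_continuous; apply: rsmooth_continuous; exact: rsmooth_bump. Qed.

Lemma lint_bump : (((bump_height * s) ^+ n)%:E <= lint setT (bump a s) < +oo)%E.
Proof.
have s20 : 0 <= s / 2 by rewrite divr_ge0// ltW.
have h0 : 0 <= bump_height ^+ n by rewrite exprn_ge0// ltW// bump_height_gt0.
apply/andP; split.
  apply: (@le_trans _ _ (lint setT (fun x => bump_height ^+ n * \1_(box a (s / 2)) x))).
    rewrite lintZ//; last by apply: lmeasurable_indic; exact: measurable_box_RdL.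
    rewrite lint_indic//; last exact: measurable_box_RdL.
    rewrite setIT leb_boxE// exprMn EFinM (_ : 2 * (s / 2) = s)//.
    by rewrite mulrCA mulfV ?mulr1.
  apply: lint_le => //.
  - by apply: lmeasurableZ; apply: lmeasurable_indic; exact: measurable_box_RdL.
  - exact: lmeasurable_bump.
  - by move=> x _; rewrite mulr_ge0.
  - by move=> x _; exact: bump_ge0.
  apply: ae_all => x _; rewrite indicE; case: (boolP (x \in box a (s / 2))) => [|_].
    by rewrite mulr1 inE; exact: bump_inner.
  by rewrite mulr0 bump_ge0.
apply: (@le_lt_trans _ _ (lint setT (\1_(box a s)))).
  apply: lint_le => //.
  - exact: lmeasurable_bump.
  - by apply: lmeasurable_indic; exact: measurable_box_RdL.
  - by move=> x _; exact: bump_ge0.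
  apply: ae_all => x _; rewrite indicE; case: (boolP (x \in box a s)) => [_|].
    exact: bump_le1.
  rewrite notin_setE => h; rewrite bump_out// leNgt; apply/negP => /(norm_rV_ltP _ s0) xa.
  by apply: h; apply/boxE => i; have := xa i; rewrite !mxE => /ltW.
rewrite lint_indic//; last exact: measurable_box_RdL.
by rewrite setIT leb_boxE ?ltry// ltW.
Qed.

End mollifiers.

Section mollifier_existence.
Context {R : realType} {n : nat}.
Local Notation Rn := 'rV[R]_n.
Hypothesis n0 : (0 < n)%N.

(** A normalized bump at [tau *: nu] of radius [tau * rho]. The volume bound at scale [tau * L] and
    the mass of the bump both scale as [tau ^+ n], so their ratio, which is [K], does not involve
    [tau]. *)
Lemma mollifier_exists (nu : Rn) (rho : R) : 0 < rho -> exists K L,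
  [/\ 0 < K, 0 < L & forall tau, 0 < tau -> exists k,
    [/\ rsmooth k, kernel K (tau * L) k &
        forall z, tau * rho <= `|z - tau *: nu| -> k z = 0]].
Proof.
move=> rho0; pose L := `|nu| + rho; have L0 : 0 < L by rewrite ltr_wpDl.
have h0 := @bump_height_gt0 R.
have nR0 : 0 < n%:R :> R by rewrite ltr0n.
(* The ratio of [ball_volume_bound (tau * L)] to the lower bound of [lint_bump] at radius
   [tau * rho], after cancelling [tau]. *)
pose K := (4 * n%:R * L / (bump_height * rho)) ^+ n.
have K0 : 0 < K.
  apply: exprn_gt0; apply: divr_gt0; last exact: mulr_gt0.
  by apply: mulr_gt0 => //; apply: mulr_gt0.
exists K, L; split => // tau tau0.
pose s := tau * rho; have s0 : 0 < s by rewrite mulr_gt0.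
pose a := tau *: nu.
have /andP[I1 I2] := lint_bump a s0.
have b0 := bump_ge0 a s.
have ib : lintegrable setT (bump a s).
  apply/lintegrableP; split; first exact: lmeasurable_bump.
  by move: I2; congr (_ < _)%E; apply: eq_lint => x _; rewrite ger0_norm.
have IE : lint setT (bump a s) = (rint setT (bump a s))%:E by rewrite rint_lint.
set I := rint setT (bump a s) in IE.
move: I1; rewrite IE lee_fin => I1.
have I0 : 0 < I by apply: lt_le_trans I1; rewrite exprn_gt0// mulr_gt0.
exists (fun z => I^-1 * bump a s z); split.
- by apply: rsmoothZ; exact: rsmooth_bump.
- split.
  + by apply: rsmooth_continuous; apply: rsmoothZ; exact: rsmooth_bump.
  + by move=> z; rewrite mulr_ge0// invr_ge0 ltW.
  + move=> z zL; rewrite bump_out ?mulr0//.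
    have := lerB_dist z a; rewrite /a normrZ gtr0_norm//.
    by move: zL; rewrite /L /s mulrDr; lra.
  + rewrite lintZ//; last 2 first.
    * exact: lmeasurable_bump.
    * by rewrite invr_ge0 ltW.
    by rewrite IE -EFinM mulVf// gt_eqF.
  + move=> z; rewrite -mulrA ler_pdivrMl//.
    have V0 : 0 < @ball_volume_bound R n (tau * L).
      by apply: ball_volume_bound_gt0 => //; rewrite mulr_gt0.
    apply: (@le_trans _ _ (@ball_volume_bound R n (tau * L))).
      by rewrite ger_pMl// bump_le1.
    apply: (@le_trans _ _ ((bump_height * s) ^+ n * K)); last by rewrite ler_wpM2r// ltW.
    rewrite /K -exprMn /ball_volume_bound le_eqVlt; apply/orP; left; apply/eqP.
    by congr (_ ^+ _); rewrite /s; field; rewrite !gt_eqF.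
- by move=> z zs; rewrite bump_out ?mulr0.
Qed.

End mollifier_existence.

(** * Sobolev pairs and their approximation *)

Section translations.
Context {R : realType} {n : nat}.
Local Notation Rn := 'rV[R]_n.
Local Notation e_ j := (delta_mx 0 j : 'rV[R]_n).
Implicit Types (k w : Rn -> R).

Lemma is_derive_shift k x y j : rsmooth k ->
  is_derive y (e_ j) (fun y => k (y - x)) (rpartial j k (y - x)).
Proof.
move=> sk; apply/is_derive_epsP => e e0.
have [d d0 dP] := iffLR (is_derive_epsP _ _ _ _) (rsmooth_is_derive j (y - x) sk) e e0.
by exists d => // h h0 hd; have := dP h h0 hd; rewrite addrA.
Qed.

Lemma rpartial_shift k x j : rsmooth k ->
  rpartial j (fun y => k (y - x)) = fun y => rpartial j k (y - x).
Proof. by move=> sk; apply: rpartialE => y; exact: is_derive_shift. Qed.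

Lemma rsmooth_shift k x : rsmooth k -> rsmooth (fun y => k (y - x)).
Proof.
move=> sk; apply: (@rsmooth_class _ _ (fun u => exists2 k, rsmooth k & u = fun y => k (y - x)));
  last by exists k.
- by move=> _ [k1 s1 ->]; apply: continuous_shift; exact: rsmooth_continuous.
- by move=> _ j y [k1 s1 ->]; have [] := is_derive_shift x y j s1.
- move=> _ j [k1 s1 ->]; exists (rpartial j k1); first exact: rsmooth_rpartial.
  exact: rpartial_shift.
Qed.

Lemma lintegrable_indic_cbox (M : R) : 0 <= M -> lintegrable setT (\1_(cbox M) : Rn -> R).
Proof.
move=> M0; have mM : measurable (cbox M : set (RdL R n)) by exact: measurable_cbox_RdL.
apply/lintegrableP; split; first exact: lmeasurable_indic.
rewrite (_ : lint _ _ = lint setT (\1_(cbox M) : Rn -> R)); last first.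
  by apply: eq_lint => y _; rewrite ger0_norm.
by rewrite lint_indic// setIT leb_cbox// ltry.
Qed.

Lemma cut_off_integrable w : continuous w -> cut_off w -> lintegrable setT w.
Proof.
move=> cw wc; have [c [M [c0 M0 cP]]] := cut_off_indic_le cw wc.
have iM := lintegrableZ c measurableT (lintegrable_indic_cbox M0).
apply: lintegrable_le iM => //; first exact: lmeasurable_continuous.
by move=> x _; apply: (le_trans (cP x)); rewrite ler_norm.
Qed.

(** The measure-theoretic statement covers nonnegative integrands; [w] is the difference of the
    nonnegative continuous functions [|w| + w] and [|w|]. *)
Lemma rint_shift w x : continuous w -> cut_off w ->
  rint setT (fun y => w (y - x)) = rint setT w.
Proof.
move=> cw wc; have iw := cut_off_integrable cw wc.
have pos k : continuous k -> (forall z, 0 <= k z) -> lintegrable setT k ->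
    lintegrable setT (fun y => k (y - x)) /\ rint setT (fun y => k (y - x)) = rint setT k.
  move=> ck k0 ik; have mk : lmeasurable setT (fun y => k (y - x)).
    by apply: lmeasurable_continuous; exact: continuous_shift.
  have iks : lintegrable setT (fun y => k (y - x)).
    apply/lintegrableP; split=> //.
    have -> : lint setT (fun y => `|k (y - x)|) = lint setT (fun y => k (y - x)).
      by apply: eq_lint => y _; rewrite ger0_norm.
    by rewrite lint_kernel_shift// -rint_lint// ltry.
  by split=> //; apply: EFin_inj; rewrite !rint_lint// lint_kernel_shift.
pose a z := `|w z|; pose b z := `|w z| + w z.
have ca : continuous a by exact: continuous_normr.
have cb : continuous b.
  apply/continuous_rVP => x0 e e0; have [d d0 dP] := iffLR (continuous_rVP w) cw x0 (e / 2) (divr_gt0 e0 (ltr0n _ 2)).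
  exists d => // y /dP h; rewrite /b; have := ler_dist_dist (w x0) (w y).
  have -> : `|w x0| + w x0 - (`|w y| + w y) = (`|w x0| - `|w y|) + (w x0 - w y) by ring.
  by have := ler_normD (`|w x0| - `|w y|) (w x0 - w y); move: h; lra.
have ia : lintegrable setT a by exact: lintegrable_norm.
have ib : lintegrable setT b by exact: lintegrableD.
have [ias aE] := pos a ca (fun z => normr_ge0 _) ia.
have b0 z : 0 <= b z by rewrite /b -lerBlDr sub0r -normrN ler_norm.
have [ibs bE] := pos b cb b0 ib.
have wE z : w z = b z - a z by rewrite /b /a addrC addKr.
transitivity (rint setT (fun y => b (y - x) - a (y - x))).
  by apply: eq_rint => y _; rewrite wE.
by rewrite rintB// aE bE -rintB//; apply: eq_rint => y _; rewrite -wE.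
Qed.

(** The correlation of [w] with the indicator of a large cube is constant near 0, by translation
    invariance. Its partial at 0 is therefore 0, but it is also minus the integral of the partial of
    [w]. *)
Lemma rint_rpartial0 w j : rsmooth w -> cut_off w -> rint setT (rpartial j w) = 0.
Proof.
move=> sw wc; have cw := rsmooth_continuous sw; have [r wr] := wc.
(* One unit of margin for the shift by [x], and another so that the partial of [w] vanishes there
   too. *)
pose M := Num.max 0 r + 2; have M0 : 0 <= M by rewrite addr_ge0// le_max lexx.
pose F := \1_(cbox M) : Rn -> R; have iF := lintegrable_indic_cbox M0.
have conv (v : Rn -> R) x : `|x| <= 1 -> (forall z, M - 1 <= `|z| -> v z = 0) ->
    kconv v F x = rint setT (fun y => v (y - x)).
  move=> x1 vM; apply: eq_rint => y _; rewrite /F indicE.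
  have [yM|yM] := leP `|y| M; first by rewrite mem_set ?cboxP// mulr1.
  by rewrite vM ?mul0r//; have := lerB_dist y x; lra.
have rM : r <= M - 2 by rewrite /M addrK le_max lexx orbT.
have dw := is_derive_kconv j 0 sw wc iF.
have : is_derive (0 : Rn) (e_ j) (kconv w F) 0.
  apply/is_derive_epsP => e e0; exists 1 => // h h0 h1.
  have he : `|h *: e_ j + 0| <= 1.
    rewrite addr0 normrZ -[leRHS]mulr1; apply: ler_pM => //; first exact: ltW.
    exact: norm_delta_mx.
  rewrite !conv ?normr0 ?ler01//; last by move=> z zM; apply: wr; lra.
    by rewrite !rint_shift// subrr mulr0 subrr normr0.
  by move=> z zM; apply: wr; lra.
move=> [_ d0]; have [_] := dw; rewrite d0 conv ?normr0 ?ler01//; last first.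
  move=> z zM; rewrite (_ : rpartial j w z = 0) ?mulr0//.
  by apply: (rpartial_off j wr); lra.
have sdw := rsmooth_rpartial j sw.
have idw := cut_off_integrable (rsmooth_continuous sdw) (cut_off_rpartial j wc).
rewrite (@rint_shift (fun z => -1 * rpartial j w z)); last 2 first.
- by apply: rsmooth_continuous; exact: rsmoothZ.
- by apply: cut_offM; exact: cut_off_rpartial.
by rewrite rintZ// mulN1r => /eqP; rewrite eq_sym oppr_eq0 => /eqP.
Qed.

End translations.

Section sobolev_pairs.
Context {R : realType} {n : nat}.
Local Notation Rn := 'rV[R]_n.
Hypothesis n0 : (0 < n)%N.
Variables (Omega : set Rn) (Phi : Rn -> R -> R).
Hypothesis oOmega : open Omega.
Hypothesis PhiMO : MO_function Omega Phi.
Hypothesis PhiA1 : A1 Omega Phi.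
Hypothesis Phi_Delta2 : Delta2 Omega Phi.
Implicit Types (u v : Rn -> R) (g : 'I_n -> Rn -> R).

Let mOmega : measurable (Omega : set (RdL R n)).
Proof. exact: open_RdL. Qed.

(** Real test functions. Vanishing outside some compact subset of [Omega] spares the computation of
    closed supports. *)
Definition rtest phi := rsmooth phi /\
  exists K : set Rn, [/\ compact K, K `<=` Omega & forall x, ~ K x -> phi x = 0].

Lemma compact_norm_bounded (K : set Rn) : compact K -> exists M : R, forall x, K x -> `|x| <= M.
Proof.
move=> /normed_module.compact_bounded [M [_ /(_ (M + 1))]].
by rewrite ltrDl ltr01 => /(_ isT) h; exists (M + 1) => x Kx; exact: h.
Qed.

Lemma rtest_cut_off phi : rtest phi -> cut_off phi.
Proof.
move=> [_ [K [cK _ K0]]]; have [M MP] := compact_norm_bounded cK.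
exists (M + 1) => z zM; apply: K0 => /MP; lra.
Qed.

Lemma rtestM phi u : rtest phi -> rsmooth u -> rtest (fun x => u x * phi x).
Proof.
move=> [sp [K [cK KO K0]]] su; split; first exact: rsmoothM.
by exists K; split => // x /K0 ->; rewrite mulr0.
Qed.

Definition LPhiT u := [/\ lmeasurable setT u, forall x, ~ Omega x -> u x = 0 &
  (modul Omega Phi u < +oo)%E].

Lemma LPhiT_LPhi0 u kk : LPhiT u -> (forall x, kk < `|x| -> u x = 0) -> LPhi0 Omega Phi kk u.
Proof. by move=> [mu_ uO uoo] uk; split. Qed.

Lemma LPhiT_bounded_mul u z c : LPhiT u -> lmeasurable setT z -> (forall x, `|z x| <= c) ->
  LPhiT (fun x => z x * u x).
Proof.
move=> [mu_ uO uoo] mz zc; split.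
- exact: lmeasurableM.
- by move=> x /uO ->; rewrite mulr0.
- have mO : lmeasurable Omega u by exact: lmeasurableS mu_.
  apply: le_lt_trans (modulZ_fin mOmega PhiMO Phi_Delta2 c mO uoo).
  apply: le_modul => //.
  + by apply: lmeasurableM => //; exact: lmeasurableS mz.
  + exact: lmeasurableZ.
  apply: ae_all => x _; rewrite !normrM ler_wpM2r//.
  by rewrite (le_trans (zc x))// ler_norm.
Qed.

Lemma LPhiT_add u v : LPhiT u -> LPhiT v -> LPhiT (fun x => u x + v x).
Proof.
move=> [mu_ uO uoo] [mv vO voo]; split.
- exact: lmeasurableD.
- by move=> x nO; rewrite uO// vO// addr0.
- by apply: modulD_fin => //; [exact: lmeasurableS mu_|exact: lmeasurableS mv].
Qed.

Lemma LPhiT_integrable u phi : LPhiT u -> continuous phi -> cut_off phi ->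
  lintegrable setT (fun x => u x * phi x).
Proof.
move=> Hu cp pc; have [r pr] := pc.
pose M := Num.max 0 r; have M0 : 0 <= M by rewrite le_max lexx.
have [[_ [c c0 cP]] _] := cut_off_bounded cp pc.
pose v x := \1_(cbox M) x * u x.
have Hv : LPhi0 Omega Phi M v.
  apply: LPhiT_LPhi0.
    apply: (@LPhiT_bounded_mul _ _ 1) => //.
      by apply: lmeasurable_indic; exact: measurable_cbox_RdL.
    by move=> x; rewrite ger0_norm indicE// lern1 leq_b1.
  move=> x xM; rewrite /v indicE memNset ?mul0r//.
  by rewrite cboxP//=; apply/negP; rewrite -ltNge.
have iv := LPhi0_integrable n0 oOmega PhiMO PhiA1 M0 Hv.
have mp : lmeasurable setT phi by exact: lmeasurable_continuous.
have -> : (fun x => u x * phi x) = (fun x => phi x * v x).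
  apply/funext => x; rewrite /v indicE; have [xM|xM] := leP `|x| M.
    by rewrite mem_set ?cboxP// mul1r mulrC.
  by rewrite pr ?mulr0 ?mul0r// (le_trans _ (ltW xM))// le_max lexx orbT.
by apply: (lintegrable_bounded_mul _ mp _ iv (c := c)).
Qed.

(** A real Sobolev function together with an explicit weak gradient, both extended by zero; no
    representative has to be chosen while pairs are multiplied, added and approximated. *)
Definition Sob u g := [/\ LPhiT u, forall j, LPhiT (g j) &
  forall j phi, rtest phi ->
    rint setT (fun x => u x * rpartial j phi x) = - rint setT (fun x => g j x * phi x)].

(** The weak Leibniz rule, obtained by testing the pair against [z * phi]. *)
Lemma SobM u g z : Sob u g -> rsmooth z -> cut_off z ->
  Sob (fun x => z x * u x) (fun j x => z x * g j x + rpartial j z x * u x).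
Proof.
move=> [Hu Hg ug] sz zc.
have mz : lmeasurable setT z by apply: lmeasurable_continuous; exact: rsmooth_continuous.
have [[_ [c _ cP]] _] := cut_off_bounded (rsmooth_continuous sz) zc.
have bd j : exists c', forall x, `|rpartial j z x| <= c'.
  have [[_ [c' _ cP']] _] := cut_off_bounded
    (rsmooth_continuous (rsmooth_rpartial j sz)) (cut_off_rpartial j zc).
  by exists c'.
have mdz j : lmeasurable setT (rpartial j z).
  by apply: lmeasurable_continuous; apply: rsmooth_continuous; exact: rsmooth_rpartial.
split.
- exact: LPhiT_bounded_mul cP.
- move=> j; have [c' cP'] := bd j.
  apply: LPhiT_add; first exact: LPhiT_bounded_mul cP.
  exact: LPhiT_bounded_mul cP'.
move=> j phi tphi; have [sphi _] := tphi.
have cphi := rtest_cut_off tphi.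
have tz : rtest (fun x => z x * phi x) by exact: rtestM.
have ctsM (v w : Rn -> R) : rsmooth v -> rsmooth w -> continuous (fun x => v x * w x).
  by move=> sv sw; apply: rsmooth_continuous; exact: rsmoothM.
have sdz := rsmooth_rpartial j sz; have sdp := rsmooth_rpartial j sphi.
have i1 : lintegrable setT (fun x => u x * (z x * rpartial j phi x)).
  by apply: LPhiT_integrable => //; [exact: ctsM|apply: cut_offM; exact: cut_off_rpartial].
have i2 : lintegrable setT (fun x => u x * (rpartial j z x * phi x)).
  by apply: LPhiT_integrable => //; [exact: ctsM|exact: cut_offM].
have i3 : lintegrable setT (fun x => g j x * (z x * phi x)).
  by apply: LPhiT_integrable => //; [exact: ctsM|exact: cut_offM].
have := ug j _ tz; rewrite (rpartialM j sz sphi) => E.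
have E1 : rint setT (fun x => u x * (z x * rpartial j phi x)) +
    rint setT (fun x => u x * (rpartial j z x * phi x)) =
    - rint setT (fun x => g j x * (z x * phi x)).
  by rewrite -E -rintD//; apply: eq_rint => x _; ring.
rewrite (_ : rint setT (fun x => z x * u x * rpartial j phi x) =
  rint setT (fun x => u x * (z x * rpartial j phi x))); last by apply: eq_rint => x _; ring.
rewrite (_ : rint setT (fun x => (z x * g j x + rpartial j z x * u x) * phi x) =
  rint setT (fun x => g j x * (z x * phi x)) +
  rint setT (fun x => u x * (rpartial j z x * phi x))); last first.
  by rewrite -rintD//; apply: eq_rint => x _; ring.
by rewrite opprD -E1 addrK.
Qed.

End sobolev_pairs.

(** * Smooth cutoffs and truncation at infinity *)

Section plateau_functions.
Context {R : realType} {n : nat}.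
Local Notation Rn := 'rV[R]_n.
Hypothesis n0 : (0 < n)%N.

Lemma rsmooth_norm_integral_bound (w : Rn -> R) (A : set Rn) x : rsmooth w -> cut_off w ->
  lintegrable setT (\1_A : Rn -> R) ->
  `|kconv w \1_A x| <= rint setT (fun y => `|w y|).
Proof.
move=> sw wc iA; have cw := rsmooth_continuous sw.
have [bw _] := cut_off_bounded cw wc.
have caw := continuous_normr cw.
have awc : cut_off (fun y => `|w y|).
  by have [r wr] := wc; exists r => z /wr ->; rewrite normr0.
have iw := kconv_integrable x bw iA.
apply: (le_trans (rint_norm measurableT iw)).
rewrite -(rint_shift x caw awc); apply: rint_le => //.
- exact: lintegrable_norm.
- apply: (cut_off_integrable (w := fun y => `|w (y - x)|)); first exact: (@continuous_shift _ _ (fun y => `|w y|) x caw).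
  have [r wr] := awc; exists (r + `|x|) => z zr; apply: wr.
  by have := lerB_dist z x; lra.
- move=> y _; rewrite normrM -[leRHS]mulr1 ler_wpM2l// indicE ger0_norm// lern1.
  exact: leq_b1.
Qed.

(** The indicator of the cube of radius [m + tau / 2], mollified at scale [tau / 2]. Its partials
    are bounded by L1 norms of the partials of the kernel, hence uniformly in [m]; dominated
    convergence as [m] grows relies on this. *)
Lemma plateau_exists (tau : R) : 0 < tau -> exists C, forall m, 0 <= m ->
  exists t : Rn -> R, [/\ rsmooth t, forall x, 0 <= t x <= 1,
    forall x, `|x| <= m -> t x = 1, forall x, m + tau <= `|x| -> t x = 0 &
    forall j x, `|rpartial j t x| <= C].
Proof.
move=> tau0; have [K [L [K0 L0 H]]] := mollifier_exists n0 (0 : Rn) (@ltr01 R).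
have s0 : 0 < tau / 2 by rewrite divr_gt0.
have [k [sk kk kz]] := H _ s0.
have {}kz z : tau / 2 <= `|z| -> k z = 0.
  by move=> zt; apply: kz; rewrite mulr1 scaler0 subr0.
have r0 : 0 < tau / 2 * L by rewrite mulr_gt0.
have bk := kernel_bounded n0 r0 kk; have [ck k0 _ k1 _] := kk.
have kc : cut_off k by exists (tau / 2).
pose w j z := (-1) * rpartial j k z.
pose I j := rint setT (fun y => `|w j y|).
have I0 j : 0 <= I j by apply: rint_ge0.
exists (\sum_j I j) => m m0; pose M := m + tau / 2.
have M0 : 0 <= M by rewrite addr_ge0// ltW.
have iM := lintegrable_indic_cbox M0.
have onM y : `|y| <= M -> \1_(cbox M) y = 1 :> R.
  by move=> yM; rewrite indicE mem_set// cboxP.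
have offM y : ~ `|y| <= M -> \1_(cbox M) y = 0 :> R.
  by move=> yM; rewrite indicE memNset// cboxP.
have ind01 (y : Rn) : 0 <= (\1_(cbox M) y : R) <= 1.
  by rewrite indicE ler0n lern1 leq_b1.
exists (kconv k \1_(cbox M)); split.
- exact: rsmooth_kconv.
- move=> x; have [is1 rs1] := rint_kernel_shift x r0 kk.
  apply/andP; split; first by apply: rint_ge0 => y _; rewrite mulr_ge0//; case/andP: (ind01 y).
  rewrite -rs1; apply: rint_le => //; first exact: kconv_integrable.
  by move=> y _; rewrite ler_piMr//; case/andP: (ind01 y).
- move=> x xm; have [_ <-] := rint_kernel_shift x r0 kk.
  apply: eq_rint => y _; have [yM|yM] := leP `|y| M; first by rewrite onM ?mulr1.
  by rewrite kz ?mul0r//; have := lerB_dist y x; move: yM; rewrite /M; lra.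
- move=> x xm; rewrite /kconv -[RHS](@rint0 R n setT); apply: eq_rint => y _.
  have [yM|yM] := leP `|y| M; last by rewrite offM ?mulr0//; apply/negP; rewrite -ltNge.
  by rewrite kz ?mul0r//; have := lerB_dist x y; rewrite distrC; move: yM; rewrite /M; lra.
- move=> j x; rewrite rpartial_kconv// (@le_trans _ _ (I j))//.
    apply: rsmooth_norm_integral_bound; last exact: iM.
      by apply: rsmoothZ; exact: rsmooth_rpartial.
    by apply: cut_offM; exact: cut_off_rpartial.
  by rewrite (bigD1 j)//= lerDl sumr_ge0.
Qed.

Lemma plateau_at (x0 : Rn) (a b : R) : 0 < a -> a < b -> exists t : Rn -> R,
  [/\ rsmooth t, cut_off t, forall x, `|x - x0| <= a -> t x = 1 &
      forall x, b <= `|x - x0| -> t x = 0].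
Proof.
move=> a0 ab; have ba0 : 0 < b - a by rewrite subr_gt0.
have [_ /(_ a (ltW a0)) [t [st _ t1 t0 _]]] := plateau_exists ba0.
exists (fun x => t (x - x0)); split.
- exact: rsmooth_shift.
- exists (b + `|x0|) => z zb; apply: t0; rewrite addrC subrK.
  by have := lerB_dist z x0; lra.
- by move=> x; exact: t1.
- by move=> x xb; apply: t0; rewrite addrC subrK.
Qed.

End plateau_functions.

Section approximable_pairs.
Context {R : realType} {n : nat}.
Local Notation Rn := 'rV[R]_n.
Hypothesis n0 : (0 < n)%N.
Variables (Omega : set Rn) (Phi : Rn -> R -> R).
Hypothesis oOmega : open Omega.
Hypothesis PhiMO : MO_function Omega Phi.
Hypothesis Phi_Delta2 : Delta2 Omega Phi.
Implicit Types (u v : Rn -> R) (g h : 'I_n -> Rn -> R).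

Let mOmega : measurable (Omega : set (RdL R n)).
Proof. exact: open_RdL. Qed.

Definition approximable u g := forall l, 0 < l -> exists phi,
  [/\ rsmooth phi, cut_off phi, Nle Omega Phi (fun x => u x - phi x) l &
      forall j, Nle Omega Phi (fun x => g j x - rpartial j phi x) l].

Definition lmeasurable_pair u g := lmeasurable Omega u /\ forall j, lmeasurable Omega (g j).

Lemma Sob_meas u g : Sob Omega Phi u g -> lmeasurable_pair u g.
Proof.
move=> [[mu_ _ _] mg _]; split; first exact: lmeasurableS mu_.
by move=> j; have [mgj _ _] := mg j; exact: lmeasurableS mgj.
Qed.

Lemma approximable_ext u g v h : u = v -> g = h -> approximable u g -> approximable v h.
Proof. by move=> -> ->. Qed.

Lemma rsmooth_lmeasurable D phi : rsmooth phi -> lmeasurable D (phi : Rn -> R).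
Proof. by move=> s; apply: lmeasurable_continuous; exact: rsmooth_continuous. Qed.

Lemma approximable_add u g v h : lmeasurable_pair u g -> lmeasurable_pair v h ->
  approximable u g -> approximable v h ->
  approximable (fun x => u x + v x) (fun j x => g j x + h j x).
Proof.
move=> [mu_ mg] [mv mh] au av l l0; have l20 : 0 < l / 2 by rewrite divr_gt0.
have [p [sp pc up gp]] := au _ l20; have [q [sq qc vq hq]] := av _ l20.
exists (fun x => p x + q x); split.
- exact: rsmoothD.
- have [r rP] := pc; have [r' rP'] := qc; exists (Num.max r r') => z.
  by rewrite ge_max => /andP[/rP -> /rP' ->]; rewrite addr0.
- rewrite (_ : (fun x => _) = fun x => (u x - p x) + (v x - q x)); last first.
    by apply/funext => x; ring.
  rewrite (splitr l); apply: Nle_triangle => //.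
  + by apply: lmeasurableB => //; exact: rsmooth_lmeasurable.
  + by apply: lmeasurableB => //; exact: rsmooth_lmeasurable.
- move=> j; rewrite (rpartialD j sp sq).
  rewrite (_ : (fun x => _) = fun x => (g j x - rpartial j p x) + (h j x - rpartial j q x)); last first.
    by apply/funext => x; ring.
  rewrite (splitr l); apply: Nle_triangle => //.
  + by apply: lmeasurableB => //; apply: rsmooth_lmeasurable; exact: rsmooth_rpartial.
  + by apply: lmeasurableB => //; apply: rsmooth_lmeasurable; exact: rsmooth_rpartial.
Qed.

Lemma approximable_lim u g : lmeasurable_pair u g ->
  (forall l, 0 < l -> exists v h, [/\ lmeasurable_pair v h, approximable v h,
    Nle Omega Phi (fun x => u x - v x) l & forall j, Nle Omega Phi (fun x => g j x - h j x) l]) ->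
  approximable u g.
Proof.
move=> [mu_ mg] H l l0; have l20 : 0 < l / 2 by rewrite divr_gt0.
have [v [h [[mv mh] av uv gh]]] := H _ l20; have [q [sq qc vq hq]] := av _ l20.
exists q; split => //.
- rewrite (_ : (fun x => _) = fun x => (u x - v x) + (v x - q x)); last first.
    by apply/funext => x; ring.
  rewrite (splitr l); apply: Nle_triangle => //; apply: lmeasurableB => //.
  exact: rsmooth_lmeasurable.
- move=> j; rewrite (_ : (fun x => _) = fun x => (g j x - h j x) + (h j x - rpartial j q x)); last first.
    by apply/funext => x; ring.
  rewrite (splitr l); apply: Nle_triangle => //; apply: lmeasurableB => //.
  by apply: rsmooth_lmeasurable; exact: rsmooth_rpartial.
Qed.

Lemma Nle_eventually (f_ : nat -> Rn -> R) H (l : R) : 0 < l -> LPhiT Omega Phi H ->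
  (forall m, lmeasurable Omega (f_ m)) -> (forall m x, `|f_ m x| <= `|H x|) ->
  (forall x, \forall m \near \oo, f_ m x = 0) ->
  \forall m \near \oo, Nle Omega Phi (f_ m) l.
Proof.
move=> l0 [mH HO Hoo] mf fH f0.
have mHO : lmeasurable Omega H by exact: lmeasurableS mH.
have := @modul_cvg0 R n Omega Phi oOmega PhiMO (fun m x => f_ m x / l) (fun x => H x / l).
move=> /(_ (fun m => lmeasurable_div l (mf m)) (lmeasurable_div l mHO)).
have Hl : (modul Omega Phi (fun x => H x / l)%R < +oo)%E.
  rewrite (_ : (fun x => _) = (fun x => l^-1 * H x)); last by apply/funext => x; rewrite mulrC.
  exact: modulZ_fin.
move=> /(_ Hl).
have b m x : Omega x -> `|f_ m x / l| <= `|H x / l|.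
  by move=> _; rewrite !normrM ler_wpM2r.
move=> /(_ b).
have c x : Omega x -> (fun m => f_ m x / l) @ \oo --> (0 : R).
  move=> _; apply/cvgrPdist_lt => e e0; near=> m.
  rewrite (_ : f_ m x = 0) ?mul0r ?subrr ?normr0//.
  by near: m; exact: f0.
move=> /(_ c 1 ltr01); apply: filterS => m mle; by split.
Unshelve. all: by end_near.
Qed.

Lemma Sob_cutoff u g l : Sob Omega Phi u g -> 0 < l -> exists m t,
  [/\ 0 <= m, rsmooth t, forall x, m <= `|x| -> t x = 0,
    Nle Omega Phi (fun x => u x - t x * u x) l &
    forall j, Nle Omega Phi (fun x => g j x - (t x * g j x + rpartial j t x * u x)) l].
Proof.
move=> Sug l0; have [Hu Hg _] := Sug; have [mu_ mg] := Sob_meas Sug.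
have [C CP] := @plateau_exists R n n0 1 ltr01.
have /choice[t tP] : forall m : nat, exists t : Rn -> R, [/\ rsmooth t, forall x, 0 <= t x <= 1,
    forall x, `|x| <= m%:R -> t x = 1, forall x, m%:R + 1 <= `|x| -> t x = 0 &
    forall j x, `|rpartial j t x| <= C].
  by move=> m; apply: CP.
have big x : \forall m \near \oo, `|x| + 1 <= m%:R :> R by exact: nbhs_infty_ger.
have st m : rsmooth (t m) by have [] := tP m.
have mt m : lmeasurable Omega (t m) by exact: rsmooth_lmeasurable.
have nu_ : \forall m \near \oo, Nle Omega Phi (fun x => u x - t m x * u x) l.
  apply: (Nle_eventually l0 Hu).
  - by move=> m; apply: lmeasurableB => //; exact: lmeasurableM.
  - move=> m x; have [_ /(_ x)/andP[a0 a1] _ _ _] := tP m.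
    rewrite (_ : u x - t m x * u x = (1 - t m x) * u x); last by ring.
    rewrite normrM -[leRHS]mul1r ler_wpM2r// ler_norml; apply/andP; split; lra.
  - move=> x; near=> m; have [_ _ t1 _ _] := tP m.
    rewrite t1 ?mul1r ?subrr//.
    have : `|x| + 1 <= m%:R :> R by near: m; exact: big.
    by lra.
have ng : \forall m \near \oo, forall j, Nle Omega Phi
    (fun x => g j x - (t m x * g j x + rpartial j (t m) x * u x)) l.
  apply: filter_forall => j.
  have aH v : LPhiT Omega Phi v -> LPhiT Omega Phi (fun x => `|v x|).
    move=> [mv vO voo]; split; first exact: lmeasurable_norm.
      by move=> x /vO ->; rewrite normr0.
    rewrite (_ : modul _ _ _ = modul Omega Phi v)//.
    by apply: eq_lint => x _; rewrite normr_id.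
  have C0 : 0 <= `|C| by [].
  (* The dominating function: [C] bounds the partials of all cutoffs at once. *)
  have HH : LPhiT Omega Phi (fun x => `|g j x| + `|C| * `|u x|).
    apply: LPhiT_add => //; first exact: aH.
    apply: (@LPhiT_bounded_mul _ _ _ _ oOmega PhiMO Phi_Delta2 (fun x => `|u x|) (fun=> `|C|) `|C|).
    - exact: aH.
    - exact: lmeasurable_cst.
    - by move=> x; rewrite normr_id.
  have mdt m : lmeasurable Omega (rpartial j (t m)).
    by apply: rsmooth_lmeasurable; exact: rsmooth_rpartial.
  apply: (Nle_eventually l0 HH).
  - move=> m; apply: lmeasurableB; first exact: mg.
    by apply: lmeasurableD; apply: lmeasurableM => //; exact: mg.
  - move=> m x; have [_ /(_ x)/andP[a0 a1] _ _ dt] := tP m.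
    rewrite [leRHS]ger0_norm ?addr_ge0 ?mulr_ge0//.
    rewrite (_ : _ - _ = (1 - t m x) * g j x + (- rpartial j (t m) x) * u x); last by ring.
    apply: (le_trans (ler_normD _ _)); rewrite !normrM normrN; apply: lerD.
      by rewrite -[leRHS]mul1r ler_wpM2r// ler_norml; apply/andP; split; lra.
    by rewrite ler_wpM2r// (le_trans (dt j x))// ler_norm.
  - move=> x; near=> m; have [_ _ t1 _ _] := tP m.
    have xm : `|x| + 1 <= m%:R :> R by near: m; exact: big.
    rewrite t1; last by lra.
    (* Since [|x| + 1 <= m], the cutoff equals 1 on the unit ball around [x]. *)
    rewrite (@rpartial_near_cst _ _ _ _ _ 1)//; first by ring.
    move=> y yx; rewrite !t1//; first by lra.
    by have := lerB_dist y x; lra.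
have [m [h1 h2]] : exists m, Nle Omega Phi (fun x => u x - t m x * u x) l /\
    (forall j, Nle Omega Phi (fun x => g j x - (t m x * g j x + rpartial j (t m) x * u x)) l).
  have : \forall m \near \oo, Nle Omega Phi (fun x => u x - t m x * u x) l /\
    (forall j, Nle Omega Phi (fun x => g j x - (t m x * g j x + rpartial j (t m) x * u x)) l).
    by apply: filterS2 nu_ ng => m.
  by move=> /filter_ex.
exists (m%:R + 1), (t m); split => //; last by have [] := tP m.
Unshelve. all: by end_near.
Qed.

End approximable_pairs.

(** * Localization under the cone condition *)

Section local_approximation.
Context {R : realType} {n : nat}.
Local Notation Rn := 'rV[R]_n.
Hypothesis n0 : (0 < n)%N.
Variables (Omega : set Rn) (Phi : Rn -> R -> R).
Hypothesis oOmega : open Omega.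
Hypothesis PhiMO : MO_function Omega Phi.
Hypothesis PhiA1 : A1 Omega Phi.
Hypothesis Phi_Delta2 : Delta2 Omega Phi.
Implicit Types (u v : Rn -> R) (g h : 'I_n -> Rn -> R).

Let mOmega : measurable (Omega : set (RdL R n)).
Proof. exact: open_RdL. Qed.

(** A local uniform cone condition. The perturbation [w] ranges over a whole ball, so that the
    entire support of a kernel centred at [s *: nu], with radius proportional to [s], is pushed into
    the domain. *)
Definition cone_at (x0 : Rn) (rho : R) (nu : Rn) := forall x s w, Omega x ->
  `|x - x0| < rho -> 0 < s < rho -> `|w| < rho -> Omega (x + s *: (nu + w)).

Lemma compact_shift_cbox (c : Rn) (r : R) : 0 <= r ->
  compact [set y : Rn | `|y - c| <= r].
Proof.
move=> r0; have -> : [set y : Rn | `|y - c| <= r] = (fun y => y + c) @` cbox r.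
  apply/seteqP; split=> y /=.
    by move=> yr; exists (y - c); rewrite ?subrK// cboxP.
  by move=> [z]; rewrite cboxP//= => zr <-; rewrite addrK.
apply: continuous_compact; last exact: cbox_compact.
apply: continuous_subspaceT => y A /nbhs_normP[e /= e0 eA].
suff : nbhs y ((fun z => z + c) @^-1` A) by [].
apply/nbhs_ballP; exists e => // z; rewrite -ball_normE /= => yz; apply: eA => /=.
by rewrite opprD addrACA subrr addr0.
Qed.

Lemma Nle_distC u v l : Nle Omega Phi (fun x => u x - v x) l ->
  Nle Omega Phi (fun x => v x - u x) l.
Proof.
move=> [l0 h]; split=> //; congr (_ <= _)%E: h.
by apply: eq_lint => x _; rewrite !normrM distrC.
Qed.

(* The mollifier is supported near [tau nu], so near [x0] only values of [u] inside
   [Omega] enter the convolution and the shifted kernel is an admissible test function. *)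
Lemma local_approximable x0 rho nu u g : 0 < rho -> cone_at x0 rho nu ->
  Sob Omega Phi u g -> (forall x, rho / 2 <= `|x - x0| -> u x = 0) ->
  (forall j x, rho / 2 <= `|x - x0| -> g j x = 0) ->
  approximable Omega Phi u g.
Proof.
move=> rho0 cone Sug u0 g0 l l0; have [Hu Hg ug] := Sug.
have rho20 : 0 < rho / 2 by rewrite divr_gt0.
have [K [L [K0 L0 moll]]] := mollifier_exists n0 nu rho20.
pose kk := `|x0| + rho; have kk0 : 0 <= kk by rewrite addr_ge0// ltW.
have off v : (forall x, rho / 2 <= `|x - x0| -> v x = 0) -> forall x, kk < `|x| -> v x = 0.
  by move=> v0 x xk; apply: v0; have := lerB_dist x x0; move: xk; rewrite /kk; lra.
have LPu := LPhiT_LPhi0 Hu (off _ u0).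
have LPg j := LPhiT_LPhi0 (Hg j) (off _ (g0 j)).
have iu := LPhi0_integrable n0 oOmega PhiMO PhiA1 kk0 LPu.
have ig j := LPhi0_integrable n0 oOmega PhiMO PhiA1 kk0 (LPg j).
have [ru ru0 ruP] := kconv_cvg n0 oOmega PhiMO PhiA1 Phi_Delta2 K0 kk0 LPu l0.
have /choice[rg rgP] : forall j, exists r : R, 0 < r /\ forall (r' : R) k, 0 < r' -> r' < r ->
    kernel K r' k -> Nle Omega Phi (fun x => kconv k (g j) x - g j x) l.
  move=> j; have [r r0 rP] := kconv_cvg n0 oOmega PhiMO PhiA1 Phi_Delta2 K0 kk0 (LPg j) l0.
  by exists r.
(* One scale below the thresholds of [u] and of every [g j], and below the margin [rho / 2] between
   the support and the ball of radius [rho]. *)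
pose r1 := \big[Num.min/Num.min ru (rho / 2)]_j rg j.
have r1ru : r1 <= Num.min ru (rho / 2) by exact: bigmin_le_id.
have r1rg j : r1 <= rg j by exact: bigmin_le_cond.
have r10 : 0 < r1.
  apply: lt_bigmin; first by rewrite lt_min ru0 rho20.
  by move=> j _; have [] := rgP j.
(* The shift must be shorter than [rho] for the cone condition, and the kernel scale [tau * L]
   smaller than [r1]. *)
pose tau := Num.min (rho / 2) (r1 / (2 * L)).
have L20 : 0 < 2 * L by rewrite mulr_gt0.
have tau0 : 0 < tau by rewrite lt_min rho20 divr_gt0.
have tau_rho : tau < rho.
  by apply: (@le_lt_trans _ _ (rho / 2)); [rewrite /tau ge_min lexx|lra].
have tauL : tau * L < r1.
  apply: (@le_lt_trans _ _ (r1 / (2 * L) * L)).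
    by rewrite ler_wpM2r ?(ltW L0)// /tau ge_min lexx orbT.
  rewrite (_ : _ * L = r1 / 2); first by lra.
  by field; rewrite gt_eqF.
have [k [sk kker ksupp]] := moll tau tau0.
have r0 : 0 < tau * L by rewrite mulr_gt0.
have [ck k0 kr _ _] := kker; have kc : cut_off k by exists (tau * L).
have tauLu : tau * L < ru.
  by apply: lt_le_trans tauL _; apply: le_trans r1ru _; rewrite ge_min lexx.
have tauLrho : tau * L < rho / 2.
  by apply: lt_le_trans tauL _; apply: le_trans r1ru _; rewrite ge_min lexx orbT.
exists (kconv k u); split.
- exact: rsmooth_kconv.
- exists (kk + tau * L) => z; apply: kconv_supp kker _; exact: off.
- by apply: Nle_distC; exact: ruP kker.
have pE j x : Omega x -> rpartial j (kconv k u) x = kconv k (g j) x.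
  move=> Ox; rewrite rpartial_kconv//.
  (* Beyond [rho] both sides vanish, as the kernel reaches less than [rho / 2]. Within [rho] the
     shifted kernel is tested against the pair. *)
  have [xr|xr] := leP rho `|x - x0|.
    have far v w (z : Rn) : (forall x, rho / 2 <= `|x - x0| -> v x = 0) ->
        (forall z, tau * L < `|z| -> w z = 0) -> kconv w v x = 0.
      move=> v0 w0; rewrite /kconv -[RHS](@rint0 R n setT); apply: eq_rint => y _.
      have [yr|yr] := leP (rho / 2) `|y - x0|; first by rewrite v0 ?mulr0.
      rewrite w0 ?mul0r//; have := ler_normD (x - y) (y - x0).
      by rewrite addrA subrK [`|x - y|]distrC; lra.
    rewrite !far//; first exact: (g0 j).
      by move=> z zr; apply: kr; exact: ltW.
    by move=> z zr; rewrite (rpartial_off j kr zr) mulr0.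
  have tk : rtest Omega (fun y => k (y - x)).
    split; first exact: rsmooth_shift.
    exists [set y | `|y - (x + tau *: nu)| <= tau * (rho / 2)]; split.
    - by apply: compact_shift_cbox; rewrite mulr_ge0// ltW.
    - move=> y /= yx; pose w := tau^-1 *: (y - (x + tau *: nu)).
      have -> : y = x + tau *: (nu + w).
        by rewrite scalerDr scalerA divff ?gt_eqF// scale1r addrA addrC subrK.
      apply: cone => //; first by rewrite tau0.
      rewrite normrZ gtr0_norm ?invr_gt0// mulrC ltr_pdivrMr//.
      by apply: le_lt_trans yx _; rewrite mulrC ltr_pM2r//; lra.
    - move=> y /= /negP; rewrite -ltNge => yx; apply: ksupp.
      by rewrite -addrA -opprD ltW.
  have := ug j _ tk; rewrite (rpartial_shift x j sk) => E.
  rewrite /kconv -[RHS]opprK.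
  rewrite (_ : rint setT (fun y => k (y - x) * g j y) = rint setT (fun y => g j y * k (y - x))); last first.
    by apply: eq_rint => y _; rewrite mulrC.
  rewrite -E.
  have bdk : bounded_cts (fun z => (-1) * rpartial j k z).
    have sd : rsmooth (fun z => (-1) * rpartial j k z) by apply: rsmoothZ; exact: rsmooth_rpartial.
    have [] // := cut_off_bounded (rsmooth_continuous sd) _.
    by apply: cut_offM; exact: cut_off_rpartial.
  rewrite -[RHS]mulN1r -rintZ//; first by apply: eq_rint => y _; ring.
  have := lintegrableZ (-1) measurableT (kconv_integrable x bdk iu).
  by rewrite (_ : (fun y => _) = fun y => u y * rpartial j k (y - x))//; apply/funext => y; ring.
move=> j; have [_ rgj] := rgP j.
have Nj := Nle_distC (rgj _ _ r0 (lt_le_trans tauL (r1rg j)) kker).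
have mgj : lmeasurable Omega (g j) by have [_ mg] := Sob_meas Sug; exact: mg.
apply: Nle_le Nj => //.
- apply: lmeasurableB => //; apply: rsmooth_lmeasurable; apply: rsmooth_rpartial.
  exact: rsmooth_kconv.
- apply: lmeasurableB => //.
  by apply: (lmeasurableS measurableT (@subsetT _ _)); exact: kernel_kconv_meas r0 kker _.
- by apply: ae_all => x Ox; rewrite pE.
Qed.

Lemma Sob_sub u g v h : Sob Omega Phi u g -> Sob Omega Phi v h ->
  Sob Omega Phi (fun x => u x - v x) (fun j x => g j x - h j x).
Proof.
move=> [Hu Hg ug] [Hv Hh vh].
have LPhiTN w : LPhiT Omega Phi w -> LPhiT Omega Phi (fun x => -1 * w x).
  move=> Hw; apply: (@LPhiT_bounded_mul _ _ _ _ oOmega PhiMO Phi_Delta2 w (fun=> -1) 1) => //.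
    exact: lmeasurable_cst.
  by move=> x; rewrite normrN1.
have LPhiTB w w' : LPhiT Omega Phi w -> LPhiT Omega Phi w' -> LPhiT Omega Phi (fun x => w x - w' x).
  move=> Hw Hw'; rewrite (_ : (fun x => _) = fun x => w x + -1 * w' x).
    by apply: LPhiT_add => //; exact: LPhiTN.
  by apply/funext => x; rewrite mulN1r.
split; first exact: LPhiTB.
  by move=> j; exact: LPhiTB.
move=> j phi tphi; have [sp _] := tphi; have pc := rtest_cut_off tphi.
have cp := rsmooth_continuous sp.
have cdp := rsmooth_continuous (rsmooth_rpartial j sp).
have dpc := cut_off_rpartial j pc.
have I := LPhiT_integrable n0 oOmega PhiMO PhiA1 Phi_Delta2.
transitivity (rint setT (fun x => u x * rpartial j phi x) - rint setT (fun x => v x * rpartial j phi x)).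
  by rewrite -rintB//; [apply: eq_rint => x _; ring|exact: I..].
rewrite ug// vh// -opprD; congr (- _).
by rewrite -rintB//; [apply: eq_rint => x _; ring|exact: I..].
Qed.

(* Stable under unions because [(a + b - b a) u = a u + b (u - a u)]; this replaces a
   partition of unity. *)
Definition localizable (A : set Rn) := exists t, [/\ rsmooth t, cut_off t,
  forall x, A x -> t x = 1 & forall u g, Sob Omega Phi u g ->
    approximable Omega Phi (fun x => t x * u x) (fun j x => t x * g j x + rpartial j t x * u x)].

Lemma localizable0 : localizable set0.
Proof.
exists (fun=> 0); split => //; first exact: rsmooth_cst.
  by exists 0.
move=> u g _ l l0; exists (fun=> 0); split.
- exact: rsmooth_cst.
- by exists 0.
- rewrite (_ : (fun x => _) = fun=> 0); first exact: Nle0.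
  by apply/funext => x; rewrite mul0r subrr.
- move=> j; rewrite (_ : (fun x => _) = fun=> 0); first exact: Nle0.
  by apply/funext => x; rewrite rpartial_cst !mul0r addr0 subrr.
Qed.

Lemma localizableU A B : localizable A -> localizable B -> localizable (A `|` B).
Proof.
move=> [a [sa ac a1 aP]] [b [sb bc b1 bP]].
have sba : rsmooth (fun x => b x * a x) by exact: rsmoothM.
have sN : rsmooth (fun x => -1 * (b x * a x)) by exact: rsmoothZ.
have sbN : rsmooth (fun x => b x + -1 * (b x * a x)) by exact: rsmoothD.
have st : rsmooth (fun x => a x + (b x + -1 * (b x * a x))) by exact: rsmoothD.
have tdE j : rpartial j (fun x => a x + (b x + -1 * (b x * a x))) =
    fun x => rpartial j a x + (rpartial j b x + -1 * (b x * rpartial j a x + a x * rpartial j b x)).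
  by rewrite (rpartialD j sa sbN) (rpartialD j sb sN) (rpartialZ _ j sba) (rpartialM j sb sa).
exists (fun x => a x + (b x + -1 * (b x * a x))); split.
- exact: st.
- have [r rP] := ac; have [r' rP'] := bc; exists (Num.max r r') => z.
  by rewrite ge_max => /andP[/rP -> /rP' ->]; rewrite mul0r mulr0 !addr0.
- by move=> x [/a1 ->|/b1 ->]; ring.
move=> u g Sug; have Sa := SobM n0 oOmega PhiMO PhiA1 Phi_Delta2 Sug sa ac.
have Sd := Sob_sub Sug Sa.
have Sb := SobM n0 oOmega PhiMO PhiA1 Phi_Delta2 Sd sb bc.
apply: approximable_ext (approximable_add oOmega PhiMO (Sob_meas Sa) (Sob_meas Sb)
  (aP _ _ Sug) (bP _ _ Sd)).
- by apply/funext => x; ring.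
- by apply/funext => j; apply/funext => x; rewrite tdE; ring.
Qed.

Hypothesis cone : forall x0, exists rho nu, 0 < rho /\ cone_at x0 rho nu.

Lemma localizable_ball x0 : exists2 r : R, 0 < r & localizable (ball x0 r).
Proof.
have [rho [nu [rho0 xcone]]] := cone x0.
have a0 : 0 < rho / 4 by rewrite divr_gt0.
(* The cutoff lives within [rho / 3], so it vanishes on the ball of radius [rho / 6] around any
   point at distance at least [rho / 2], and its partials vanish there as well. *)
have ab : rho / 4 < rho / 3 by lra.
exists (rho / 4) => //; have [t [st tc t1 tz]] := plateau_at n0 x0 a0 ab.
exists t; split => //.
  move=> x; rewrite -ball_normE/= => xr; apply: t1; rewrite distrC; exact: ltW.
move=> u g Sug.
have tz' x : rho / 2 <= `|x - x0| -> t x = 0 by move=> xr; apply: tz; lra.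
apply: (local_approximable rho0 xcone (SobM n0 oOmega PhiMO PhiA1 Phi_Delta2 Sug st tc)).
- by move=> x /tz' ->; rewrite mul0r.
- move=> j x xr; rewrite tz'// mul0r add0r.
  rewrite (@rpartial_near_cst _ _ _ _ _ (rho / 6)) ?mul0r//; first by rewrite divr_gt0.
  move=> y yx; rewrite (tz' x)// tz//.
  have := lerB_dist (x - x0) (y - x0).
  by rewrite opprB addrA subrK [`|x - y|]distrC; lra.
Qed.

Theorem Sob_approximable u g : Sob Omega Phi u g -> approximable Omega Phi u g.
Proof.
move=> Sug; apply: approximable_lim => //; first exact: Sob_meas Sug.
move=> l l0; have [m [t [m0 st tm h1 h2]]] := Sob_cutoff n0 oOmega PhiMO Phi_Delta2 Sug l0.
have tc : cut_off t by exists m.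
have St := SobM n0 oOmega PhiMO PhiA1 Phi_Delta2 Sug st tc.
exists (fun x => t x * u x), (fun j x => t x * g j x + rpartial j t x * u x); split => //.
  exact: Sob_meas St.
have m20 : 0 <= m + 2 by rewrite addr_ge0.
(* The margin makes [s] equal to 1 on a unit neighbourhood of the support of [t], so that
   multiplying by [s] changes neither [t * u] nor its gradient. *)
have [s [ss sc s1 sP]] : localizable (cbox (m + 2)).
  apply: cbox_ind m20.
  - exact: localizable0.
  - exact: localizableU.
  - by move=> A B AB [s [ss sc s1 sP]]; exists s; split => // x /AB; exact: s1.
  - exact: localizable_ball.
apply: approximable_ext (sP _ _ St).
- apply/funext => x; have [xm|xm] := leP m `|x|; first by rewrite tm// mul0r mulr0.
  by rewrite s1 ?mul1r// cboxP//=; lra.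
- apply/funext => j; apply/funext => x; have [xm|xm] := ltP m `|x|.
    by rewrite (rpartial_off j tm xm) tm ?ltW// !(mul0r, mulr0, addr0).
  rewrite s1 ?mul1r; last by rewrite cboxP//=; lra.
  rewrite (@rpartial_near_cst _ _ s _ _ 1)//; first by rewrite mul0r addr0.
  move=> y yx; rewrite !s1//; rewrite cboxP//=; first by lra.
  by have := lerB_dist y x; lra.
Qed.

End local_approximation.

(** * The cone property of a domain with boundary of class C1 *)

Section lipschitz_of_C1.
Context {R : realType} {n : nat}.
Local Notation Rn := 'rV[R]_n.
Local Notation e_ j := (delta_mx 0 j : 'rV[R]_n).
Variables (f : Rn -> R) (r B : R).
Hypothesis df : forall y, `|y| < r -> forall j, derivable f y (e_ j).
Hypothesis dB : forall y, `|y| < r -> forall j, `|rpartial j f y| <= B.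

Let r_gt0 (x : Rn) : `|x| < r -> 0 < r.
Proof. exact: le_lt_trans. Qed.

Let step j x h : 0 <= h -> `|x| < r -> `|h *: e_ j + x| < r ->
  `|f (h *: e_ j + x) - f x| <= B * h.
Proof.
move=> h0 xr hr; have r0 := r_gt0 xr.
have inside s : 0 <= s <= h -> `|s *: e_ j + x| < r.
  move=> /andP[s0 sh]; apply/norm_rV_ltP => // i; rewrite !mxE eqxx/=.
  have xi := iffLR (norm_rV_ltP _ r0) xr i.
  have [->|ij] := eqVneq i j; last by rewrite mulr0 add0r.
  have := iffLR (norm_rV_ltP _ r0) hr j; rewrite !mxE eqxx eqxx !mulr1.
  have := iffLR (norm_rV_ltP _ r0) xr j.
  by rewrite !ltr_norml => /andP[? ?] /andP[? ?]; apply/andP; split; lra.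
have dg s : 0 <= s <= h -> is_derive s (1 : R) (fun t => f (t *: e_ j + x)) (rpartial j f (s *: e_ j + x)).
  by move=> /inside /df /(_ j) dfs; apply/is_derive_line; split.
have cg : {within `[0, h], continuous (fun t => f (t *: e_ j + x))}.
  by apply: derivable_within_continuous => s; rewrite in_itv/= => /dg[].
have dg' s : s \in `]0, h[%R ->
    is_derive s (1 : R) (fun t => f (t *: e_ j + x)) (rpartial j f (s *: e_ j + x)).
  by rewrite in_itv/= => /andP[s0 sh]; apply: dg; rewrite !ltW.
have [c] := MVT_segment h0 dg' cg; rewrite in_itv/= => ch.
rewrite scale0r add0r subr0 => ->; rewrite normrM (ger0_norm h0) ler_wpM2r//.
by apply: dB; exact: inside.
Qed.

Let coordinate_step j x h : `|x| < r -> `|h *: e_ j + x| < r ->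
  `|f (h *: e_ j + x) - f x| <= B * `|h|.
Proof.
move=> xr hr; have [h0|h0] := leP 0 h; first by rewrite (ger0_norm h0); exact: step.
have E : - h *: e_ j + (h *: e_ j + x) = x by rewrite addrA -scalerDl addNr scale0r add0r.
rewrite (ltr0_norm h0) distrC -{1}E; apply: step => //; first by rewrite oppr_ge0 ltW.
by rewrite E.
Qed.

(** The coordinates are changed one at a time; the intermediate points stay in the ball because it
    is a cube. Each of the [n] edges is a mean value theorem in one variable. *)
Lemma lipschitz_of_bounded_partials x y : `|x| < r -> `|y| < r ->
  `|f y - f x| <= n%:R * B * `|y - x|.
Proof.
move=> xr yr; have r0 := r_gt0 xr.
pose z k : Rn := \row_i (if (i < k)%N then y 0 i else x 0 i).
have zr k : `|z k| < r.
  apply/norm_rV_ltP => // i; rewrite mxE; case: ifP => _; exact: (iffLR (norm_rV_ltP _ r0)).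
have z0 : z 0%N = x by apply/rowP => i; rewrite mxE.
have zn : z n = y by apply/rowP => i; rewrite mxE ltn_ord.
have zS (k : 'I_n) : z k.+1 = (y 0 k - x 0 k) *: e_ k + z k.
  apply/rowP => i; rewrite !mxE eqxx/= ltnS leq_eqVlt -(inj_eq val_inj).
  have [/val_inj ->|ik] := eqVneq (val i) (val k); first by rewrite ltnn mulr1 subrK.
  by rewrite mulr0 add0r.
rewrite -{1}zn -{1}z0 -(telescope_sumr (fun k => f (z k)) (leq0n n)) big_mkord.
apply: (le_trans (ler_norm_sum _ _ _)).
apply: (@le_trans _ _ (\sum_(k < n) B * `|y - x|)); last first.
  by rewrite sumr_const card_ord -[leLHS]mulr_natl mulrA.
apply: ler_sum => k _; have B0 : 0 <= B by apply: le_trans (dB xr k).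
apply: (@le_trans _ _ (B * `|y 0 k - x 0 k|)).
  by rewrite zS; apply: coordinate_step => //; rewrite -zS.
by rewrite ler_wpM2l//; have := coord_le_norm (y - x) k; rewrite !mxE.
Qed.

End lipschitz_of_C1.

Section cones.
Context {R : realType} {d : nat}.
Local Notation Rd := 'rV[R]_d.+1.
Variable Omega : set Rd.
Hypothesis oOmega : open Omega.

Lemma C1_lipschitz (r : R) (f : 'rV[R]_d -> R) : 0 < r -> C1_on (cube r) f ->
  exists a C, [/\ 0 < a, a <= r, 0 <= C & forall x y, `|x| < a -> `|y| < a ->
    `|f y - f x| <= C * `|y - x|].
Proof.
move=> r0 C1; have c0 : cube r (0 : 'rV[R]_d) by move=> i; rewrite mxE normr0.
have [_ C10] := C1 _ c0.
have /choice[b bP] : forall j : 'I_d, exists b : R, 0 < b /\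
    forall y, `|y| < b -> `|rpartial j f y| <= `|rpartial j f 0| + 1.
  move=> j; have [_ /cvgrPdist_lt/(_ 1 ltr01)] := C10 j.
  move=> /nbhs_ballP[b /= b0 bP]; exists b; split => // y yb.
  have := bP y; rewrite -ball_normE/= sub0r normrN => /(_ yb).
  by have := lerB_dist (rpartial j f y) (rpartial j f 0); rewrite distrC; lra.
pose a := \big[Num.min/r]_j b j; pose B := \sum_j (`|rpartial j f 0| + 1).
have B0 : 0 <= B by apply: sumr_ge0 => j _; rewrite addr_ge0.
have ar : a <= r by exact: bigmin_le_id.
have a0 : 0 < a by apply: lt_bigmin => // j _; have [] := bP j.
have ab j : a <= b j by exact: bigmin_le_cond.
exists a, (d%:R * B); split => //; first by rewrite mulr_ge0.
move=> x y; apply: lipschitz_of_bounded_partials.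
  move=> z za j; have cz : cube r z.
    by move=> i; apply: (le_lt_trans (coord_le_norm z i)); exact: lt_le_trans ar.
  by have [_ /(_ j)[]] := C1 z cz.
move=> z za j; have [_ h] := bP j; apply: (le_trans (h z (lt_le_trans za (ab j)))).
by rewrite /B (bigD1 j)//= lerDl sumr_ge0// => i _; rewrite addr_ge0.
Qed.

Lemma mulmx_norm_le (M : 'M[R]_d.+1) : exists2 C, 0 <= C & forall v : Rd, `|v *m M| <= C * `|v|.
Proof.
exists (\sum_i \sum_j `|M i j|); first by apply: sumr_ge0 => i _; apply: sumr_ge0.
move=> v; apply/norm_rV_leP; first by rewrite mulr_ge0//; apply: sumr_ge0 => i _; apply: sumr_ge0.
move=> j; rewrite mxE; apply: (le_trans (ler_norm_sum _ _ _)); rewrite mulr_suml.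
apply: ler_sum => i _; rewrite normrM mulrC; apply: ler_pM => //; last exact: coord_le_norm.
by rewrite (bigD1 j)//= lerDl sumr_ge0.
Qed.

Lemma hd_coordsD (x y : Rd) : hd_coords (x + y) = hd_coords x + hd_coords y.
Proof. by apply/rowP => i; rewrite !mxE. Qed.

Lemma hd_coords_norm (x : Rd) : `|hd_coords x| <= `|x|.
Proof. by apply/norm_rV_leP => // i; rewrite mxE coord_le_norm. Qed.

(** Small displacements in any direction stay inside, so [nu = 0] serves. *)
Lemma cone_interior x0 : Omega x0 -> exists rho nu, 0 < rho /\ cone_at Omega x0 rho nu.
Proof.
move=> Ox; have /nbhs_ballP[e /= e0 eO] := open_nbhs_nbhs (conj oOmega Ox).
pose rho := Num.min 1 (e / 2).
have rho0 : 0 < rho by rewrite lt_min ltr01 divr_gt0.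
have r1 : rho <= 1 by rewrite ge_min lexx.
have re : rho <= e / 2 by rewrite ge_min lexx orbT.
exists rho, 0; split=> // x s w _ xr /andP[s0 sr] wr; rewrite add0r.
apply: eO; rewrite -ball_normE/= opprD addrA.
apply: (le_lt_trans (ler_normB _ _)); rewrite distrC normrZ gtr0_norm//.
have : s * `|w| <= 1 * `|w| by rewrite ler_wpM2r// ltW// (lt_le_trans sr).
by lra.
Qed.

(** Void: no point of [Omega] is near [x0]. *)
Lemma cone_exterior x0 : ~ closure Omega x0 -> exists rho nu, 0 < rho /\ cone_at Omega x0 rho nu.
Proof.
move=> ncl; suff [e [e0 eO]] : exists e : R, 0 < e /\ forall x, `|x - x0| < e -> ~ Omega x.
  by exists e, 0; split => // x s w Ox /eO.
apply: contrapT => H; apply: ncl => B /nbhs_ballP[e /= e0 eB].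
apply: contrapT => nOB; apply: H; exists e; split=> // x xe Ox.
apply: nOB; exists x; split => //; apply: eB; by rewrite -ball_normE/= distrC.
Qed.

Hypothesis OmegaC1 : C1_boundary Omega.

(* In the chart T the domain is the supergraph of a Lipschitz function, so it
   is preserved by small translations in directions close to the vertical. *)
Lemma cone_boundary x0 : bd Omega x0 -> exists rho nu, 0 < rho /\ cone_at Omega x0 rho nu.
Proof.
move=> /OmegaC1[U [M [c [r [ff [[oU Ux0] [MMT _] r0 C1 [Tx0 TE]]]]]]].
set T := (fun x => _) in Tx0 TE; set E := [set y | _] in TE.
have MTM : M^T *m M = 1%:M by exact: mulmx1C.
have [a [L [a0 ar L0 Lip]]] := C1_lipschitz r0 C1.
have [C C0 CP] := mulmx_norm_le M.
have /nbhs_ballP[e /= e0 eU] := open_nbhs_nbhs (conj oU Ux0).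
(* [nu] is the vertical direction of the chart, pulled back by the inverse rotation. *)
pose ed : Rd := delta_mx 0 ord_max; pose nu := ed *m M^T.
(* [rho * A <= a] keeps [T x] and its translate in the ball where [ff] is Lipschitz. With [D] below,
   [rho * (L + 1) * C <= 1]: the rise [s] outweighs both the vertical error and the change of [ff]
   caused by [w]. *)
pose A := 2 * C + 2.
have A0 : 0 < A by rewrite ltr_wpDl// mulr_ge0.
pose D := (L + 1) * (C + 1).
have D0 : 0 < D by rewrite mulr_gt0 ?ltr_wpDl.
pose rho := Num.min (Num.min 1 e) (Num.min (a / A) (D^-1)).
have rho0 : 0 < rho by rewrite !lt_min ltr01 e0 divr_gt0 ?invr_gt0.
have rho1 : rho <= 1 by rewrite !ge_min lexx.
have rhoe : rho <= e by rewrite !ge_min lexx orbT.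
have rhoA : rho * A <= a by rewrite -ler_pdivlMr// !ge_min lexx !orbT.
have rhoD : rho * D <= 1 by rewrite -ler_pdivlMr// mul1r !ge_min lexx !orbT.
exists rho, nu; split => // x s w Ox xr /andP[s0 sr] wr.
have Ux : U x by apply: eU; rewrite -ball_normE/= distrC (lt_le_trans xr).
have [cx fx] : E (T x) by rewrite -TE; exists x.
have TB x' : T x' = (x' - x0) *m M.
  rewrite mulmxBl; have /eqP := Tx0; rewrite /T addr_eq0 => /eqP E0.
  by rewrite E0 opprK.
set x' := x + s *: (nu + w).
have Tx' : T x' = T x + s *: (ed + w *m M).
  rewrite !TB /x' addrAC mulmxDl; congr (_ + _).
  by rewrite -scalemxAl mulmxDl /nu -mulmxA MTM mulmx1.
have nT : `|T x| <= C * rho by rewrite TB (le_trans (CP _))// ler_wpM2l// ltW.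
have nw : `|w *m M| <= C * rho by rewrite (le_trans (CP _))// ler_wpM2l// ltW.
have ned : `|ed| <= 1 by exact: norm_delta_mx.
have Crho : C * rho <= C by rewrite -[leRHS]mulr1 ler_wpM2l.
have nTx' : `|T x'| < a.
  rewrite Tx'; apply: (le_lt_trans (ler_normD _ _)); rewrite normrZ gtr0_norm//.
  have h1 : s * `|ed + w *m M| < rho * (C + 2).
    apply: (@le_lt_trans _ _ (s * (C + 1))).
      by rewrite ler_wpM2l ?(ltW s0)//; have := ler_normD ed (w *m M); lra.
    by apply: ltr_pM => //; rewrite ?(ltW s0) ?addr_ge0//; lra.
  by move: rhoA; rewrite /A; lra.
have nTx : `|T x| < a.
  apply: (le_lt_trans nT); apply: lt_le_trans rhoA; rewrite mulrC ltr_pM2l//.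
  by rewrite /A; lra.
have Ex' : E (T x').
  split.
    move=> i; apply: (le_lt_trans (coord_le_norm _ i)); exact: lt_le_trans ar.
  have hdT : hd_coords (T x') - hd_coords (T x) = hd_coords (s *: (w *m M)).
    rewrite Tx' hd_coordsD addrAC subrr add0r; apply/rowP => i; rewrite !mxE eqxx/=.
    by rewrite eq_sym (negbTE (neq_lift ord_max i)) add0r.
  have h1 : ff (hd_coords (T x')) - ff (hd_coords (T x)) <= L * (s * (C * rho)).
    apply: (le_trans (ler_norm _)).
    apply: (le_trans (Lip _ _ (le_lt_trans (hd_coords_norm _) nTx) (le_lt_trans (hd_coords_norm _) nTx'))).
    rewrite ler_wpM2l// hdT (le_trans (hd_coords_norm _))// normrZ gtr0_norm//.
    by rewrite ler_wpM2l// ltW.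
  have h2 : (T x') 0 ord_max >= (T x) 0 ord_max + s - s * (C * rho).
    rewrite Tx'; move: (T x) (w *m M) nw => t q nq; rewrite !mxE eqxx/=.
    have : `|q 0 ord_max| <= C * rho by exact: le_trans (coord_le_norm _ _) nq.
    rewrite ler_norml => /andP[h _].
    have : s * (- (C * rho)) <= s * q 0 ord_max by rewrite ler_wpM2l// ltW.
    by rewrite eqxx mulr1n; lra.
  have h3 : L * (s * (C * rho)) + s * (C * rho) <= s.
    have -> : L * (s * (C * rho)) + s * (C * rho) = s * (rho * ((L + 1) * C)) by ring.
    rewrite -[leRHS]mulr1 ler_wpM2l ?(ltW s0)// (le_trans _ rhoD)//.
    by rewrite ler_wpM2l ?(ltW rho0)// ler_wpM2l ?addr_ge0// lerDl.
  by move: fx h1 h2 h3; lra.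
(* The chart yields a point of [Omega] with the same image as [x']; [T] is injective, so this point
   is [x']. *)
move: Ex'; rewrite -TE => -[z [Oz _] /eqP].
rewrite /T (inj_eq (addIr c)) => /eqP /(congr1 (fun v => v *m M^T)).
by rewrite -!mulmxA MMT !mulmx1 => <-.
Qed.

Lemma cone_everywhere x0 : exists rho nu, 0 < rho /\ cone_at Omega x0 rho nu.
Proof.
have [Ox|nOx] := pselect (Omega x0); first exact: cone_interior.
have [cl|] := pselect (closure Omega x0); last exact: cone_exterior.
by apply: cone_boundary; split => // /interior_subset.
Qed.

End cones.

(** * Weak derivatives and complex-valued functions *)

Section fundamental_lemma.
Context {R : realType} {n : nat}.
Local Notation Rn := 'rV[R]_n.
Local Notation mu := (leb R n).
Hypothesis n0 : (0 < n)%N.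

(* Mollification in L1 is the case [Phi x t = t]; [Delta2] needs an integrable positive
   function, hence the restriction to balls. *)
Let idPhi (x : Rn) (t : R) := t.

Let idPhi_MO (A : set Rn) : MO_function A idPhi.
Proof.
split.
- by [].
- move=> x _ t u v _ _; exact: lexx.
- by [].
- move=> t _; exact: lmeasurable_cst.
Qed.

Let idPhi_A1 (A : set Rn) : A1 A idPhi.
Proof.
exists (1 / 2), (1 / 2); split; [apply/andP; split; lra..|move=> c r r0 /= _].
exists set0; first exact: negligible_set0.
move=> x y _ _ t /andP[t1 _]; rewrite /idPhi; suff t0 : 0 <= t by lra.
apply: le_trans t1; rewrite /MO_inv; case: xgetP => //.
by move=> s _ [].
Qed.

Let idPhi_Delta2 (x0 : Rn) (a : R) : Delta2 (ball x0 a) idPhi.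
Proof.
have mB : measurable (ball x0 a : set (RdL R n)) by apply: open_RdL; exact: ball_open.
exists 2, (fun=> 1); split=> //; last by move=> t _; apply: ae_all => x _; rewrite /idPhi lerDl.
apply/lintegrableP; split; first exact: lmeasurable_cst.
pose M := `|x0| + `|a|; have M0 : 0 <= M by rewrite addr_ge0.
apply: (@le_lt_trans _ _ (lint (cbox M) (fun x : Rn => `|1| : R))); last first.
  rewrite (_ : lint _ _ = lint (cbox M) (\1_(cbox M) : Rn -> R)); last first.
    by apply: eq_lint => x xM; rewrite normr1 indicE mem_set.
  by rewrite lint_indic ?setIid ?leb_cbox ?ltry//; exact: measurable_cbox_RdL.
apply: lintS => //; first exact: measurable_cbox_RdL.
  exact: lmeasurable_cst.
move=> x; rewrite -ball_normE cboxP//= => xa.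
have := lerB_dist x x0; rewrite distrC /M; have := ler_norm a; lra.
Qed.

Definition loc_integrable (Omega : set Rn) (u : Rn -> R) := lmeasurable Omega u /\
  forall K : set Rn, compact K -> K `<=` Omega -> (lint K (fun x => `|u x|%R) < +oo)%E.

Variables (Omega : set Rn) (w : Rn -> R).
Hypothesis oOmega : open Omega.
Hypothesis lw : loc_integrable Omega w.
Hypothesis w0 : forall phi, rtest Omega phi -> rint Omega (fun x => w x * phi x) = 0.

(** For [x] in the ball of radius [a], a kernel of radius at most [a] around [x] is a test function,
    so the mollification of [w] cut to the doubled ball vanishes there. As it converges in L1 to
    [w], the integral of [|w|] over the small ball is below every [l]. *)
Let local_zero (x0 : Rn) (a : R) : 0 < a -> (forall x, `|x - x0| <= 2 * a -> Omega x) ->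
  {ae mu, forall x, ball x0 a x -> w x = 0}.
Proof.
move=> a0 aO; pose B := ball x0 (2 * a).
have oB : open B by exact: ball_open.
have mB : measurable (B : set (RdL R n)) by exact: open_RdL.
have mO : measurable (Omega : set (RdL R n)) by exact: open_RdL.
have mBa : measurable (ball x0 a : set (RdL R n)) by apply: open_RdL; exact: ball_open.
have BO : B `<=` Omega.
  by move=> x; rewrite /B -ball_normE/= => xa; apply: aO; rewrite distrC ltW.
have BaB : ball x0 a `<=` B.
  by apply: le_ball; rewrite mulr_natl mulr2n lerDl ltW.
have [mw Kw] := lw; pose F := w \_ B; pose kk := `|x0| + 2 * a.
have kk0 : 0 <= kk by rewrite addr_ge0// mulr_ge0// ltW.
have mwB : lmeasurable B w by exact: lmeasurableS mw.
have FB x : B x -> F x = w x by move=> Bx; rewrite /F patchE mem_set.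
have FnB x : ~ B x -> F x = 0 by move=> nBx; rewrite /F patchE memNset.
pose KB := [set y : Rn | `|y - x0| <= 2 * a].
have cK : compact KB by apply: compact_shift_cbox; rewrite mulr_ge0// ltW.
have KO : KB `<=` Omega by move=> y; exact: aO.
have mKB : measurable (KB : set (RdL R n)).
  by rewrite -[KB]setCK; apply: measurableC; apply: open_RdL; apply: closed_openC; exact: compact_closed cK.
have HF : LPhi0 B idPhi kk F.
  split.
  - exact: lmeasurable_patch.
  - exact: FnB.
  - move=> x xk; apply: FnB; rewrite /B -ball_normE/= => xa.
    by have := lerB_dist x x0; rewrite distrC; move: xk; rewrite /kk; lra.
  - apply: le_lt_trans (Kw _ cK KO); rewrite /modul /idPhi.
    rewrite (_ : lint B _ = lint B (fun x => `|w x|)); last by apply: eq_lint => x /FB ->.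
    apply: lintS => //.
      by apply: lmeasurable_norm; exact: lmeasurableS mw.
    by move=> x; rewrite /B -ball_normE/= distrC => /ltW.
have iF := LPhi0_integrable n0 oB (@idPhi_MO B) (@idPhi_A1 B) kk0 HF.
have [K [L [K0 L0 moll]]] := mollifier_exists n0 (0 : Rn) (@ltr01 R).
have small l : 0 < l -> (lint (ball x0 a) (fun x => `|w x|%R) <= l%:E)%E.
  move=> l0; have [r1 r10 r1P] := kconv_cvg n0 oB (@idPhi_MO B) (@idPhi_A1 B)
    (@idPhi_Delta2 x0 (2 * a)) K0 kk0 HF l0.
  pose tau := Num.min a (r1 / (2 * L)); have L20 : 0 < 2 * L by rewrite mulr_gt0.
  have tau0 : 0 < tau by rewrite lt_min a0 divr_gt0.
  have taua : tau <= a by rewrite ge_min lexx.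
  have tauL : tau * L < r1.
    apply: (@le_lt_trans _ _ (r1 / (2 * L) * L)).
      by rewrite ler_wpM2r ?(ltW L0)// /tau ge_min lexx orbT.
    rewrite (_ : _ * L = r1 / 2); first by lra.
    by field; rewrite gt_eqF.
  have [k [sk kker ksupp]] := moll tau tau0.
  have r0 : 0 < tau * L by rewrite mulr_gt0.
  have kz z : tau <= `|z| -> k z = 0.
    by move=> zt; apply: ksupp; rewrite mulr1 scaler0 subr0.
  have kF0 x : ball x0 a x -> kconv k F x = 0.
    rewrite -ball_normE/= => xa.
    have inB y : ~ (k (y - x) = 0) -> B y.
      move=> kn; rewrite /B -ball_normE/=; have [/kz //|yx] := leP tau `|y - x|.
      by have := ler_normD (x0 - x) (x - y); rewrite addrA subrK [`|x - y|]distrC; lra.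
    have tk : rtest Omega (fun y => k (y - x)).
      split; first exact: rsmooth_shift.
      exists KB; split => // y nKy; apply: contrapT => /inB.
      by rewrite /B -ball_normE/= distrC => /ltW.
    rewrite -(w0 tk) rint_setT; last first.
      move=> y nOy; have -> : k (y - x) = 0; last by rewrite mulr0.
      by apply: contrapT => /inB/BO.
    apply: eq_rint => y _; rewrite mulrC.
    have [->|/eqP kn] := eqVneq (k (y - x)) 0; first by rewrite !mulr0.
    by rewrite FB//; exact: inB.
  have [_] := r1P _ _ r0 tauL kker; rewrite /modul /idPhi => le1.
  have mkF : lmeasurable B (fun x => (kconv k F x - F x) / l).
    apply: lmeasurable_div; apply: (lmeasurableS measurableT (@subsetT _ _)).
    by apply: lmeasurableB; [exact: kernel_kconv_meas r0 kker iF|exact: lmeasurable_patch].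
  rewrite (_ : lint _ _ = l%:E * lint (ball x0 a) (fun x => `|((kconv k F x - F x) / l)%R|%R))%E; last first.
    rewrite -lintZ//; last 2 first.
    - by apply: lmeasurable_norm; exact: lmeasurableS mkF.
    - exact: ltW.
    apply: eq_lint => x xa; rewrite kF0// FB; last exact: BaB.
    by rewrite sub0r normrM normrN mulrC normfV (gtr0_norm l0) divfK// gt_eqF.
  rewrite -[leRHS]mule1; apply: lee_wpmul2l; first by rewrite lee_fin ltW.
  apply: le_trans le1.
  by apply: lintS => //; exact: lmeasurable_norm.
have mwa : lmeasurable (ball x0 a) w by exact: lmeasurableS mwB.
have lint0 : lint (ball x0 a) (fun x => `|w x|) = 0%E.
  apply/eqP; rewrite eq_le lint_ge0// andbT; apply/lee_addgt0Pr => e e0.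
  by rewrite add0e; exact: small.
have := iffLR (@ae_eq_integral_abs _ _ _ mu (ball x0 a : set (RdL R n)) mBa (fun x : RdL R n => (w x)%:E)
  (lmeasurable_EFin mwa)).
have E0 : (\int[mu]_(x in (ball x0 a : set (RdL R n))) `|(w x)%:E|)%E = 0%E by rewrite -lint0.
by move=> /(_ E0); apply: ae_imp => x /[swap] xa /(_ xa)[].
Qed.

(** Countably many balls, with rational centres and radii [1 / (k + 1)] and with doubled ball in
    [Omega], cover [Omega]. *)
Lemma loc_integrable_eq0 : {ae mu, forall x, Omega x -> w x = 0}.
Proof.
pose I := ('rV[rat]_n * nat)%type.
pose ctr (i : I) : Rn := map_mx ratr i.1; pose rad (i : I) : R := i.2.+1%:R^-1.
pose N (i : I) : set Rn := [set x | (forall y, `|y - ctr i| <= 2 * rad i -> Omega y) /\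
  ball (ctr i) (rad i) x /\ w x <> 0].
have nN i : mu.-negligible (N i).
  have [iO|niO] := pselect (forall y, `|y - ctr i| <= 2 * rad i -> Omega y); last first.
    by apply: negligibleS (@negligible_set0 _ _ _ _) => x [].
  have r0 : 0 < rad i by rewrite invr_gt0.
  apply: negligibleS (local_zero r0 iO) => x [_ [xi wx]] /= h.
  by apply: wx; exact: h.
apply: (negligible_ae (negligible_bigcup_countable nN)) => x nx Ox.
apply: contrapT => wx; apply: nx.
have /nbhs_ballP[e /= e0 eO] := open_nbhs_nbhs (conj oOmega Ox).
(* A third of [e] for the distance to the rational centre and two thirds for the doubled radius. *)
have [k ke] : exists k : nat, k.+1%:R^-1 < e / 3.
  have e30 : 0 < e / 3 by rewrite divr_gt0.
  have := near_infty_natSinv_lt (PosNum e30) => /filter_ex[k kP]; exists k; exact: kP.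
have r0 : 0 < k.+1%:R^-1 :> R by rewrite invr_gt0.
have [q xq] := rat_rV_dense x r0.
exists (q, k) => //; split.
  move=> y; rewrite /ctr /rad/= => yq; apply: eO; rewrite -ball_normE/=.
  apply: (le_lt_trans (ler_distD (map_mx ratr q) _ _)); rewrite [`|map_mx ratr q - y|]distrC.
  have e3 : e = e / 3 + 2 * (e / 3) by field.
  rewrite e3; apply: ltr_leD; first exact: lt_trans ke.
  by apply: (le_trans yq); rewrite ler_pM2l// ltW.
by split=> //; rewrite -ball_normE/= distrC.
Qed.

End fundamental_lemma.

Section real_weak_derivatives.
Context {R : realType} {n : nat}.
Local Notation Rn := 'rV[R]_n.
Local Notation mu := (leb R n).
Hypothesis n0 : (0 < n)%N.
Variable Omega : set Rn.
Hypothesis oOmega : open Omega.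
Implicit Types (u v g h : Rn -> R).

Let mOmega : measurable (Omega : set (RdL R n)).
Proof. exact: open_RdL. Qed.

Lemma compact_RdL (K : set Rn) : compact K -> measurable (K : set (RdL R n)).
Proof.
move=> cK; rewrite -[K]setCK; apply: measurableC; apply: open_RdL.
by apply: closed_openC; exact: compact_closed cK.
Qed.

Lemma lintegrable_loc_mul u psi (K : set Rn) : loc_integrable Omega u ->
  continuous psi -> compact K -> K `<=` Omega -> (forall x, ~ K x -> psi x = 0) ->
  lintegrable Omega (fun x => u x * psi x).
Proof.
move=> [mu_ uK] cpsi cK KO K0.
have pc : cut_off psi.
  have [M MP] := compact_norm_bounded cK.
  by exists (M + 1) => z zM; apply: K0 => /MP; lra.
have [[_ [c c0 cP]] _] := cut_off_bounded cpsi pc.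
have mp : lmeasurable Omega psi by exact: lmeasurable_continuous.
have mK := compact_RdL cK.
have mup : lmeasurable Omega (fun x => u x * psi x) by exact: lmeasurableM.
have muK : lmeasurable K (fun x => `|u x|).
  by apply: lmeasurable_norm; exact: lmeasurableS mu_.
apply/lintegrableP; split => //.
rewrite lint_setT; last by move=> x nO; rewrite K0 ?mulr0 ?normr0// => /KO.
rewrite -(@lint_setT _ _ K); last by move=> x /K0 ->; rewrite mulr0 normr0.
apply: (@le_lt_trans _ _ (lint K (fun x => c * `|u x|))).
  apply: lint_le => //.
  - by apply: lmeasurable_norm; exact: lmeasurableS mup.
  - exact: lmeasurableZ.
  - by move=> x _; rewrite mulr_ge0.
  - by apply: ae_all => x _; rewrite normrM mulrC ler_wpM2r.
rewrite lintZ//; by apply: lte_mul_pinfty => //; exact: uK.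
Qed.

Lemma loc_integrable_ext u v : (forall x, Omega x -> u x = v x) ->
  loc_integrable Omega u -> loc_integrable Omega v.
Proof.
move=> uv [mu_ uK]; split.
  by apply: eq_measurable_fun mu_ => x; rewrite inE => /uv.
move=> K cK KO; have := uK K cK KO; congr (_ < _)%E.
by apply: eq_lint => x /KO/uv ->.
Qed.

Lemma loc_integrableB u v : loc_integrable Omega u -> loc_integrable Omega v ->
  loc_integrable Omega (fun x => u x - v x).
Proof.
move=> [mu_ uK] [mv vK]; split; first exact: lmeasurableB.
move=> K cK KO; have mK := compact_RdL cK.
have muK : lmeasurable K u by exact: lmeasurableS mu_.
have mvK : lmeasurable K v by exact: lmeasurableS mv.
apply: (@le_lt_trans _ _ (lint K (fun x => `|u x| + `|v x|))).
  apply: lint_le => //.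
  - by apply: lmeasurable_norm; exact: lmeasurableB.
  - by apply: lmeasurableD; exact: lmeasurable_norm.
  - by apply: ae_all => x _; exact: ler_normB.
rewrite lintD//; [|exact: lmeasurable_norm..].
by apply: lte_add_pinfty; [exact: uK|exact: vK].
Qed.

Lemma loc_integrable_continuous u : continuous u -> cut_off u -> loc_integrable Omega u.
Proof.
move=> cu uc; have mu_ D : lmeasurable D u by exact: lmeasurable_continuous.
split=> // K cK KO; have /lintegrableP[_ h] := cut_off_integrable cu uc.
apply: le_lt_trans h; apply: lintS => //; first exact: compact_RdL.
exact: lmeasurable_norm.
Qed.

Definition real_weak_partial j u g := [/\ loc_integrable Omega u, loc_integrable Omega g &
  forall psi, rtest Omega psi ->
    rint Omega (fun x => u x * rpartial j psi x) = - rint Omega (fun x => g x * psi x)].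

Lemma rpartial_off_compact (K : set Rn) j psi : compact K -> (forall x, ~ K x -> psi x = 0) ->
  forall x, ~ K x -> rpartial j psi x = 0.
Proof.
move=> cK K0 x nKx; have : nbhs x (~` K).
  by apply: open_nbhs_nbhs; split => //; apply: closed_openC; exact: compact_closed cK.
move=> /nbhs_ballP[e /= e0 eK]; apply: (@rpartial_near_cst _ _ _ _ _ e) => // y yx.
by rewrite !K0//; apply: eK; rewrite -ball_normE/= distrC.
Qed.

Lemma rtest_integrable u j psi : loc_integrable Omega u -> rtest Omega psi ->
  lintegrable Omega (fun x => u x * psi x) /\ lintegrable Omega (fun x => u x * rpartial j psi x).
Proof.
move=> lu [sp [K [cK KO K0]]]; split.
  by apply: lintegrable_loc_mul lu _ cK KO K0; exact: rsmooth_continuous.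
apply: (lintegrable_loc_mul lu _ cK KO).
  by apply: rsmooth_continuous; exact: rsmooth_rpartial.
exact: (rpartial_off_compact j cK K0).
Qed.

Lemma real_weak_partialB j u g v h : real_weak_partial j u g -> real_weak_partial j v h ->
  real_weak_partial j (fun x => u x - v x) (fun x => g x - h x).
Proof.
move=> [lu lg ug] [lv lh vh]; split; [exact: loc_integrableB..|].
move=> psi tp; have [u1 u2] := rtest_integrable j lu tp; have [v1 v2] := rtest_integrable j lv tp.
have [g1 _] := rtest_integrable j lg tp; have [h1 _] := rtest_integrable j lh tp.
transitivity (rint Omega (fun x => u x * rpartial j psi x) - rint Omega (fun x => v x * rpartial j psi x)).
  by rewrite -rintB//; apply: eq_rint => x _; ring.
by rewrite ug// vh// -opprD -rintB//; congr (- _); apply: eq_rint => x _; ring.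
Qed.

Lemma real_weak_partial_ext j u g v h : (forall x, Omega x -> u x = v x) ->
  (forall x, Omega x -> g x = h x) -> real_weak_partial j u g -> real_weak_partial j v h.
Proof.
move=> uv gh [lu lg ug]; split; [exact: loc_integrable_ext lu|exact: loc_integrable_ext lg|].
move=> psi tp; rewrite (_ : rint _ _ = rint Omega (fun x => u x * rpartial j psi x)); last first.
  by apply: eq_rint => x /uv ->.
by rewrite ug//; congr (- _); apply: eq_rint => x /gh ->.
Qed.

(** Integration by parts: the partial of the boundedly supported product [u * psi] has integral
    0. *)
Lemma real_weak_partial_smooth j u : rsmooth u -> cut_off u ->
  real_weak_partial j u (rpartial j u).
Proof.
move=> su uc; have sdu := rsmooth_rpartial j su.
have lu : loc_integrable Omega u by apply: loc_integrable_continuous => //; exact: rsmooth_continuous.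
have lg : loc_integrable Omega (rpartial j u).
  by apply: loc_integrable_continuous; [exact: rsmooth_continuous|exact: cut_off_rpartial].
split => // psi tp; have [_ u2] := rtest_integrable j lu tp.
have [g1 _] := rtest_integrable j lg tp; have [sp [K [cK KO K0]]] := tp.
apply/eqP; rewrite -addr_eq0 -rintD//; apply/eqP.
have sup := rsmoothM su sp.
rewrite -[RHS](@rint_rpartial0 _ _ (fun x => u x * psi x) j sup); last first.
  by have [r rP] := uc; exists r => z /rP ->; rewrite mul0r.
rewrite rint_setT; last first.
  move=> x nO; have nK : ~ K x by move/KO.
  by rewrite (K0 x nK) mulr0 addr0 (rpartial_off_compact j cK K0 nK) mulr0.
by apply: eq_rint => x _; rewrite (rpartialM j su sp); ring.
Qed.

Lemma real_weak_partial_unique j u g h : real_weak_partial j u g -> real_weak_partial j u h ->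
  {ae mu, forall x, Omega x -> g x = h x}.
Proof.
move=> [_ lg ug] [_ lh uh].
have : {ae mu, forall x, Omega x -> g x - h x = 0}.
  apply: loc_integrable_eq0 => //; first exact: loc_integrableB.
  move=> psi tp; have [g1 _] := rtest_integrable j lg tp.
  have [h1 _] := rtest_integrable j lh tp.
  transitivity (rint Omega (fun x => g x * psi x) - rint Omega (fun x => h x * psi x)).
    by rewrite -rintB//; apply: eq_rint => x _; ring.
  by rewrite -[X in X - _]opprK -ug// uh// opprK subrr.
by apply: ae_imp => x h' Ox; apply/eqP; rewrite -subr_eq0; apply/eqP; exact: h'.
Qed.

End real_weak_derivatives.

(** * Reduction of the complex case to real pairs *)

Section complex_functions.
Context {R : realType} {n : nat}.
Local Notation Rn := 'rV[R]_n.
Local Notation mu := (leb R n).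
Local Notation normc := ComplexField.Normc.normc.
Local Notation Re := complex.Re.
Local Notation Im := complex.Im.
Hypothesis n0 : (0 < n)%N.
Variables (Omega : set Rn) (Phi : Rn -> R -> R).
Hypothesis oOmega : open Omega.
Hypothesis PhiMO : MO_function Omega Phi.
Hypothesis PhiA1 : A1 Omega Phi.
Hypothesis Phi_Delta2 : Delta2 Omega Phi.
Implicit Types (f g phi : Rn -> R[i]).

Let mOmega : measurable (Omega : set (RdL R n)).
Proof. exact: open_RdL. Qed.

Lemma Re_le_normc (z : R[i]) : `|Re z| <= normc z.
Proof. by case: z => a b /=; rewrite -sqrtr_sqr ler_wsqrtr// lerDl sqr_ge0. Qed.

Lemma Im_le_normc (z : R[i]) : `|Im z| <= normc z.
Proof. by case: z => a b /=; rewrite -sqrtr_sqr ler_wsqrtr// lerDr sqr_ge0. Qed.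

Lemma normc_ge0 (z : R[i]) : 0 <= normc z.
Proof. by case: z => a b /=; rewrite sqrtr_ge0. Qed.

Lemma normc_le (z : R[i]) : normc z <= `|Re z| + `|Im z|.
Proof.
case: z => a b /=; rewrite -[leRHS]ger0_norm ?addr_ge0// -[leRHS]sqrtr_sqr ler_wsqrtr//.
by rewrite sqrrD !real_normK ?num_real// addrAC lerDl mulrn_wge0.
Qed.

Lemma normc_real (x : R) : normc (x%:C)%C = `|x|.
Proof. by rewrite /= expr0n/= addr0 sqrtr_sqr. Qed.

Lemma lmeasurable_normc f : cmeasurable_fun Omega f -> lmeasurable Omega (fun x => normc (f x)).
Proof.
move=> [mr mi]; rewrite (_ : (fun x => _) =
  fun x => Num.sqrt (Re (f x) * Re (f x) + Im (f x) * Im (f x))); last first.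
  by apply/funext => x; case: (f x).
have ms : measurable_fun setT (@Num.sqrt R) by apply: continuous_measurable_fun; exact: sqrt_continuous.
by apply: (measurableT_comp ms); apply: lmeasurableD; exact: lmeasurableM.
Qed.

Lemma L1loc_real f : L1loc Omega f <->
  loc_integrable Omega (fun x => Re (f x)) /\ loc_integrable Omega (fun x => Im (f x)).
Proof.
split=> [[mf fK]|[[mr rK] [mi iK]]].
  have [mr mi] := mf; have mn := lmeasurable_normc mf.
  have dom (u : Rn -> R) : lmeasurable Omega u -> (forall x, `|u x| <= normc (f x)) ->
      loc_integrable Omega u.
    move=> mu_ uf; split=> // K cK KO; apply: le_lt_trans (fK K cK KO).
    have mK := compact_RdL cK; apply: lint_le => //.
    - by apply: lmeasurable_norm; exact: lmeasurableS mu_.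
    - exact: lmeasurableS mn.
    - by move=> x _; exact: normc_ge0.
    - by apply: ae_all => x _; exact: uf.
  by split; apply: dom => // x; [exact: Re_le_normc|exact: Im_le_normc].
split=> // K cK KO; have mK := compact_RdL cK.
have mrK : lmeasurable K (fun x => Re (f x)) by exact: lmeasurableS mr.
have miK : lmeasurable K (fun x => Im (f x)) by exact: lmeasurableS mi.
apply: (@le_lt_trans _ _ (lint K (fun x => `|Re (f x)| + `|Im (f x)|))).
  apply: lint_le => //.
  - have mf : cmeasurable_fun Omega f by split.
    exact: lmeasurableS (lmeasurable_normc mf).
  - by apply: lmeasurableD; exact: lmeasurable_norm.
  - by move=> x _; exact: normc_ge0.
  - by apply: ae_all => x _; exact: normc_le.
rewrite lintD//; [|exact: lmeasurable_norm..].
by apply: lte_add_pinfty; [exact: rK|exact: iK].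
Qed.

Lemma support_off phi x : ~ Defs.support phi x -> phi x = 0.
Proof.
move=> nx; apply/eqP; apply: contrapT => px; apply: nx.
have phix : [set y | phi y != 0] x by exact/negP.
by have := @subset_closure _ [set y | phi y != 0] x phix.
Qed.

Lemma Ccinfty_rtest phi : Ccinfty phi -> Defs.support phi `<=` Omega ->
  rtest Omega (fun x => Re (phi x)) /\ rtest Omega (fun x => Im (phi x)).
Proof.
by move=> [sr si cs] sO; split; split=> //; exists (Defs.support phi); split=> // x /support_off ->.
Qed.

Lemma Ccinfty_cut_off phi : Ccinfty phi ->
  cut_off (fun x => Re (phi x)) /\ cut_off (fun x => Im (phi x)).
Proof.
move=> [_ _ cs]; have [M MP] := compact_norm_bounded cs.
have off z : M + 1 <= `|z| -> phi z = 0 by move=> zM; apply: support_off => /MP; lra.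
by split; exists (M + 1) => z /off ->.
Qed.

Lemma support_sub (K : set Rn) phi : compact K -> (forall x, ~ K x -> phi x = 0) ->
  compact (Defs.support phi) /\ Defs.support phi `<=` K.
Proof.
move=> cK K0; have sK : Defs.support phi `<=` K.
  rewrite (iffLR (closure_id K) (compact_closed _ cK)); last exact: norm_hausdorff.
  by apply: closure_subset => x /= px; apply: contrapT => /K0 xE; rewrite xE eqxx in px.
split=> //; apply: subclosed_compact cK sK; exact: closed_closure.
Qed.

Lemma rtest_Ccinfty psi : rtest Omega psi ->
  [/\ Ccinfty (fun x => (psi x +i* 0)%C), Defs.support (fun x => (psi x +i* 0)%C) `<=` Omega &
    forall j, partial j (fun x => (psi x +i* 0)%C) = fun x => (rpartial j psi x +i* 0)%C].
Proof.
move=> [sp [K [cK KO K0]]].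
have [cs sK] : compact (Defs.support (fun x => (psi x +i* 0)%C)) /\ Defs.support (fun x => (psi x +i* 0)%C) `<=` K.
  by apply: support_sub => // x /K0 ->.
split; last by move=> j; apply/funext => x; rewrite /partial /= rpartial_cst.
  split; [exact: sp|exact: rsmooth_cst|exact: cs].
exact: subset_trans KO.
Qed.

(** Tested against a real-valued function, the complex identity decouples into its real and
    imaginary parts. *)
Lemma weak_partial_real j f g : L1loc Omega f -> is_weak_partial Omega j f g ->
  real_weak_partial Omega j (fun x => Re (f x)) (fun x => Re (g x)) /\
  real_weak_partial Omega j (fun x => Im (f x)) (fun x => Im (g x)).
Proof.
move=> /L1loc_real[fr fi] [/L1loc_real[gr gi] H].
have key psi : rtest Omega psi ->
    rint Omega (fun x => Re (f x) * rpartial j psi x) = - rint Omega (fun x => Re (g x) * psi x) /\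
    rint Omega (fun x => Im (f x) * rpartial j psi x) = - rint Omega (fun x => Im (g x) * psi x).
  move=> /rtest_Ccinfty[Cp sp pE]; have := H _ Cp sp; rewrite pE => E.
  have E1 : rint Omega (fun x => Re (f x * (rpartial j psi x +i* 0)%C)) =
      - rint Omega (fun x => Re (g x * (psi x +i* 0)%C)) := congr1 (fun z : R[i] => Re z) E.
  have E2 : rint Omega (fun x => Im (f x * (rpartial j psi x +i* 0)%C)) =
      - rint Omega (fun x => Im (g x * (psi x +i* 0)%C)) := congr1 (fun z : R[i] => Im z) E.
  split.
    transitivity (rint Omega (fun x => Re (f x * (rpartial j psi x +i* 0)%C))).
      by apply: eq_rint => x _; case: (f x) => a b /=; rewrite mulr0 subr0.
    rewrite E1; congr (- _).
    by apply: eq_rint => x _; case: (g x) => a b /=; rewrite mulr0 subr0.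
  transitivity (rint Omega (fun x => Im (f x * (rpartial j psi x +i* 0)%C))).
    by apply: eq_rint => x _; case: (f x) => a b /=; rewrite mulr0 add0r.
  rewrite E2; congr (- _).
  by apply: eq_rint => x _; case: (g x) => a b /=; rewrite mulr0 add0r.
by split; split=> // psi /key[].
Qed.

Lemma weak_partial_complex j f g :
  real_weak_partial Omega j (fun x => Re (f x)) (fun x => Re (g x)) ->
  real_weak_partial Omega j (fun x => Im (f x)) (fun x => Im (g x)) ->
  is_weak_partial Omega j f g.
Proof.
move=> [fr gr rE] [fi gi iE]; split; first by apply/L1loc_real.
move=> phi Cp sp; have [ta tb] := Ccinfty_rtest Cp sp.
pose a x := Re (phi x); pose b x := Im (phi x).
have [fra frda] := rtest_integrable oOmega j fr ta; have [frb frdb] := rtest_integrable oOmega j fr tb.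
have [fia fida] := rtest_integrable oOmega j fi ta; have [fib fidb] := rtest_integrable oOmega j fi tb.
have [gra _] := rtest_integrable oOmega j gr ta; have [grb _] := rtest_integrable oOmega j gr tb.
have [gia _] := rtest_integrable oOmega j gi ta; have [gib _] := rtest_integrable oOmega j gi tb.
have E1 : rint Omega (fun x => Re (f x * partial j phi x)) =
    - rint Omega (fun x => Re (g x * phi x)).
  transitivity (rint Omega (fun x => Re (f x) * rpartial j a x) -
      rint Omega (fun x => Im (f x) * rpartial j b x)).
    by rewrite -rintB//; apply: eq_rint => x _; rewrite /partial; case: (f x).
  rewrite rE// iE// -opprD -rintB//; congr (- _).
  by apply: eq_rint => x _; rewrite /a /b; case: (g x) => ? ?; case: (phi x).
have E2 : rint Omega (fun x => Im (f x * partial j phi x)) =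
    - rint Omega (fun x => Im (g x * phi x)).
  transitivity (rint Omega (fun x => Re (f x) * rpartial j b x) +
      rint Omega (fun x => Im (f x) * rpartial j a x)).
    by rewrite -rintD//; apply: eq_rint => x _; rewrite /partial; case: (f x).
  rewrite rE// iE// -opprD -rintD//; congr (- _).
  by apply: eq_rint => x _; rewrite /a /b; case: (g x) => ? ?; case: (phi x).
by rewrite /cintegral; apply/eqP; rewrite eq_complex /=; apply/andP; split; apply/eqP.
Qed.

Lemma weak_partial_spec j f : weakly_differentiable Omega f ->
  is_weak_partial Omega j f (weak_partial Omega j f).
Proof. by move=> [_ /(_ j)[g]]; move=> wg; apply: xgetPex; exists g. Qed.

Lemma modular_normc f l : modular Omega Phi (fun x => (f x / (l%:C)%C)) =
  modul Omega Phi (fun x => normc (f x) / l).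
Proof.
apply: eq_lint => x _; congr (Phi x _).
rewrite ComplexField.Normc.normcM ComplexField.Normc.normcV normc_real.
by rewrite normrM normfV (ger0_norm (normc_ge0 _)).
Qed.

(** The modulus is at most the sum of the absolute values of the two parts; the triangle inequality
    for witnesses adds their bounds. *)
Lemma LPhi_norm_le f l : cmeasurable_fun Omega f -> Nle Omega Phi (fun x => Re (f x)) l ->
  Nle Omega Phi (fun x => Im (f x)) l -> (LPhi_norm Omega Phi f <= (l + l)%:E)%E.
Proof.
move=> mf Nr Ni; have [mr mi] := mf; have mn := lmeasurable_normc mf.
have Nabs (u : Rn -> R) : lmeasurable Omega u -> Nle Omega Phi u l -> Nle Omega Phi (fun x => `|u x|) l.
  move=> mu_; apply: Nle_le => //; first exact: lmeasurable_norm.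
  by apply: ae_all => x _; rewrite normr_id.
have mar : lmeasurable Omega (fun x => `|Re (f x)|) by exact: lmeasurable_norm.
have mai : lmeasurable Omega (fun x => `|Im (f x)|) by exact: lmeasurable_norm.
have Ns := Nle_triangle mOmega PhiMO mar mai (Nabs _ mr Nr) (Nabs _ mi Ni).
have [l0 N1] : Nle Omega Phi (fun x => normc (f x)) (l + l).
  apply: Nle_le Ns => //; first exact: lmeasurableD.
  apply: ae_all => x _; rewrite (ger0_norm (normc_ge0 _)) ger0_norm ?addr_ge0//.
  exact: normc_le.
apply: ereal_inf_lbound; exists (l + l) => //; split => //.
by rewrite modular_normc.
Qed.

Lemma LPhi_modul f : LPhi Omega Phi f ->
  (modul Omega Phi (fun x => Re (f x)) < +oo)%E /\ (modul Omega Phi (fun x => Im (f x)) < +oo)%E.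
Proof.
move=> [mf [l l0 foo]]; have [mr mi] := mf; have mn := lmeasurable_normc mf.
have {}foo : (modul Omega Phi (fun x => l * normc (f x))%R < +oo)%E.
  apply: le_lt_trans foo; rewrite le_eqVlt; apply/orP; left; apply/eqP.
  apply: eq_lint => x _; congr (Phi x _).
  by rewrite ComplexField.Normc.normcM normc_real normrM (ger0_norm (normc_ge0 _)).
have fin (u : Rn -> R) : lmeasurable Omega u -> (forall x, `|u x| <= normc (f x)) ->
    (modul Omega Phi u < +oo)%E.
  move=> mu_ uf; have mlu : lmeasurable Omega (fun x => l * u x) by exact: lmeasurableZ.
  rewrite (_ : u = fun x => l^-1 * (l * u x)); last first.
    by apply/funext => x; rewrite mulKf// gt_eqF.
  apply: modulZ_fin => //; apply: le_lt_trans foo; apply: le_modul => //.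
    exact: lmeasurableZ.
  by apply: ae_all => x _; rewrite !normrM ler_wpM2l// (ger0_norm (normc_ge0 _)).
by split; apply: fin => // x; [exact: Re_le_normc|exact: Im_le_normc].
Qed.

Lemma LPhi_bounded f (c M : R) : 0 <= M -> cmeasurable_fun Omega f ->
  {ae mu, forall x, Omega x -> normc (f x) <= c * \1_(cbox M) x} -> LPhi Omega Phi f.
Proof.
move=> M0 mf fc; split => //; exists 1 => //.
apply: le_lt_trans (modul_cbox_fin n0 mOmega PhiMO PhiA1 Phi_Delta2 c M0).
rewrite (_ : modular _ _ _ = modul Omega Phi (fun x => normc (f x))); last first.
  by apply: eq_lint => x _; rewrite mul1r (ger0_norm (normc_ge0 _)).
apply: le_modul => //; first exact: lmeasurable_normc.
  by apply: lmeasurableZ; apply: lmeasurable_indic; exact: measurable_cbox_RdL.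
apply: ae_imp fc => x h Ox; rewrite (ger0_norm (normc_ge0 _)).
exact: le_trans (h Ox) (ler_norm _).
Qed.

Lemma Sob_of_weak (u : Rn -> R) (g : 'I_n -> Rn -> R) :
  (forall j, real_weak_partial Omega j u (g j)) -> lmeasurable Omega u ->
  (modul Omega Phi u < +oo)%E -> (forall j, modul Omega Phi (g j) < +oo)%E ->
  Sob Omega Phi (u \_ Omega) (fun j => g j \_ Omega).
Proof.
move=> ug mu_ uoo goo.
have LT (v : Rn -> R) : lmeasurable Omega v -> (modul Omega Phi v < +oo)%E -> LPhiT Omega Phi (v \_ Omega).
  move=> mv voo; split; first exact: lmeasurable_patch.
    by move=> x nO; rewrite patchE memNset.
  apply: le_lt_trans voo; rewrite le_eqVlt; apply/orP; left; apply/eqP.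
  by apply: eq_lint => x Ox; rewrite patchE mem_set.
split; first exact: LT.
  by move=> j; have [_ [mg _] _] := ug j; exact: LT.
have pE (v p : Rn -> R) : rint setT (fun x => (v \_ Omega) x * p x) = rint Omega (fun x => v x * p x).
  rewrite -(@rint_setT _ _ Omega); last by move=> x nO; rewrite patchE memNset// mul0r.
  by apply: eq_rint => x Ox; rewrite patchE mem_set.
by move=> j phi tp; rewrite !pE; have [_ _] := ug j; exact.
Qed.

Lemma restrictionE phi x : Omega x -> restriction Omega phi x = phi x.
Proof. by move=> Ox; rewrite /restriction /patch mem_set. Qed.

Lemma restriction_weak_partial phi j : Ccinfty phi ->
  real_weak_partial Omega j (fun x => Re (restriction Omega phi x)) (rpartial j (fun x => Re (phi x))) /\
  real_weak_partial Omega j (fun x => Im (restriction Omega phi x)) (rpartial j (fun x => Im (phi x))).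
Proof.
move=> Cp; have [cr ci] := Ccinfty_cut_off Cp; have [sr si _] := Cp.
by split; [have := real_weak_partial_smooth oOmega j sr cr|
  have := real_weak_partial_smooth oOmega j si ci];
  apply: real_weak_partial_ext => // x Ox; rewrite restrictionE.
Qed.

Lemma weak_partial_ae j f g h : L1loc Omega f -> is_weak_partial Omega j f g ->
  is_weak_partial Omega j f h -> {ae mu, forall x, Omega x -> g x = h x}.
Proof.
move=> Lf /(weak_partial_real Lf)[gr gi] /(weak_partial_real Lf)[hr hi].
have := ae_and (real_weak_partial_unique n0 oOmega gr hr) (real_weak_partial_unique n0 oOmega gi hi).
apply: ae_imp => x [h1 h2] Ox; have := h1 Ox; have := h2 Ox.
by case: (g x) => a b; case: (h x) => a' b' /= -> ->.
Qed.

Lemma LPhi_smooth_ae f (u v : Rn -> R) : cmeasurable_fun Omega f -> rsmooth u -> rsmooth v ->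
  cut_off u -> cut_off v -> {ae mu, forall x, Omega x -> f x = (u x +i* v x)%C} ->
  LPhi Omega Phi f.
Proof.
move=> mf su sv uc vc fE; have [c [M [c0 M0 cP]]] := cut_off_indic_le (rsmooth_continuous su) uc.
have [c' [M' [c'0 M'0 cP']]] := cut_off_indic_le (rsmooth_continuous sv) vc.
pose M1 := Num.max M M'; have M10 : 0 <= M1 by rewrite le_max M0.
have mono (m : R) x : 0 <= m -> m <= M1 -> \1_(cbox m) x <= \1_(cbox M1) x :> R.
  move=> m0 mM; rewrite !indicE; have [xm|xm] := leP `|x| m; last first.
    by rewrite memNset ?ler0n// cboxP//= leNgt xm.
  by rewrite !mem_set// cboxP// /mkset (le_trans xm).
apply: (@LPhi_bounded f (c + c') M1) => //; apply: ae_imp fE => x fx Ox; rewrite (fx Ox).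
apply: (le_trans (normc_le _)); rewrite mulrDl; apply: lerD => /=.
  by apply: (le_trans (cP x)); rewrite ler_wpM2l// mono// le_max lexx.
by apply: (le_trans (cP' x)); rewrite ler_wpM2l// mono// le_max lexx orbT.
Qed.

Lemma W1Phi_restriction phi : Ccinfty phi -> W1Phi Omega Phi (restriction Omega phi).
Proof.
move=> Cp; have [cr ci] := Ccinfty_cut_off Cp; have [sr si _] := Cp.
have wp j : is_weak_partial Omega j (restriction Omega phi) (partial j phi).
  have [h1 h2] := restriction_weak_partial j Cp.
  exact: (@weak_partial_complex j (restriction Omega phi) (partial j phi) h1 h2).
have Lr : L1loc Omega (restriction Omega phi).
  apply/L1loc_real; split.
    apply: (loc_integrable_ext (u := fun x => Re (phi x))).
      by move=> x Ox; rewrite restrictionE.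
    by apply: loc_integrable_continuous => //; exact: rsmooth_continuous.
  apply: (loc_integrable_ext (u := fun x => Im (phi x))).
    by move=> x Ox; rewrite restrictionE.
  by apply: loc_integrable_continuous => //; exact: rsmooth_continuous.
have wd : weakly_differentiable Omega (restriction Omega phi).
  by split => // j; exists (partial j phi).
split; first exact: wd.
  apply: (LPhi_smooth_ae (u := fun x => Re (phi x)) (v := fun x => Im (phi x)));
    [by case: Lr|exact: sr|exact: si|exact: cr|exact: ci|].
  by apply: ae_all => x Ox; rewrite restrictionE//; case: (phi x).
(* The chosen representative agrees with the classical partial only almost everywhere, which is why
   the membership criterion is stated with an almost everywhere equality. *)
move=> j; have wj := weak_partial_spec j wd.
apply: (LPhi_smooth_ae (u := rpartial j (fun x => Re (phi x))) (v := rpartial j (fun x => Im (phi x)))).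
- by have [[]] := wj.
- exact: rsmooth_rpartial.
- exact: rsmooth_rpartial.
- exact: cut_off_rpartial.
- exact: cut_off_rpartial.
- exact: (weak_partial_ae Lr wj (wp j)).
Qed.

Hypothesis cone : forall x0, exists rho nu, 0 < rho /\ cone_at Omega x0 rho nu.

Lemma W1Phi_approx f (l : R) : W1Phi Omega Phi f -> 0 < l -> exists2 phi, Ccinfty phi &
  (LPhi_norm Omega Phi (fun x => f x - restriction Omega phi x)%R <= (l + l)%:E)%E /\
  forall j, (LPhi_norm Omega Phi (weak_partial Omega j (fun x => f x - restriction Omega phi x)%R)
    <= (l + l)%:E)%E.
Proof.
move=> [wd Lf Lw] l0; have [L1f _] := wd; have [mf _] := L1f; have [mr mi] := mf.
pose w j := weak_partial Omega j f.
have ww j : is_weak_partial Omega j f (w j) by exact: weak_partial_spec.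
have wr j := (weak_partial_real L1f (ww j)).1; have wi j := (weak_partial_real L1f (ww j)).2.
have [rfin ifin] := LPhi_modul Lf.
have Sr := Sob_of_weak wr mr rfin (fun j => (LPhi_modul (Lw j)).1).
have Si := Sob_of_weak wi mi ifin (fun j => (LPhi_modul (Lw j)).2).
have [a [sa ac aN adN]] := Sob_approximable n0 oOmega PhiMO PhiA1 Phi_Delta2 cone Sr l0.
have [b [sb bc bN bdN]] := Sob_approximable n0 oOmega PhiMO PhiA1 Phi_Delta2 cone Si l0.
pose phi x := (a x +i* b x)%C.
have Cp : Ccinfty phi.
  split; [exact: sa|exact: sb|have [r rP] := ac; have [r' rP'] := bc].
  pose M := Num.max 0 (Num.max r r').
  have M0 : 0 <= M by rewrite le_max lexx.
  apply: (@support_sub (cbox M) phi _ _).1; first exact: cbox_compact.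
  move=> x; rewrite cboxP//= => /negP; rewrite -ltNge !gt_max => /andP[_ /andP[h1 h2]].
  by rewrite /phi rP ?rP'// ltW.
exists phi => //; set F := fun x => _.
have [pr pi] : (forall j, real_weak_partial Omega j (fun x => Re (F x)) (fun x => Re (w j x) - rpartial j a x)) /\
    (forall j, real_weak_partial Omega j (fun x => Im (F x)) (fun x => Im (w j x) - rpartial j b x)).
  split => j; have [h1 h2] := restriction_weak_partial j Cp.
    have := real_weak_partialB oOmega (wr j) h1; apply: real_weak_partial_ext => // x _.
    by rewrite /F; case: (f x) => ? ?; case: (restriction Omega phi x).
  have := real_weak_partialB oOmega (wi j) h2; apply: real_weak_partial_ext => // x _.
  by rewrite /F; case: (f x) => ? ?; case: (restriction Omega phi x).
(* An explicit weak derivative of the difference, built from the two real approximations; the chosen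
   one equals it almost everywhere. *)
pose W j x := ((Re (w j x) - rpartial j a x) +i* (Im (w j x) - rpartial j b x))%C.
have WW j : is_weak_partial Omega j F (W j) by apply: weak_partial_complex; [exact: pr|exact: pi].
(* Local integrability of [F] is recorded in each of its real weak partials, so any coordinate
   provides it. *)
have j0 : 'I_n by exact: Ordinal n0.
have L1F : L1loc Omega F.
  by apply/L1loc_real; split; [have [] := pr j0|have [] := pi j0].
have wdF : weakly_differentiable Omega F by split => // j; exists (W j).
have Next (u v : Rn -> R) : lmeasurable Omega u -> lmeasurable Omega v ->
    {ae mu, forall x, Omega x -> u x = v x} -> Nle Omega Phi v l -> Nle Omega Phi u l.
  by move=> mu_ mv uv; apply: Nle_le => //; apply: ae_imp uv => x h Ox; rewrite h.
have ma : lmeasurable Omega a by exact: rsmooth_lmeasurable.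
have mb : lmeasurable Omega b by exact: rsmooth_lmeasurable.
have mp (u : Rn -> R) : lmeasurable Omega u -> lmeasurable Omega (u \_ Omega).
  by move=> mu_; apply: lmeasurableS (lmeasurable_patch mOmega mu_).
split.
  have [mF _] := L1F; have [mFr mFi] := mF; apply: LPhi_norm_le; first exact: mF.
    apply: Next aN; [exact: mFr|by apply: lmeasurableB => //; exact: mp|].
    apply: ae_all => x Ox; rewrite /F restrictionE// patchE mem_set//.
    by case: (f x).
  apply: Next bN; [exact: mFi|by apply: lmeasurableB => //; exact: mp|].
  apply: ae_all => x Ox; rewrite /F restrictionE// patchE mem_set//.
  by case: (f x).
move=> j; have wj := weak_partial_spec j wdF; have E := weak_partial_ae L1F wj (WW j).
have [[mw _] _] := wj; have [mwr mwi] := mw.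
have [[[mjr mji] _] _] := ww j.
have mda : lmeasurable Omega (rpartial j a) by apply: rsmooth_lmeasurable; exact: rsmooth_rpartial.
have mdb : lmeasurable Omega (rpartial j b) by apply: rsmooth_lmeasurable; exact: rsmooth_rpartial.
apply: LPhi_norm_le; first exact: mw.
  apply: Next (adN j); [exact: mwr|by apply: lmeasurableB => //; exact: mp|].
  by apply: ae_imp E => x h Ox; rewrite h// patchE mem_set.
apply: Next (bdN j); [exact: mwi|by apply: lmeasurableB => //; exact: mp|].
by apply: ae_imp E => x h Ox; rewrite h// patchE mem_set.
Qed.

Lemma W1Phi_density : W1Phi_dense Omega Phi [set restriction Omega phi | phi in Ccinfty].
Proof.
split; first by move=> _ [phi Cp <-]; exact: W1Phi_restriction.
(* The Sobolev norm has [n + 1] terms, each at most [2 * l], which adds up to [eps / 2]. *)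
move=> f Wf eps e0; pose l := eps / (4 * n.+1%:R).
have l0 : 0 < l by rewrite divr_gt0// mulr_gt0.
have [phi Cp [h hj]] := W1Phi_approx Wf l0.
exists (restriction Omega phi); first by exists phi.
apply: (@le_lt_trans _ _ ((l + l)%:E + \sum_(j < n) (l + l)%:E)%E).
  by apply: leeD; [exact: h|apply: lee_sum => j _; exact: hj].
rewrite sumEFin -EFinD lte_fin sumr_const card_ord -mulrS -[ltLHS]mulr_natl.
have n1 : 0 < n.+1%:R :> R by [].
have -> : n.+1%:R * (l + l) = eps / 2 by rewrite /l; field; rewrite gt_eqF.
lra.
Qed.

End complex_functions.

Unset Implicit Arguments.

Theorem theorem2p13 (R : realType) (d : nat) (Omega : set 'rV[R]_d.+1)
    (Phi : 'rV[R]_d.+1 -> R -> R)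
    (Omega_open : open Omega)
    (Omega_C1 : C1_boundary Omega)
    (Phi_MO : MO_function Omega Phi)
    (Phi_A1 : A1 Omega Phi)
    (Phi_Delta2 : Delta2 Omega Phi) :
  W1Phi_dense Omega Phi [set restriction Omega phi | phi in Ccinfty].
Proof.
exact: (W1Phi_density (ltn0Sn d) Omega_open Phi_MO Phi_A1 Phi_Delta2
  (cone_everywhere Omega_open Omega_C1)).
Qed.
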